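(* With the notation of the context, when $|t|$ is small, $S_{r,c}\cap Y_t$ in a normal region is a generalized special Lagrangian submanifold of $Y_t$ with respect to the symplectic form $\check\omega_t=(\omega-\partial\bar\partial\mu)|_{Y_t}$ and the holomorphic volume form $$\Omega_t=\prod_{k=1}^{n}\frac{dz_k}{z_k}.$$ Here $\mu$ is the function of $z'$ determined by the same constants $c$ and $|t|$ as $S_{r,c}$.
   Context: Index sets: $I''=\{0,\dots,l\}$, $I'=\{l+1,\dots,n\}$. On $\mathbb C^{n+1}$ use coordinates $\tilde z=(z_0,\dots,z_n)=(\tilde z'',z')$, $\tilde z''=(z_0,\dots,z_l)$, $z'=(z_{l+1},\dots,z_n)$, $z_k=|z_k|e^{i\theta_k}$. A toric (torus-invariant) K\''ahler metric is given by $\omega=\partial\bar\partial\big(\sum_{k\in I''}\lambda_k(z')|z_k|^2+\rho(z')\big)$, where $\lambda_k>0$ and $\rho$ are smooth functions of the $|z_j|^2$, $j\in I'$. Convention: K\''ahler forms are written $\partial\bar\partial(\text{potential})$ without a factor $i$. $p(z')$ is a holomorphic function, $t\neq0$ is a constant, and $Y_t=\{\tilde z\in\mathbb C^{n+1}: z_0z_1\cdots z_n=tp(z')\}$; $(z_1,\dots,z_n)$ are used as coordinates on $Y_t$. Let $\Lambda(z')=\prod_{k\in I''}\lambda_k(z')$, $\tilde\Lambda(z')=\Lambda(z')\prod_{j\in I'}|z_j|^{-2}$, $\kappa(z')=\tilde\Lambda(z')|tp(z')|^2$. For constants $c=(c_0,\dots,c_l)$ with $0=c_0\le c_1\le\dots\le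 c_l$, let $\eta=\eta(z')\geq 0$ be the real function with $\prod_{k\in I''}(c_k+\eta)=\kappa(z')$, and $$\mu=(l+1)\eta-\sum_{k\in I''}c_k\log(c_k+\eta)$$ (so that $d\mu/d\log\kappa=\eta$). For $r=(r_{l+1},\dots,r_n)$ with $r_j>0$, $$S_{r,c}=\{\tilde z\in\mathbb C^{n+1}: |z_j|=r_j\ (j\in I'),\ \lambda_k(z')|z_k|^2=c_k+\eta(z')\ (k\in I'')\}.$$ A (bounded) region of $\mathbb C^{n+1}$ is called normal if in it $|p(z')|\ge C>0$ for a constant $C$ and $\epsilon(\tilde z)=\max_{j\in I'}|z_0|/|z_j|$ is small (smaller than a sufficiently small constant). Everything is considered near $S_{r,c}$ in such a region. Generalized special Lagrangian: for an $m$-dimensional complex manifold with a symplectic form $\omega$ and a nowhere vanishing holomorphic $m$-form $\Omega$, a real $m$-dimensional submanifold $L$ is generalized special Lagrangian if $\omega|_L=0$ and $\Omega|_L$ has constant phase. *)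

(* Defs.v *)
From HB Require Import structures.
From mathcomp Require Import all_boot all_order all_algebra.
From mathcomp Require Import complex.
From mathcomp Require Import all_classical all_reals all_analysis.

Set Implicit Arguments.
Unset Strict Implicit.
Unset Printing Implicit Defensive.

Import Order.TTheory GRing.Theory Num.Theory.
Import numFieldNormedType.Exports.

Local Open Scope classical_set_scope.
Local Open Scope ring_scope.
Local Open Scope complex_scope.

(* C^N is the real normed space of pairs (x, y) standing for z = x + iy, so that
   the derivatives of MathComp-Analysis are real derivatives. The type R[i] is
   only used for complex values and coefficients. *)
Notation "''Cn[' R ]_ N" := ('rV[R]_N * 'rV[R]_N)%type
  (at level 8, N at level 2, format "''Cn[' R ]_ N") : type_scope.

Section ComplexSpace.
Context {R : realType} {N : nat}.

Definition coord (z : 'Cn[R]_N) (k : 'I_N) : R[i] := z.1 0 k +i* z.2 0 k.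

Definition cscale (a : R[i]) (u : 'Cn[R]_N) : 'Cn[R]_N :=
  (complex.Re a *: u.1 - complex.Im a *: u.2,
   complex.Re a *: u.2 + complex.Im a *: u.1).

Definition e_re (k : 'I_N) : 'Cn[R]_N := (delta_mx 0 k, 0).
Definition e_im (k : 'I_N) : 'Cn[R]_N := (0, delta_mx 0 k).

End ComplexSpace.

Definition cmod {R : realType} (a : R[i]) : R := Normc.normc a.

(* C^infinity on the open set U: all iterated directional derivatives exist and
   are differentiable at every point of U. *)
Definition smooth {R : realType} {V : normedModType R} (U : set V) (f : V -> R) :=
  forall (vs : seq V) (x : V), U x ->
    differentiable (foldr (fun v g => 'D_v g) f vs) x.

Section Derivatives.
Context {R : realType} {N : nat}.
Implicit Types (f : 'Cn[R]_N -> R[i]) (U : set 'Cn[R]_N).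

Definition csmooth U f :=
  smooth U (fun z => complex.Re (f z)) /\ smooth U (fun z => complex.Im (f z)).

Definition cderive (v : 'Cn[R]_N) f : 'Cn[R]_N -> R[i] := fun z =>
  'D_v (fun w => complex.Re (f w)) z +i*
  'D_v (fun w => complex.Im (f w)) z.

(* the Wirtinger derivatives d/dz_k and d/d(conj z_k) *)
Definition dz (k : 'I_N) f : 'Cn[R]_N -> R[i] := fun z =>
  (cderive (e_re k) f z - 'i%C * cderive (e_im k) f z) / 2.
Definition dzbar (k : 'I_N) f : 'Cn[R]_N -> R[i] := fun z =>
  (cderive (e_re k) f z + 'i%C * cderive (e_im k) f z) / 2.

(* C^infinity and Cauchy-Riemann in each variable *)
Definition holomorphic U f :=
  csmooth U f /\ forall z, U z -> forall k, dzbar k f z = 0.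

End Derivatives.

Section Forms.
Context {R : realType} {N : nat}.

(* a 2-form, as a function of the base point and of two real tangent vectors *)
Definition form2 := 'Cn[R]_N -> 'Cn[R]_N -> 'Cn[R]_N -> R[i].

(* the 2-form sum_{j,k} f_{j kbar} dz_j /\ d(conj z_k) *)
Definition ddbar (f : 'Cn[R]_N -> R[i]) : form2 := fun z u v =>
  \sum_(j < N) \sum_(k < N) dz j (dzbar k f) z *
    (coord u j * conjc (coord v k) - coord v j * conjc (coord u k)).

(* the Hermitian matrix (f_{j kbar}) is positive definite everywhere, i.e.
   ddbar f is a Kaehler form on C^N; in R[i], 0 < a means a real and positive *)
Definition kahler_potential (f : 'Cn[R]_N -> R[i]) :=
  forall z u : 'Cn[R]_N, u != 0 ->
    0 < \sum_(j < N) \sum_(k < N)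
          dz j (dzbar k f) z * coord u j * conjc (coord u k).

Definition d2 (w : form2) (z u1 u2 u3 : 'Cn[R]_N) : R[i] :=
  cderive u1 (fun x => w x u2 u3) z - cderive u2 (fun x => w x u1 u3) z
  + cderive u3 (fun x => w x u1 u2) z.

(* w is a C^infinity 2-form on U. Kaehler forms are written without the factor i,
   so it is 'i * w that is a real form. *)
Definition is_form2 (U : set 'Cn[R]_N) (w : form2) :=
  [/\ forall z, U z -> forall (a : R) u1 u2 v,
        w z (a *: u1 + u2) v = a%:C * w z u1 v + w z u2 v,
      forall z, U z -> forall u v, w z u v = - w z v u,
      forall z, U z -> forall u v, complex.Re (w z u v) = 0 &
      forall u v, csmooth U (fun z => w z u v)].

(* a complex d-form, as a function of the base point and of d tangent vectors *)
Definition cform (d : nat) := 'Cn[R]_N -> ('I_d -> 'Cn[R]_N) -> R[i].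

(* dfwith v i u is v with its i-th entry replaced by u *)
Definition holomorphic_form (d : nat) (U : set 'Cn[R]_N) (Om : cform d) :=
  [/\ forall z, U z -> forall v i (a : R[i]) (u1 u2 : 'Cn[R]_N),
        Om z (dfwith v i (cscale a u1 + u2)) =
        a * Om z (dfwith v i u1) + Om z (dfwith v i u2),
      forall z, U z -> forall v i j, i != j -> v i = v j -> Om z v = 0 &
      forall v, holomorphic U (fun z => Om z v)].

End Forms.
Arguments form2 : clear implicits.
Arguments cform : clear implicits.

Section Submanifolds.
Context {R : realType} {N : nat}.
Implicit Types M Y L : set 'Cn[R]_N.

(* tangent vectors as velocities of curves in M *)
Definition tangent M (z v : 'Cn[R]_N) :=
  exists g : R -> 'Cn[R]_N,
    [/\ g 0 = z, \forall s \near (0 : R), M (g s) &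
        is_derive (0 : R) (1 : R) g v].

(* embedded C^infinity submanifold of real dimension d, locally the zero set of a
   submersion to R^q with d + q = 2N *)
Definition real_submanifold (d : nat) M :=
  forall z, M z -> exists (q : nat) (W : set 'Cn[R]_N)
      (F : 'I_q -> 'Cn[R]_N -> R),
    [/\ (d + q)%N = (2 * N)%N, open W /\ W z, forall i, smooth W (F i),
        forall b : 'I_q -> R, exists v, forall i, 'D_v (F i) z = b i &
        M `&` W = W `&` [set x | forall i, F i x = 0]].

Definition complex_submanifold (d : nat) Y :=
  forall z, Y z -> exists (q : nat) (W : set 'Cn[R]_N)
      (F : 'I_q -> 'Cn[R]_N -> R[i]),
    [/\ (d + q)%N = N, open W /\ W z, forall i, holomorphic W (F i),
        forall b : 'I_q -> R[i], exists v, forall i, cderive v (F i) z = b i &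
        Y `&` W = W `&` [set x | forall i, F i x = 0]].

(* The symplectic form on Y is the restriction to Y of a 2-form w defined on a
   neighbourhood of Y. *)
Definition symplectic_on Y (w : form2 R N) :=
  [/\ exists O : set 'Cn[R]_N, [/\ open O, Y `<=` O & is_form2 O w],
      forall z, Y z -> forall u1 u2 u3,
        tangent Y z u1 -> tangent Y z u2 -> tangent Y z u3 ->
        d2 w z u1 u2 u3 = 0 &
      forall z, Y z -> forall u, tangent Y z u -> u != 0 ->
        exists2 v, tangent Y z v & w z u v != 0].

(* Likewise a holomorphic d-form on Y is the restriction of an ambient one. *)
Definition holomorphic_volume_form (d : nat) Y (Om : cform R N d) :=
  (exists O : set 'Cn[R]_N, [/\ open O, Y `<=` O & holomorphic_form O Om]) /\
  (forall z, Y z ->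
     exists2 v : 'I_d -> 'Cn[R]_N, (forall i, tangent Y z (v i)) & Om z v != 0).

(* Om|_L is nowhere zero and is a constant e, |e| = 1, times a real form *)
Definition constant_phase (d : nat) L (Om : cform R N d) :=
  (forall z, L z ->
     exists2 v : 'I_d -> 'Cn[R]_N, (forall i, tangent L z (v i)) & Om z v != 0) /\
  exists2 e : R[i], cmod e = 1 &
    forall z, L z -> forall v : 'I_d -> 'Cn[R]_N, (forall i, tangent L z (v i)) ->
      exists s : R, Om z v = e * s%:C.

Definition gen_special_lagrangian (d : nat) Y (w : form2 R N) (Om : cform R N d) L :=
  [/\ [/\ complex_submanifold d Y, symplectic_on Y w &
          holomorphic_volume_form Y Om],
      L `<=` Y /\ real_submanifold d L,
      forall z, L z -> forall u v, tangent L z u -> tangent L z v -> w z u v = 0 &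
      constant_phase L Om].

End Submanifolds.

(* The index set {0, ..., n} with n = l + m is 'I_(l.+1 + m): the indices in I''
   are lshift m k for k : 'I_l.+1, those in I' are rshift l.+1 j for j : 'I_m. *)
Section Toric.
Context {R : realType} {l m : nat}.

Definition zprime (z : 'Cn[R]_(l.+1 + m)) : 'Cn[R]_m := (rsubmx z.1, rsubmx z.2).

Definition sqmods (z' : 'Cn[R]_m) : 'rV[R]_m := \row_j cmod (coord z' j) ^+ 2.

(* lam k and rho take the variables |z_j|^2, j in I', as arguments. *)
Implicit Types (lam : 'I_l.+1 -> 'rV[R]_m -> R) (rho : 'rV[R]_m -> R).
Implicit Types (p : 'Cn[R]_m -> R[i]) (t : R[i]) (c : 'I_l.+1 -> R) (r : 'I_m -> R).

Definition potential lam rho (z : 'Cn[R]_(l.+1 + m)) : R :=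
  \sum_k lam k (sqmods (zprime z)) * cmod (coord z (lshift m k)) ^+ 2
  + rho (sqmods (zprime z)).

Definition toric_kahler lam rho :=
  [/\ forall k, smooth setT (lam k),
      smooth setT rho,
      forall k z', 0 < lam k (sqmods z') &
      kahler_potential (fun z => (potential lam rho z)%:C)].

Definition Yt p t : set 'Cn[R]_(l.+1 + m) :=
  [set z | \prod_k coord z k = t * p (zprime z)].

Definition kappa lam p t (z' : 'Cn[R]_m) : R :=
  (\prod_k lam k (sqmods z')) * (\prod_j (cmod (coord z' j) ^+ 2)^-1)
  * cmod (t * p z') ^+ 2.

(* for 0 = c_0 <= ... <= c_l and kap >= 0, the unique e >= 0 such that
   prod_k (c_k + e) = kap *)
Definition eta_of c (kap : R) : R :=
  xget 0 [set e : R | 0 <= e /\ \prod_k (c k + e) = kap].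

Definition eta lam p t c (z' : 'Cn[R]_m) : R := eta_of c (kappa lam p t z').

Definition mu lam p t c (z' : 'Cn[R]_m) : R :=
  l.+1%:R * eta lam p t c z'
  - \sum_k c k * ln (c k + eta lam p t c z').

Definition Src lam p t c r : set 'Cn[R]_(l.+1 + m) :=
  [set z | (forall j, cmod (coord z (rshift l.+1 j)) = r j) /\
           (forall k, lam k (sqmods (zprime z)) * cmod (coord z (lshift m k)) ^+ 2
                      = c k + eta lam p t c (zprime z))].

(* max_{j in I'} |z_0| / |z_j|, meaningful when no z_j vanishes *)
Definition epsilon (z : 'Cn[R]_(l.+1 + m)) : R :=
  \big[Num.max/0]_j
    (cmod (coord z (lshift m ord0)) / cmod (coord z (rshift l.+1 j))).

(* U is a region inside the ball of radius B in which |p| >= C and epsilon < eps *)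
Definition normal_region p (B C eps : R) (U : set 'Cn[R]_(l.+1 + m)) :=
  open U /\
  forall z, U z ->
    [/\ `|z| <= B, C <= cmod (p (zprime z)),
        forall j, coord z (rshift l.+1 j) != 0 & epsilon z < eps].

(* omega - ddbar mu, on C^(n+1); mu is a function of z' *)
Definition omega_check lam rho p t c : form2 R (l.+1 + m) := fun z u v =>
  ddbar (fun w => (potential lam rho w)%:C) z u v
  - ddbar (fun w => (mu lam p t c (zprime w))%:C) z u v.

(* the wedge product of the dz_k / z_k for k = 1, ..., n; the index k of the
   coordinate z_k is lift ord0 of its rank k - 1 *)
Definition Omega_t : cform R (l.+1 + m) (l + m) := fun z v =>
  \det (\matrix_(i < l + m, k < l + m)
    (coord (v i) (lift ord0 k : 'I_(l.+1 + m)) /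
     coord z (lift ord0 k : 'I_(l.+1 + m)))).

End Toric.

(* Main.v *)
Require Import Defs.
From HB Require Import structures.
From mathcomp Require Import all_boot all_order all_algebra.
From mathcomp Require Import complex.
From mathcomp Require Import all_classical all_reals all_analysis.
From mathcomp Require Import ring lra.
(* The name coord is also that of a function on bases of vector spaces. *)
Import Defs.

(** On the torus where all coordinates and [p] are nonzero, put
    [tau = log kappa] and [phi_k = log (lambda_k |z_k|^2)]. The forms at hand are
    [ddbar] of a real function [f], and are governed by the real bilinear operator
    [Kop f u v = D_u D_v f + D_(iu) D_(iv) f]: the 2-form is [i/2] times
    [Kop f u (iv)], and the form is positive when [Kop f u u > 0]. Since
    [log |g|^2] is pluriharmonic for [g] holomorphic, [Kop phi_k = Kop log lambda_k]
    and [Kop tau = sum_k Kop log lambda_k].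

    The potential of the modified form is
    [f = sum_k exp phi_k + rho - M (tau)] with [M' = eta] and
    [M'' = (sum_k 1 / A_k)^-1], where [A_k = c_k + eta]. At a point where
    [exp phi_k = A_k], the chain rule gives
    [Kop f = (sum_k c_k Kop log lambda_k + Kop rho) + sum_k A_k |d phi_k|^2
             - (sum_k 1 / A_k)^-1 |d tau|^2] ([Kop_potc]),
    the coefficient [eta] of [Kop tau] cancelling the excess of [A_k] over [c_k];
    this is the purpose of subtracting [mu].

    Positivity on the tangent space of [Y_t] ([potc_gt0]): along [Y_t] one has
    [d tau = sum_k d phi_k], so that the last two terms together are nonnegative by
    the Cauchy-Schwarz inequality. The first term is the Kaehler form of [omega] at
    the point over [z'] with [lambda_k |z_k|^2 = c_k], on the lift of the direction
    which makes every [lambda_k |z_k|^2] stationary ([base_form_gt0]), and so it is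
    positive. Vectors with [z'] component zero are dealt with by the middle term.
    By compactness of the sphere this positivity holds on a neighbourhood of the
    fibre ([positive_regionP]); closedness is the symmetry of third derivatives.

    Isotropy ([potc_isotropic]): on tangent vectors of the fibre, the first term
    vanishes as it comes from a torus-invariant function of [z'] evaluated on
    vectors tangent to the torus orbits, and [A_k d phi_k = d eta =
    (sum_k 1 / A_k)^-1 d tau] makes the last two terms cancel.

    Phase ([fibre_constant_phase]): on the fibre, [d z_j / z_j = i d theta_j] for
    [j] in [I'], and [d z_k / z_k] is [i d theta_k] plus a combination of the
    [d theta_j], because [|z_k|] depends on [z'] only. The matrix of logarithmic
    derivatives is thus a real matrix times a block triangular one with [i] on the
    diagonal, and [Omega_t] is [i^n] times a real form. It does not vanish because
    the angles [theta_1, ..., theta_n] vary independently on the fibre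
    ([fibre_tangent_rotation]): rotate [z_1, ..., z_n] at given speeds, correct the
    moduli of the [z_k], and let [z_0] be determined by the equation of [Y_t]. The
    modulus of [z_0] is then right, since [prod_k A_k = kappa] ([fibreP]). *)


Set Implicit Arguments.
Unset Strict Implicit.
Unset Printing Implicit Defensive.

Import Order.TTheory GRing.Theory Num.Theory.
Import numFieldNormedType.Exports.

Local Open Scope classical_set_scope.
Local Open Scope ring_scope.
Local Open Scope complex_scope.

(** * Smooth functions and the symmetry of second derivatives *)

Section SmoothCalculus.
Context {R : realType}.
Implicit Types V W : normedModType R.

(** Smoothness up to a finite order, recursive on the order: unlike the
    definition by lists of directions it lends itself to induction. *)
Fixpoint smoothn V (n : nat) (U : set V) (f : V -> R) : Prop :=
  (forall x, U x -> differentiable f x) /\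
  if n is n'.+1 then forall v, smoothn n' U ('D_v f) else True.

Lemma smoothn_diff V n (U : set V) f x : smoothn n U f -> U x -> differentiable f x.
Proof. by case: n => [|n] [+ _]; apply. Qed.

Lemma smoothn_derive V n (U : set V) f v : smoothn n.+1 U f -> smoothn n U ('D_v f).
Proof. by case=> _; exact. Qed.

Lemma smoothnP V (U : set V) f : smooth U f <-> forall n, smoothn n U f.
Proof.
split.
  move=> + n; elim: n f => [|n IH] f sf; (split; first by move=> x; exact: (sf [::])) => //.
  move=> v; apply: IH => vs x Ux.
  by have := sf (rcons vs v) x Ux; rewrite foldr_rcons.
move=> sf vs; elim/last_ind: vs f sf => [|vs v IH] f sf x Ux.
  exact: smoothn_diff (sf 0%N) Ux.
rewrite foldr_rcons; apply: IH => // n.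
exact: smoothn_derive.
Qed.

Lemma smoothnW V n (U : set V) f : smoothn n.+1 U f -> smoothn n U f.
Proof.
elim: n f => [|n IH] f [df sf]; split => // v.
exact/IH/sf.
Qed.

Lemma near_eq_differentiable V W (f g : V -> W) x :
  {near x, f =1 g} -> differentiable f x -> differentiable g x.
Proof.
move=> fg df; have gx : f x = g x := nbhs_singleton fg.
have key : g \o shift x = cst (g x) + 'd f x +o_ 0 id.
  apply/eqaddoP => _ /posnumP[e].
  have /eqaddoP/(_ _ [gt0 of e%:num]) H := diff_locally df.
  move: fg; rewrite (near_shift 0 x) subr0 => fg.
  near=> h; rewrite !fctE.
  have -> : g (shift x h) = f (shift x h) by near: h; apply: filterS fg => h /= ->.
  by rewrite -gx; near: h; exact: H.
apply/diff_locallyP.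
have -> : 'd g x = 'd f x :> (V -> W) by apply: diff_unique => //; exact: diff_continuous.
by split => //; exact: diff_continuous.
Unshelve. all: by end_near. Qed.

Lemma open_near V (U : set V) (P : V -> Prop) x : open U -> U x ->
  (forall y, U y -> P y) -> \forall y \near x, P y.
Proof.
by move=> oU Ux UP; apply: filterS UP _; exact: open_nbhs_nbhs.
Qed.

Lemma eq_on_derive V W (U : set V) (f g : V -> W) x v : open U -> U x ->
  (forall y, U y -> f y = g y) -> 'D_v f x = 'D_v g x.
Proof.
move=> oU Ux fg.
have [->|v0] := eqVneq v 0; first by rewrite !derive0.
by apply: near_eq_derive => //; exact: open_near fg.
Qed.

Lemma eq_on_differentiable V W (U : set V) (f g : V -> W) x : open U -> U x ->
  (forall y, U y -> f y = g y) -> differentiable f x -> differentiable g x.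
Proof. by move=> oU Ux fg; apply: near_eq_differentiable; exact: open_near fg. Qed.

Lemma smoothn_eq V n (U : set V) f g : open U -> (forall x, U x -> f x = g x) ->
  smoothn n U f -> smoothn n U g.
Proof.
move=> oU; elim: n f g => [|n IH] f g fg [df sf]; (split; first by
  move=> x Ux; apply: eq_on_differentiable oU Ux fg (df x Ux)) => //.
by move=> v; apply: IH (sf v) => x Ux; exact: eq_on_derive fg.
Qed.

(** The induction step in all the proofs below: it suffices that the derivative has a
    closed expression which is smooth to the previous order. *)
Lemma smoothnS_of V n (U : set V) f (df : V -> V -> R) : open U ->
  (forall x, U x -> differentiable f x) ->
  (forall v x, U x -> 'D_v f x = df v x) ->
  (forall v, smoothn n U (df v)) -> smoothn n.+1 U f.
Proof.
move=> oU f1 fE sdf; split=> // v.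
by apply: smoothn_eq (sdf v) => // x Ux; rewrite fE.
Qed.

Lemma smooth_differentiable V (U : set V) f x : smooth U f -> U x -> differentiable f x.
Proof. by move=> sf; exact: (sf [::]). Qed.

Lemma smooth_derive V (U : set V) f v : smooth U f -> smooth U ('D_v f).
Proof. by move=> /smoothnP sf; apply/smoothnP => n; exact: smoothn_derive. Qed.

Lemma smooth_eq V (U : set V) f g : open U -> (forall x, U x -> f x = g x) ->
  smooth U f -> smooth U g.
Proof.
by move=> oU fg /smoothnP sf; apply/smoothnP => n; apply: smoothn_eq fg (sf n).
Qed.

Lemma smooth_sub V (U U' : set V) f : U' `<=` U -> smooth U f -> smooth U' f.
Proof. by move=> s sf vs x /s; exact: sf. Qed.

Lemma smoothn_cst V n (U : set V) (a : R) : smoothn n U (cst a).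
Proof.
elim: n a => [|n IH] a; split => // v.
by rewrite (_ : 'D_v _ = cst 0)//; apply/funext => x; exact: derive_cst.
Qed.

Lemma smoothnD V n (U : set V) f g : open U ->
  smoothn n U f -> smoothn n U g -> smoothn n U (f \+ g).
Proof.
move=> oU; elim: n f g => [|n IH] f g sf sg.
  by split=> // x Ux; apply: differentiableD; apply: smoothn_diff Ux; eassumption.
apply: (@smoothnS_of _ _ _ _ (fun v => 'D_v f \+ 'D_v g)) => //.
- by move=> x Ux; apply: differentiableD; apply: smoothn_diff Ux; eassumption.
- move=> v x Ux; apply: deriveD; apply: diff_derivable;
    apply: smoothn_diff Ux; eassumption.
- by move=> v; apply: IH; [case: sf => _ | case: sg => _]; exact.
Qed.

Lemma smoothnM V n (U : set V) f g : open U ->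
  smoothn n U f -> smoothn n U g -> smoothn n U (f \* g).
Proof.
move=> oU; elim: n f g => [|n IH] f g sf sg.
  by split=> // x Ux; apply: differentiableM; apply: smoothn_diff Ux; eassumption.
apply: (@smoothnS_of _ _ _ _ (fun v => (f \* 'D_v g) \+ (g \* 'D_v f))) => //.
- by move=> x Ux; apply: differentiableM; apply: smoothn_diff Ux; eassumption.
- move=> v x Ux; apply: deriveM; apply: diff_derivable;
    apply: smoothn_diff Ux; eassumption.
- move=> v; apply: smoothnD => //; apply: IH;
    by [exact: smoothnW | exact: smoothn_derive].
Qed.

Lemma derive_comp V W (f : V -> W) (g : W -> R) x v :
  differentiable f x -> differentiable g (f x) ->
  'D_v (g \o f) x = 'D_('D_v f x) g (f x).
Proof.
move=> df dg; rewrite !deriveE//; last exact: differentiable_comp.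
by rewrite diff_comp.
Qed.

Lemma deriveZdir V W (f : V -> W) (a : R) x v : differentiable f x ->
  'D_(a *: v) f x = a *: 'D_v f x.
Proof. by move=> df; rewrite !deriveE// linearZ. Qed.

Lemma deriveDdir V W (f : V -> W) x u v : differentiable f x ->
  'D_(u + v) f x = 'D_u f x + 'D_v f x.
Proof. by move=> df; rewrite !deriveE// linearD. Qed.

Lemma deriveNdir V W (f : V -> W) x u : differentiable f x ->
  'D_(- u) f x = - 'D_u f x.
Proof. by move=> df; rewrite !deriveE// linearN. Qed.

Lemma derive_sumdir V W (I : Type) (r : seq I) (f : V -> W) x (u : I -> V) :
  differentiable f x ->
  'D_(\sum_(i <- r) u i) f x = \sum_(i <- r) 'D_(u i) f x.
Proof.
by move=> df; rewrite !deriveE// linear_sum; apply: eq_bigr => i _; rewrite deriveE.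
Qed.

Lemma derive_comp1 V (f : V -> R) (h : R -> R) x v :
  differentiable f x -> differentiable h (f x) ->
  'D_v (h \o f) x = 'D_1 h (f x) * 'D_v f x.
Proof.
move=> df dh; rewrite derive_comp//.
have -> : 'D_v f x = 'D_v f x *: (1 : R) by rewrite [RHS]mulr1.
by rewrite deriveZdir// [_ *: (1 : R)]mulr1 [LHS]mulrC.
Qed.

Lemma smoothn_comp1 V n (U : set V) (A : set R) f h : open U ->
  (forall x, U x -> A (f x)) -> smoothn n U f -> smoothn n A h ->
  smoothn n U (h \o f).
Proof.
move=> oU UA; elim: n h => [|n IH] h sf sh.
  split => // x Ux; apply: differentiable_comp; first exact: smoothn_diff sf Ux.
  exact: smoothn_diff sh (UA _ Ux).
apply: (@smoothnS_of _ _ _ _ (fun v => ('D_1 h \o f) \* 'D_v f)) => //.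
- move=> x Ux; apply: differentiable_comp; first exact: smoothn_diff sf Ux.
  exact: smoothn_diff sh (UA _ Ux).
- move=> v x Ux; apply: derive_comp1; first exact: smoothn_diff sf Ux.
  exact: smoothn_diff sh (UA _ Ux).
- move=> v; apply: smoothnM => //; last exact: smoothn_derive.
  by apply: IH; [exact: smoothnW | exact: smoothn_derive].
Qed.

Lemma differentiable_row V m (s : 'I_m -> V -> R) x :
  (forall j, differentiable (s j) x) ->
  differentiable (fun y => \row_j s j y) x.
Proof.
move=> ds; rewrite (_ : (fun _ => _) = \sum_j (fun y => s j y *: delta_mx 0 j)).
  by apply: differentiable_sum => j; exact: differentiableZl.
apply/funext => y; rewrite fct_sumE; apply/rowP => j.
rewrite !mxE summxE (bigD1 j)//= big1 ?addr0 => [|i ij]; rewrite !mxE ?eqxx ?mulr1//.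
by rewrite (negbTE (_ : j != i)) ?mulr0// eq_sym.
Qed.

Lemma derive_row V m (s : 'I_m -> V -> R) x v :
  (forall j, differentiable (s j) x) ->
  'D_v (fun y => \row_j s j y) x = \row_j 'D_v (s j) x.
Proof.
move=> ds; rewrite derive_mx; last exact/diff_derivable/differentiable_row.
apply/rowP => j; rewrite !mxE; congr ('D_v _ x).
by apply/funext => y; rewrite mxE.
Qed.

Lemma derive_comp_row V m (s : 'I_m -> V -> R) (g : 'rV[R]_m -> R) x v :
  (forall j, differentiable (s j) x) ->
  differentiable g (\row_j s j x) ->
  'D_v (fun y => g (\row_j s j y)) x =
  \sum_j 'D_v (s j) x * 'D_(delta_mx 0 j) g (\row_j s j x).
Proof.
move=> ds dg; have dr := differentiable_row ds.
rewrite (@derive_comp _ _ (fun y => \row_j s j y))// derive_row//.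
rewrite [in LHS](row_sum_delta (\row_j 'D_v (s j) x)) derive_sumdir//.
by apply: eq_bigr => j _; rewrite deriveZdir// mxE.
Qed.

Lemma smoothn_sum V n (U : set V) (I : Type) (r : seq I) (f : I -> V -> R) :
  open U -> (forall i, smoothn n U (f i)) ->
  smoothn n U (fun x => \sum_(i <- r) f i x).
Proof.
move=> oU sf; elim: r => [|i r IH].
  by apply: smoothn_eq (smoothn_cst n U 0) => // x _; rewrite big_nil.
by apply: smoothn_eq (smoothnD oU (sf i) IH) => // x _; rewrite big_cons.
Qed.

Lemma smoothn_comp_row V n (U : set V) m (s : 'I_m -> V -> R) (g : 'rV[R]_m -> R) :
  open U -> (forall j, smoothn n U (s j)) -> smoothn n setT g ->
  smoothn n U (fun y => g (\row_j s j y)).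
Proof.
move=> oU; elim: n s g => [|n IH] s g ss sg.
  split => // x Ux; apply: (@differentiable_comp _ _ _ _ (fun y => \row_j s j y)).
    by apply: differentiable_row => j; exact: smoothn_diff (ss j) Ux.
  exact: smoothn_diff sg I.
apply: (@smoothnS_of _ _ _ _ (fun v x =>
  \sum_j ('D_v (s j) x * 'D_(delta_mx 0 j) g (\row_j s j x)))) => //.
- move=> x Ux; apply: (@differentiable_comp _ _ _ _ (fun y => \row_j s j y)).
    by apply: differentiable_row => j; exact: smoothn_diff (ss j) Ux.
  exact: smoothn_diff sg I.
- move=> v x Ux; apply: derive_comp_row; last exact: smoothn_diff sg I.
  by move=> j; exact: smoothn_diff (ss j) Ux.
- move=> v; apply: smoothn_sum => // j; apply: smoothnM => //.
    exact: smoothn_derive.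
  by apply: (IH s ('D_(delta_mx 0 j) g)) => [i|]; [exact: smoothnW | exact: smoothn_derive].
Qed.

Section SmoothRules.
Variables (V : normedModType R) (U : set V).
Hypothesis oU : open U.
Implicit Types f g : V -> R.

Lemma smooth_cst (a : R) : smooth U (cst a).
Proof. by apply/smoothnP => n; exact: smoothn_cst. Qed.

Lemma smoothD f g : smooth U f -> smooth U g -> smooth U (f \+ g).
Proof. by move=> /smoothnP sf /smoothnP sg; apply/smoothnP => n; exact: smoothnD. Qed.

Lemma smoothM f g : smooth U f -> smooth U g -> smooth U (f \* g).
Proof. by move=> /smoothnP sf /smoothnP sg; apply/smoothnP => n; exact: smoothnM. Qed.

Lemma smoothN f : smooth U f -> smooth U (\- f).
Proof.
move=> sf; apply: smooth_eq (smoothM (smooth_cst (-1)) sf) => // x _.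
by rewrite /= mulN1r.
Qed.

Lemma smoothB f g : smooth U f -> smooth U g -> smooth U (f \- g).
Proof. by move=> sf sg; exact: smoothD sf (smoothN sg). Qed.

Lemma smooth_sum (I : Type) (r : seq I) (f : I -> V -> R) :
  (forall i, smooth U (f i)) -> smooth U (fun x => \sum_(i <- r) f i x).
Proof.
by move=> sf; apply/smoothnP => n; apply: smoothn_sum => // i; apply/smoothnP: n.
Qed.

Lemma smooth_comp1 (A : set R) f h : (forall x, U x -> A (f x)) ->
  smooth U f -> smooth A h -> smooth U (h \o f).
Proof.
move=> UA /smoothnP sf /smoothnP sh; apply/smoothnP => n.
exact: (smoothn_comp1 oU UA).
Qed.

Lemma smooth_comp_row m (s : 'I_m -> V -> R) (g : 'rV[R]_m -> R) :
  (forall j, smooth U (s j)) -> smooth setT g ->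
  smooth U (fun y => g (\row_j s j y)).
Proof.
move=> ss /smoothnP sg; apply/smoothnP => n; apply: smoothn_comp_row => // j.
by move/smoothnP: (ss j).
Qed.

Lemma smooth_linear f (l : V -> R) : (forall x, differentiable f x) ->
  (forall v x, 'D_v f x = l v) -> smooth U f.
Proof.
move=> df fE; apply/smoothnP => -[|n]; first by split.
apply: (@smoothnS_of _ _ _ _ (fun v => cst (l v))) => // v.
exact: smoothn_cst.
Qed.

End SmoothRules.

Lemma smooth_invr : smooth [set x : R | x != 0] (fun x : R => x^-1).
Proof.
have o0 : open [set x : R | x != 0] by exact: open_neq.
apply/smoothnP; elim=> [|n IH].
  by split => // x /= x0; exact: differentiable_Rinv.
apply: (@smoothnS_of _ _ _ _ (fun v x : R => - v * (x^-1 * x^-1))) => //.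
- by move=> x /= x0; exact: differentiable_Rinv.
- move=> v x /= x0; have := @deriveV _ _ id x v x0 (@derivable_id _ _ _ _).
  rewrite /= derive_id => ->.
  by rewrite -[_ *: v]/(_ * v) -exprVn; ring.
- by move=> v; apply: smoothnM => //; [exact: smoothn_cst | exact: smoothnM].
Qed.

Lemma smooth_expR : smooth [set: R] (@expR R).
Proof.
apply/smoothnP; elim=> [|n IH].
  by split => // x _; exact/derivable1_diffP/derivable_expR.
apply: (@smoothnS_of _ _ _ _ (fun v x : R => v * expR x)) => //.
- exact: openT.
- by move=> x _; exact/derivable1_diffP/derivable_expR.
- move=> v x _; have dx : differentiable (@expR R) x.
    exact/derivable1_diffP/derivable_expR.
  rewrite -[v in LHS]mulr1 -[v * 1]/(v *: (1 : R)) deriveZdir//.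
  by rewrite derive_val.
- by move=> v; apply: smoothnM => //; [exact: openT | exact: smoothn_cst].
Qed.

Lemma differentiable_ln (x : R) : 0 < x -> differentiable (@ln R) x.
Proof. by move=> x0; apply/derivable1_diffP; case: (is_derive1_ln x0). Qed.

Lemma smooth_ln : smooth [set x : R | 0 < x] (@ln R).
Proof.
have o0 : open [set x : R | 0 < x] by exact: open_gt.
apply/smoothnP => -[|n].
  by split => // x /=; exact: differentiable_ln.
apply: (@smoothnS_of _ _ _ _ (fun v x : R => v * x^-1)) => //.
- by move=> x /=; exact: differentiable_ln.
- move=> v x /= x0.
  rewrite -[v in LHS]mulr1 -[v * 1]/(v *: (1 : R)) deriveZdir//; last exact: differentiable_ln.
  by have := is_derive1_ln x0 => ?; rewrite derive_val.
- move=> v; apply: smoothnM => //; first exact: smoothn_cst.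
  apply/smoothnP: n; apply: smooth_sub smooth_invr => x /= x0.
  by rewrite gt_eqF.
Qed.

Lemma continuous_linear_differentiable V W (f : V -> W) x :
  (forall (h : R) v y, f (h *: v + y) = h *: f v + f y) -> continuous f ->
  differentiable f x.
Proof.
move=> f_lin f_cont.
pose fM := GRing.isLinear.Build _ _ _ _ f f_lin.
pose fL : {linear _ -> _} := HB.pack f fM.
exact: (@linear_differentiable _ _ _ fL).
Qed.

Section LinearPullback.
Variables (V W : normedModType R) (A : V -> W).
Hypothesis A_lin : forall (h : R) v x, A (h *: v + x) = h *: A v + A x.
Hypothesis A_diff : forall x, differentiable A x.

Lemma derive_pullback (X : normedModType R) (f : W -> X) v :
  'D_v (f \o A) = ('D_(A v) f) \o A.
Proof.
apply/funext => x; rewrite /derive /=.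
rewrite (_ : (fun h => h^-1 *: (f (A (h *: v + x)) - f (A x))) =
             (fun h => h^-1 *: (f (h *: A v + A x) - f (A x))))//.
by apply/funext => h; rewrite A_lin.
Qed.

Lemma smooth_pullback (U : set W) (f : W -> R) :
  smooth U f -> smooth (A @^-1` U) (f \o A).
Proof.
move=> sf vs x Ux.
have -> : foldr (fun v g => 'D_v g) (f \o A) vs =
          foldr (fun v g => 'D_v g) f (map A vs) \o A.
  by elim: vs => //= v vs ->; rewrite derive_pullback.
by apply: differentiable_comp => //; exact: sf.
Qed.

End LinearPullback.

Lemma is_derive_line V W (g : V -> W) (y w : V) (s : R) :
  differentiable g (s *: w + y) ->
  is_derive s 1 (fun s => g (s *: w + y)) ('D_w g (s *: w + y)).
Proof.
move=> dg.
have ds : differentiable (fun s : R => s *: w) s by exact: differentiableZl.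
have dl : differentiable (fun s : R => s *: w + y) s by exact: differentiableD.
have dc : differentiable (g \o (fun s : R => s *: w + y)) s.
  exact: differentiable_comp.
apply: DeriveDef; first exact/diff_derivable.
rewrite deriveE// (diff_comp dl dg)/= -deriveE//; congr ('D__ g _).
rewrite -[LHS]deriveE// deriveD//; last exact/diff_derivable.
by rewrite derive_cst addr0 deriveE// diff_val scale1r.
Qed.

Lemma MVT_line V (g : V -> R) (y w : V) (h : R) : 0 <= h ->
  (forall s : R, 0 <= s <= h -> differentiable g (s *: w + y)) ->
  exists2 s : R, 0 <= s <= h & g (h *: w + y) - g y = h * 'D_w g (s *: w + y).
Proof.
move=> h0 dg.
pose G : R -> R := fun s => g (s *: w + y).
pose dG : R -> R := fun s => 'D_w g (s *: w + y).
have dl (s : R) : s \in `[0, h] -> is_derive s 1 G (dG s).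
  by rewrite in_itv /= => sh; exact/is_derive_line/dg.
have dl' (s : R) : s \in `]0, h[ -> is_derive s 1 G (dG s).
  by move=> /subset_itv_oo_cc; exact: dl.
have cG : {within `[0, h], continuous G}.
  by apply: derivable_within_continuous => s /dl [].
have [s sh E] := @MVT_segment R G dG 0 h h0 dl' cG.
exists s; first by move: sh; rewrite in_itv.
by move: E; rewrite /G /dG scale0r add0r subr0 [RHS]mulrC.
Qed.

(** The mean value theorem is applied to [f (h v + _) - f] along [u], then to [D_u f]
    along [v]; the second difference being symmetric in [u] and [v], it is also a
    value of the other mixed derivative. *)
Lemma second_difference V (U : set V) (f : V -> R) x u v (h : R) : smooth U f ->
  0 < h -> (forall s t : R, 0 <= s <= h -> 0 <= t <= h -> U (s *: u + t *: v + x)) ->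
  exists s t : R, [/\ 0 <= s <= h, 0 <= t <= h &
    f (h *: u + h *: v + x) - f (h *: u + x) - (f (h *: v + x) - f x) =
    h ^+ 2 * 'D_v ('D_u f) (s *: u + t *: v + x)].
Proof.
move=> sf h0 HU.
have h00 : 0 <= (0:R) <= h by rewrite lexx ltW.
have hhh : 0 <= h <= h by rewrite lexx ltW.
have U0 (s : R) : 0 <= s <= h -> U (s *: u + x).
  by move=> sh; have := HU s 0 sh h00; rewrite scale0r addr0.
have Uh (s : R) : 0 <= s <= h -> U (h *: v + (s *: u + x)).
  by move=> sh; have := HU s h sh hhh; rewrite addrCA addrA.
have dsh z : differentiable (fun z => h *: v + z) z by exact: differentiableD.
have dfh (s : R) : 0 <= s <= h ->
    differentiable (f \o (fun z => h *: v + z)) (s *: u + x).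
  move=> sh; apply: differentiable_comp => //; exact: smooth_differentiable (Uh _ sh).
have df (s : R) : 0 <= s <= h -> differentiable f (s *: u + x).
  by move=> sh; exact: smooth_differentiable (U0 _ sh).
have [s sh] := @MVT_line _ (fun z => (f \o (fun z => h *: v + z)) z - f z) x u h (ltW h0)
  (fun s sh => differentiableB (dfh s sh) (df s sh)).
rewrite deriveB; [|exact/diff_derivable/dfh|exact/diff_derivable/df].
rewrite derive_comp//; last exact: smooth_differentiable (Uh _ sh).
rewrite deriveD// derive_cst derive_id add0r => E1.
have [t th E2] := @MVT_line _ ('D_u f) (s *: u + x) v h (ltW h0) (fun t th =>
  smooth_differentiable (smooth_derive u sf)
   (eq_ind _ U (HU s t sh th) _ (etrans (addrAC _ _ _) (addrC _ _)))).
exists s, t; split; [exact: sh|exact: th|].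
move: E1; rewrite /= E2 => E1.
transitivity (f (h *: v + (h *: u + x)) - f (h *: u + x) - (f (h *: v + x) - f x)).
  by congr (f _ - _ - _); rewrite addrA [h *: v + _]addrC.
have -> : s *: u + t *: v + x = t *: v + (s *: u + x).
  by rewrite [s *: u + t *: v]addrC addrA.
by rewrite E1 mulrA -expr2.
Qed.

Lemma continuous_eq_of_close V (g1 g2 : V -> R) x :
  {for x, continuous g1} -> {for x, continuous g2} ->
  (forall d : R, 0 < d -> exists y z, [/\ ball x d y, ball x d z & g1 y = g2 z]) ->
  g1 x = g2 x.
Proof.
move=> c1 c2 H; apply/eqP; rewrite -subr_eq0 -normr_le0; apply/ler_addgt0Pl => e e0.
rewrite addr0; have e20 : 0 < e / 2 by rewrite divr_gt0.
have N1 : \forall y \near x, `|g1 x - g1 y| < e / 2.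
  by move/cvgrPdist_lt: c1; exact.
have N2 : \forall y \near x, `|g2 x - g2 y| < e / 2.
  by move/cvgrPdist_lt: c2; exact.
have [d /= d0 dN] := (nbhs_ballP _ _).1 (filterI N1 N2).
have [y [z [/dN[/= A1 _] /dN[/= _ A2] E]]] := H d d0.
rewrite -(subrK (g1 y) (g1 x)) -addrA {2}E (splitr e).
by rewrite (le_trans (ler_normD _ _))// lerD// ltW// distrC.
Qed.

(** Symmetry of second derivatives: both mixed derivatives take the value of the
    same second difference quotient at points close to [x]. *)
Lemma derive_sym V (U : set V) (f : V -> R) x u v : open U -> smooth U f -> U x ->
  'D_u ('D_v f) x = 'D_v ('D_u f) x.
Proof.
move=> oU sf Ux.
have ct w w' : {for x, continuous ('D_w ('D_w' f))}.
  apply: differentiable_continuous.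
  by apply: smooth_differentiable Ux; do 2!apply: smooth_derive.
apply: (@continuous_eq_of_close _ ('D_u ('D_v f)) ('D_v ('D_u f))) => // d' d'0.
have [r /= r0 rU] : exists2 r : R, 0 < r & forall y, ball x r y -> U y.
  have : nbhs x U by exact: open_nbhs_nbhs.
  by move=> /(nbhs_ballP _ _).1 [r /= r0 rU]; exists r.
pose d := Num.min d' r; have d0 : 0 < d by rewrite lt_min d'0.
have D0 : 0 < 1 + `|u| + `|v| by rewrite -addrA ltr_wpDr// addr_ge0.
pose h := d / 2 / (1 + `|u| + `|v|).
have h0 : 0 < h by rewrite /h !divr_gt0.
have B (s t : R) : 0 <= s <= h -> 0 <= t <= h -> ball x d (s *: u + t *: v + x).
  move=> /andP[s0 sh] /andP[t0 th].
  rewrite -ball_normE /= opprD addrCA subrr addr0 normrN.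
  apply: (@le_lt_trans _ _ (h * (`|u| + `|v|))).
    rewrite (le_trans (ler_normD _ _))// !normrZ !ger0_norm// mulrDr.
    by rewrite lerD// ler_wpM2r.
  rewrite /h mulrAC ltr_pdivrMr// -addrA.
  have : 0 <= `|u| + `|v| by rewrite addr_ge0.
  by nra.
have BU (s t : R) : 0 <= s <= h -> 0 <= t <= h -> U (s *: u + t *: v + x).
  move=> sh th; apply: rU; apply: le_ball (B _ _ sh th).
  by rewrite ge_min lexx orbT.
have BU' (s t : R) : 0 <= s <= h -> 0 <= t <= h -> U (s *: v + t *: u + x).
  by move=> sh th; rewrite [s *: v + _]addrC; exact: BU.
have [s [t [sh th E1]]] := second_difference sf h0 BU'.
have [s' [t' [sh' th' E2]]] := second_difference sf h0 BU.
exists (s *: v + t *: u + x), (s' *: u + t' *: v + x); split.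
- rewrite [s *: v + _]addrC; apply: le_ball (B _ _ th sh).
  by rewrite ge_min lexx.
- by apply: le_ball (B _ _ sh' th'); rewrite ge_min lexx.
- have h20 : h ^+ 2 != 0 by rewrite sqrf_eq0 gt_eqF.
  have E : forall a1 a2 a3 a4 : R, a1 - a2 - (a3 - a4) = a1 - a3 - (a2 - a4).
    by move=> *; ring.
  apply: (mulfI h20); apply: etrans (esym E1) (etrans _ E2).
  by rewrite [h *: v + h *: u]addrC; exact: E.
Qed.

End SmoothCalculus.

(** * Directional derivatives and the real operators behind [ddbar] *)

(** The values of ['D_v f] lie in [R] seen as a normed module. Here they lie in [R]
    itself, where the ring operations are the usual ones, and the definition is
    locked so that conversion does not unfold limits when comparing terms. *)
HB.lock Definition dd {R : realType} {V : normedModType R} (v : V) (f : V -> R) : V -> R :=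
  fun x => 'D_v f x.

Lemma ddE {R : realType} {V : normedModType R} (v : V) (f : V -> R) : dd v f = 'D_v f.
Proof. by rewrite unlock. Qed.

(* The derivatives become variables, hence cheap atoms for ring and field. *)
Ltac abstract_dd :=
  repeat match goal with |- context [@dd ?K ?V ?v ?f ?x] =>
    let a := fresh "a" in generalize (@dd K V v f x); intro a end.

Section DeriveRules.
Context {R : realType} {V : normedModType R}.
Implicit Types (f g : V -> R) (x v : V).

Lemma dd_cst (a : R) v x : dd v (fun=> a) x = 0.
Proof. rewrite !ddE; exact: derive_cst. Qed.

Lemma dd_on (U : set V) f g x v : open U -> U x -> (forall y, U y -> f y = g y) ->
  dd v f x = dd v g x.
Proof. rewrite !ddE; exact: eq_on_derive. Qed.

Lemma dd_sum (I : Type) (r : seq I) (f : I -> V -> R) x v :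
  (forall i, differentiable (f i) x) ->
  dd v (fun y => \sum_(i <- r) f i y) x = \sum_(i <- r) dd v (f i) x.
Proof.
move=> df.
suff [] : differentiable (fun y => \sum_(i <- r) f i y) x /\
  dd v (fun y => \sum_(i <- r) f i y) x = \sum_(i <- r) dd v (f i) x by [].
elim: r => [|i r [IHd IH]].
  rewrite big_nil (_ : (fun _ => _) = cst 0); last by apply/funext => y; rewrite big_nil.
  by rewrite dd_cst.
rewrite big_cons (_ : (fun _ => _) = f i \+ (fun y => \sum_(i <- r) f i y)); last first.
  by apply/funext => y; rewrite big_cons.
split; first exact: differentiableD.
rewrite -IH !ddE; apply: deriveD; exact: diff_derivable.
Qed.

Lemma ddMc f x v (a : R) : differentiable f x -> dd v (fun y => a * f y) x = a * dd v f x.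
Proof. rewrite !ddE; move=> df; apply: (deriveZ a); exact: diff_derivable. Qed.

Lemma ddD f g x v : differentiable f x -> differentiable g x ->
  dd v (fun y => f y + g y) x = dd v f x + dd v g x.
Proof. rewrite !ddE; move=> df dg; apply: (@deriveD _ _ _ f g); exact: diff_derivable. Qed.

Lemma ddB f g x v : differentiable f x -> differentiable g x ->
  dd v (fun y => f y - g y) x = dd v f x - dd v g x.
Proof. rewrite !ddE; move=> df dg; apply: (@deriveB _ _ _ f g); exact: diff_derivable. Qed.

Lemma ddN f x v : differentiable f x -> dd v (fun y => - f y) x = - dd v f x.
Proof. rewrite !ddE; move=> df; apply: (@deriveN _ _ _ f); exact: diff_derivable. Qed.

Lemma ddM f g x v : differentiable f x -> differentiable g x ->
  dd v (fun y => f y * g y) x = f x * dd v g x + g x * dd v f x.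
Proof. rewrite !ddE; move=> df dg; apply: (@deriveM _ _ f g); exact: diff_derivable. Qed.

Lemma dd_comp1 f (h : R -> R) x v : differentiable f x -> differentiable h (f x) ->
  dd v (h \o f) x = dd (1 : R) h (f x) * dd v f x.
Proof. rewrite !ddE; exact: derive_comp1. Qed.

Lemma dd_addl f x u v : differentiable f x -> dd (u + v) f x = dd u f x + dd v f x.
Proof. rewrite !ddE; exact: deriveDdir. Qed.

Lemma dd_scalel f x (a : R) v : differentiable f x -> dd (a *: v) f x = a * dd v f x.
Proof. rewrite !ddE; exact: deriveZdir. Qed.

Lemma dd_oppl f x v : differentiable f x -> dd (- v) f x = - dd v f x.
Proof. rewrite !ddE; exact: deriveNdir. Qed.

Lemma dd_suml (I : Type) (r : seq I) f x (u : I -> V) : differentiable f x ->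
  dd (\sum_(i <- r) u i) f x = \sum_(i <- r) dd (u i) f x.
Proof. by move=> df; rewrite ddE derive_sumdir//; apply: eq_bigr => i _; rewrite ddE. Qed.

Lemma dd_comp_row m (s : 'I_m -> V -> R) (g : 'rV[R]_m -> R) x v :
  (forall j, differentiable (s j) x) -> differentiable g (\row_j s j x) ->
  dd v (fun y => g (\row_j s j y)) x =
  \sum_j dd v (s j) x * dd (delta_mx 0 j) g (\row_j s j x).
Proof.
move=> ds dg; rewrite ddE derive_comp_row//; apply: eq_bigr => i _; by rewrite !ddE.
Qed.

Lemma smooth_dd (U : set V) f v : smooth U f -> smooth U (dd v f).
Proof. rewrite !ddE; exact: smooth_derive. Qed.

Lemma smooth_dd_diff (U : set V) f v x : smooth U f -> U x -> differentiable (dd v f) x.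
Proof. by move=> sf; exact/smooth_differentiable/smooth_dd. Qed.

Lemma dd_sym (U : set V) f x u v : open U -> smooth U f -> U x ->
  dd u (dd v f) x = dd v (dd u f) x.
Proof. rewrite !ddE; exact: derive_sym. Qed.

Lemma dd_sqr f x v : differentiable f x ->
  dd v (fun y => f y ^+ 2) x = 2 * (f x * dd v f x).
Proof. by move=> df; rewrite (ddM v df df); abstract_dd; ring. Qed.

End DeriveRules.

Section Hessian.
Context {R : realType} {V : normedModType R} (U : set V).
Hypothesis oU : open U.
Implicit Types (f g : V -> R) (x u v : V).

Lemma hessDr f x u v w : smooth U f -> U x ->
  dd u (dd (v + w) f) x = dd u (dd v f) x + dd u (dd w f) x.
Proof.
move=> sf Ux; rewrite -ddD; [|exact: smooth_dd_diff Ux..].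
by apply: dd_on oU Ux _ => y Uy; rewrite dd_addl//; exact: smooth_differentiable Uy.
Qed.

Lemma hessZr f x u v (a : R) : smooth U f -> U x ->
  dd u (dd (a *: v) f) x = a * dd u (dd v f) x.
Proof.
move=> sf Ux; rewrite -ddMc; last exact: smooth_dd_diff Ux.
by apply: dd_on oU Ux _ => y Uy; rewrite dd_scalel//; exact: smooth_differentiable Uy.
Qed.

Lemma hessNr f x u v : smooth U f -> U x -> dd u (dd (- v) f) x = - dd u (dd v f) x.
Proof. by move=> sf Ux; rewrite -scaleN1r hessZr// mulN1r. Qed.

Lemma hess_sumr f x (I : Type) (r : seq I) u (v : I -> V) : smooth U f -> U x ->
  dd u (dd (\sum_(i <- r) v i) f) x = \sum_(i <- r) dd u (dd (v i) f) x.
Proof.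
move=> sf Ux; rewrite -dd_sum; last by move=> i; exact: smooth_dd_diff Ux.
by apply: dd_on oU Ux _ => y Uy; apply: dd_suml; exact: smooth_differentiable Uy.
Qed.

Lemma hessD f g x u v : smooth U f -> smooth U g -> U x ->
  dd u (dd v (fun y => f y + g y)) x = dd u (dd v f) x + dd u (dd v g) x.
Proof.
move=> sf sg Ux; rewrite -ddD; [|exact: smooth_dd_diff Ux..].
by apply: dd_on oU Ux _ => y Uy; apply: ddD; exact: smooth_differentiable Uy.
Qed.

Lemma hessB f g x u v : smooth U f -> smooth U g -> U x ->
  dd u (dd v (fun y => f y - g y)) x = dd u (dd v f) x - dd u (dd v g) x.
Proof.
move=> sf sg Ux; rewrite -ddB; [|exact: smooth_dd_diff Ux..].
by apply: dd_on oU Ux _ => y Uy; apply: ddB; exact: smooth_differentiable Uy.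
Qed.

Lemma hess_sum (I : Type) (r : seq I) (f : I -> V -> R) x u v :
  (forall i, smooth U (f i)) -> U x ->
  dd u (dd v (fun y => \sum_(i <- r) f i y)) x = \sum_(i <- r) dd u (dd v (f i)) x.
Proof.
move=> sf Ux; rewrite -dd_sum; last by move=> i; exact: smooth_dd_diff (sf i) Ux.
apply: dd_on oU Ux _ => y Uy; apply: dd_sum => i; exact: smooth_differentiable Uy.
Qed.

Lemma hessM f g x u v : smooth U f -> smooth U g -> U x ->
  dd u (dd v (fun y => f y * g y)) x =
  f x * dd u (dd v g) x + dd u f x * dd v g x +
  dd v f x * dd u g x + g x * dd u (dd v f) x.
Proof.
move=> sf sg Ux.
have df := smooth_differentiable sf Ux; have dg := smooth_differentiable sg Ux.
have ddf := smooth_dd_diff v sf Ux; have ddg := smooth_dd_diff v sg Ux.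
transitivity (dd u (fun y => (f \* dd v g) y + (g \* dd v f) y) x).
  by apply: dd_on oU Ux _ => y Uy; apply: ddM; exact: smooth_differentiable Uy.
rewrite ddD; [|exact: differentiableM..].
by rewrite !ddM//; abstract_dd; ring.
Qed.

Lemma hess_comp1 (A : set R) (h : R -> R) f x u v :
  (forall y, U y -> A (f y)) -> smooth A h -> smooth U f -> U x ->
  dd u (dd v (h \o f)) x =
  dd (1 : R) (dd (1 : R) h) (f x) * (dd u f x * dd v f x) + dd (1 : R) h (f x) * dd u (dd v f) x.
Proof.
move=> UA sh sf Ux.
have df := smooth_differentiable sf Ux.
have ddf := smooth_dd_diff v sf Ux.
have dh := smooth_dd_diff (1 : R) sh (UA _ Ux).
transitivity (dd u (fun y => (dd (1 : R) h \o f) y * dd v f y) x).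
  apply: dd_on oU Ux _ => y Uy; apply: dd_comp1; first exact: smooth_differentiable Uy.
  exact: smooth_differentiable sh (UA _ Uy).
have dhf : differentiable (dd (1 : R) h \o f) x by exact: differentiable_comp.
by rewrite (ddM _ dhf ddf) dd_comp1//=; abstract_dd; ring.
Qed.

Lemma dd_lincomb (I : finType) f x (a b : I -> R) (e e' : I -> V) :
  differentiable f x ->
  dd (\sum_k (a k *: e k + b k *: e' k)) f x = \sum_k (a k * dd (e k) f x + b k * dd (e' k) f x).
Proof.
move=> df; rewrite dd_suml//; apply: eq_bigr => k _.
by rewrite dd_addl// !dd_scalel.
Qed.

Lemma hess_lincombr (I : finType) f x w (a b : I -> R) (e e' : I -> V) :
  smooth U f -> U x ->
  dd w (dd (\sum_k (a k *: e k + b k *: e' k)) f) x =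
  \sum_k (a k * dd w (dd (e k) f) x + b k * dd w (dd (e' k) f) x).
Proof.
move=> sf Ux; rewrite hess_sumr//; apply: eq_bigr => k _.
by rewrite hessDr// !hessZr.
Qed.

Lemma hess_lincomb (I : finType) f x (a b a' b' : I -> R) (e e' : I -> V) :
  smooth U f -> U x ->
  dd (\sum_k (a k *: e k + b k *: e' k)) (dd (\sum_k (a' k *: e k + b' k *: e' k)) f) x =
  \sum_j \sum_k
    (a j * a' k * dd (e j) (dd (e k) f) x + a j * b' k * dd (e j) (dd (e' k) f) x +
     b j * a' k * dd (e' j) (dd (e k) f) x + b j * b' k * dd (e' j) (dd (e' k) f) x).
Proof.
move=> sf Ux; rewrite dd_lincomb; last exact: smooth_dd_diff Ux.
apply: eq_bigr => j _; rewrite !hess_lincombr// !mulr_sumr -big_split.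
by apply: eq_bigr => k _ /=; abstract_dd; ring.
Qed.

End Hessian.

Section ComplexStructure.
Context {R : realType} {N : nat}.
Implicit Types (u v z : 'Cn[R]_N) (f : 'Cn[R]_N -> R).

(** Multiplication by i on real tangent vectors. *)
Definition Jc u : 'Cn[R]_N := (- u.2, u.1).

Lemma JcK u : Jc (Jc u) = - u.
Proof. by rewrite /Jc; apply/pair_equal_spec. Qed.

Lemma JcD u v : Jc (u + v) = Jc u + Jc v.
Proof. by rewrite /Jc; apply/pair_equal_spec; rewrite /= opprD. Qed.

Lemma JcZ (a : R) u : Jc (a *: u) = a *: Jc u.
Proof. by rewrite /Jc; apply/pair_equal_spec; rewrite /= scalerN. Qed.

Lemma Jc_re k : Jc (e_re k) = e_im k :> 'Cn[R]_N.
Proof. by apply/pair_equal_spec; rewrite /= oppr0. Qed.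

Lemma Cn_basis u : u = \sum_k (u.1 0 k *: e_re k + u.2 0 k *: e_im k).
Proof.
have P1 (F : 'I_N -> 'Cn[R]_N) : (\sum_k F k).1 = \sum_k (F k).1.
  by elim/big_rec2: _ => // i y1 y2 _ <-.
have P2 (F : 'I_N -> 'Cn[R]_N) : (\sum_k F k).2 = \sum_k (F k).2.
  by elim/big_rec2: _ => // i y1 y2 _ <-.
rewrite [RHS]surjective_pairing P1 P2 [LHS]surjective_pairing; congr pair.
  by rewrite [LHS]row_sum_delta; apply: eq_bigr => k _; rewrite /= scaler0 addr0.
by rewrite [LHS]row_sum_delta; apply: eq_bigr => k _; rewrite /= scaler0 add0r.
Qed.

Lemma dd_basis f z u : differentiable f z ->
  dd u f z = \sum_k (u.1 0 k * dd (e_re k) f z + u.2 0 k * dd (e_im k) f z).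
Proof. by move=> df; rewrite {1}(Cn_basis u); exact: dd_lincomb. Qed.

Section KForm.
Variable (U : set 'Cn[R]_N).
Hypothesis oU : open U.

Lemma hess_basis f z u v : smooth U f -> U z ->
  dd u (dd v f) z = \sum_j \sum_k
    (u.1 0 j * v.1 0 k * dd (e_re j) (dd (e_re k) f) z +
     u.1 0 j * v.2 0 k * dd (e_re j) (dd (e_im k) f) z +
     u.2 0 j * v.1 0 k * dd (e_im j) (dd (e_re k) f) z +
     u.2 0 j * v.2 0 k * dd (e_im j) (dd (e_im k) f) z).
Proof.
move=> sf Uz; rewrite {1}(Cn_basis u) {1}(Cn_basis v).
exact: (hess_lincomb oU (fun k => u.1 0 k) (fun k => u.2 0 k)
  (fun k => v.1 0 k) (fun k => v.2 0 k) (@e_re R N) (@e_im R N) sf Uz).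
Qed.

(** [Kop f] is four times the real part of the Hermitian form with matrix the
    complex Hessian of [f]; [Kop f u u] is the Laplacian of [f] restricted to the
    complex line of [u]. *)
Definition Kop f u v z := dd u (dd v f) z + dd (Jc u) (dd (Jc v) f) z.

(** The analogue for products of first derivatives: [Kq f u u = 4 |d'f (u)|^2]
    with [d'] the part of type (1,0); it measures how far [Kop] is from commuting
    with a function of one variable. *)
Definition Kq f u v z := dd u f z * dd v f z + dd (Jc u) f z * dd (Jc v) f z.

Lemma cderiveE v (g : 'Cn[R]_N -> R[i]) z :
  cderive v g z = dd v (fun w => complex.Re (g w)) z +i* dd v (fun w => complex.Im (g w)) z.
Proof. by rewrite !ddE. Qed.

Lemma cderive_real v f : cderive v (fun w => (f w)%:C) = fun z => (dd v f z)%:C.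
Proof. by apply/funext => z; rewrite cderiveE dd_cst. Qed.

Lemma half_complex (a : R[i]) : a / 2 = (complex.Re a / 2) +i* (complex.Im a / 2).
Proof.
have two : 2 = 2%:C :> R[i] by rewrite rmorph_nat.
have n2 : 2 != 0 :> R[i] by rewrite pnatr_eq0.
apply: (mulIf n2); rewrite divfK// two; case: a => a b /=; simpc.
by rewrite !divfK.
Qed.

Lemma dzbar_real f k : dzbar k (fun w => (f w)%:C) =
  fun z => (dd (e_re k) f z / 2) +i* (dd (e_im k) f z / 2).
Proof.
apply/funext => z; rewrite /dzbar !cderive_real half_complex.
by congr (_ +i* _); rewrite /=; ring.
Qed.

Lemma dz_dzbar_real f j k z : smooth U f -> U z ->
  dz j (dzbar k (fun w => (f w)%:C)) z =
  ((dd (e_re j) (dd (e_re k) f) z + dd (e_im j) (dd (e_im k) f) z) / 4) +i*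
  ((dd (e_re j) (dd (e_im k) f) z - dd (e_im j) (dd (e_re k) f) z) / 4).
Proof.
move=> sf Uz; rewrite dzbar_real /dz !cderiveE /=.
have H v w : dd v (fun z => dd w f z / 2) z = dd v (dd w f) z / 2.
  rewrite [RHS]mulrC -ddMc; last exact: smooth_dd_diff Uz.
  by congr (dd _ _ _); apply/funext => y; rewrite mulrC.
by rewrite !H half_complex; congr (_ +i* _); rewrite /=; field.
Qed.

Lemma Jc1 u k : (Jc u).1 0 k = - u.2 0 k. Proof. by rewrite /= mxE. Qed.
Lemma Jc2 u k : (Jc u).2 0 k = u.1 0 k. Proof. by []. Qed.

Lemma hermitian_Kop f z u v : smooth U f -> U z ->
  \sum_j \sum_k dz j (dzbar k (fun w => (f w)%:C)) z * (coord u j * conjc (coord v k)) =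
  (Kop f u v z / 4) +i* (Kop f u (Jc v) z / 4).
Proof.
move=> sf Uz.
have -> : Kop f u v z / 4 +i* (Kop f u (Jc v) z / 4) =
  (Kop f u v z / 4)%:C + 'i%C * (Kop f u (Jc v) z / 4)%:C by simpc.
rewrite /Kop !(hess_basis _ _ sf Uz) -!big_split/= !mulr_suml !rmorph_sum/= !mulr_sumr -big_split/=.
apply: eq_bigr => j _; rewrite -!big_split/= !mulr_suml !rmorph_sum/= !mulr_sumr -big_split/=.
apply: eq_bigr => k _; rewrite dz_dzbar_real// /coord; simpc.
by rewrite !mxE; congr (_ +i* _); field.
Qed.

Lemma Kop_sym f z u v : smooth U f -> U z -> Kop f v u z = Kop f u v z.
Proof.
by move=> sf Uz; rewrite /Kop (dd_sym v u oU sf Uz) (dd_sym (Jc v) (Jc u) oU sf Uz).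
Qed.

Lemma KopJ f z u v : smooth U f -> U z ->
  Kop f u (Jc v) z = dd u (dd (Jc v) f) z - dd (Jc u) (dd v f) z.
Proof. by move=> sf Uz; rewrite /Kop JcK (hessNr oU). Qed.

Lemma KopJ_anti f z u v : smooth U f -> U z -> Kop f v (Jc u) z = - Kop f u (Jc v) z.
Proof.
move=> sf Uz; rewrite !KopJ// (dd_sym v (Jc u) oU sf Uz) (dd_sym u (Jc v) oU sf Uz).
by rewrite opprB.
Qed.

Lemma ddbar_Kop f z u v : smooth U f -> U z ->
  ddbar (fun w => (f w)%:C) z u v = 0 +i* (Kop f u (Jc v) z / 2).
Proof.
move=> sf Uz; rewrite /ddbar.
under eq_bigr do under eq_bigr do rewrite mulrBr.
under eq_bigr do rewrite sumrB.
rewrite sumrB !hermitian_Kop// Kop_sym// KopJ_anti//; simpc.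
by congr (_ +i* _); field.
Qed.

Lemma kahler_Kop f z u : smooth U f -> U z ->
  0 < \sum_j \sum_k
        dz j (dzbar k (fun w => (f w)%:C)) z * coord u j * conjc (coord u k) ->
  0 < Kop f u u z.
Proof.
move=> sf Uz; under eq_bigr do under eq_bigr do rewrite -mulrA.
by rewrite hermitian_Kop// ltcE /= => /andP[_]; rewrite pmulr_lgt0// invr_gt0.
Qed.

Lemma KopDl f z u1 u2 v : smooth U f -> U z ->
  Kop f (u1 + u2) v z = Kop f u1 v z + Kop f u2 v z.
Proof.
move=> sf Uz; rewrite /Kop JcD !dd_addl; [|exact: smooth_dd_diff Uz..].
by rewrite addrACA.
Qed.

Lemma KopZl f z (a : R) u v : smooth U f -> U z -> Kop f (a *: u) v z = a * Kop f u v z.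
Proof.
move=> sf Uz; rewrite /Kop JcZ !dd_scalel; [|exact: smooth_dd_diff Uz..].
by rewrite mulrDr.
Qed.

Lemma smooth_Kop f u v : smooth U f -> smooth U (Kop f u v).
Proof. by move=> sf; apply: smoothD => //; do 2!apply: smooth_dd. Qed.

Lemma is_form2_Kop f (w : form2 R N) : smooth U f ->
  (forall z u v, U z -> w z u v = 0 +i* (Kop f u (Jc v) z / 2)) -> is_form2 U w.
Proof.
move=> sf wE; split.
- move=> z Uz a u1 u2 v; rewrite !wE// KopDl// KopZl//; simpc.
  by congr (_ +i* _); field.
- move=> z Uz u v; rewrite !wE// (KopJ_anti v u sf Uz) mulNr.
  by apply/eqP; rewrite eq_complex /= oppr0 !eqxx.
- by move=> z Uz u v; rewrite wE.
- move=> u v; split.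
    apply: (@smooth_eq _ _ U (cst 0)) => //; last exact: smooth_cst.
    by move=> z Uz; rewrite wE.
  apply: (@smooth_eq _ _ U (fun z => Kop f u (Jc v) z * 2^-1)) => //.
    by move=> z Uz; rewrite wE.
  by apply: smoothM => //; [exact: smooth_Kop | exact: smooth_cst].
Qed.

Lemma dd_dd_sym f z u v w : smooth U f -> U z ->
  dd u (dd v (dd w f)) z = dd u (dd w (dd v f)) z.
Proof. by move=> sf Uz; apply: dd_on oU Uz _ => y Uy; exact: dd_sym oU sf Uy. Qed.

(** The form is closed because the six terms are third derivatives of [f] which
    cancel in pairs by symmetry. *)
Lemma closed_Kop f (w : form2 R N) z u1 u2 u3 : smooth U f ->
  (forall z u v, U z -> w z u v = 0 +i* (Kop f u (Jc v) z / 2)) -> U z ->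
  d2 w z u1 u2 u3 = 0.
Proof.
move=> sf wE Uz.
have E v u u' : cderive v (fun x => w x u u') z =
    0 +i* ((dd v (dd u (dd (Jc u') f)) z - dd v (dd (Jc u) (dd u' f)) z) / 2).
  rewrite cderiveE; congr (_ +i* _).
    by rewrite -(dd_cst 0 v z); apply: dd_on oU Uz _ => y Uy; rewrite wE.
  rewrite -ddB; [|exact: smooth_dd_diff (smooth_dd _ sf) Uz..].
  rewrite [RHS]mulrC -ddMc; last first.
    by apply: differentiableB; exact: smooth_dd_diff (smooth_dd _ sf) Uz.
  by apply: dd_on oU Uz _ => y Uy; rewrite wE//= KopJ// mulrC.
rewrite /d2 !E; simpc; congr (_ +i* _).
rewrite (dd_sym u2 u1 oU (smooth_dd _ sf) Uz).
rewrite (dd_sym u3 u1 oU (smooth_dd _ sf) Uz).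
rewrite (dd_dd_sym u1 (Jc u2) u3 sf Uz).
rewrite (dd_sym u3 (Jc u1) oU (smooth_dd _ sf) Uz) (dd_dd_sym (Jc u1) u3 u2 sf Uz).
rewrite (dd_sym u2 (Jc u1) oU (smooth_dd _ sf) Uz).
by abstract_dd; field.
Qed.

Lemma KopD f g z u v : smooth U f -> smooth U g -> U z ->
  Kop (fun y => f y + g y) u v z = Kop f u v z + Kop g u v z.
Proof. by move=> sf sg Uz; rewrite /Kop !(hessD oU)// addrACA. Qed.

Lemma KopB f g z u v : smooth U f -> smooth U g -> U z ->
  Kop (fun y => f y - g y) u v z = Kop f u v z - Kop g u v z.
Proof. by move=> sf sg Uz; rewrite /Kop !(hessB oU)// opprD addrACA. Qed.

Lemma Kop_sum (I : Type) (r : seq I) (f : I -> 'Cn[R]_N -> R) z u v :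
  (forall i, smooth U (f i)) -> U z ->
  Kop (fun y => \sum_(i <- r) f i y) u v z = \sum_(i <- r) Kop (f i) u v z.
Proof. by move=> sf Uz; rewrite /Kop !(hess_sum oU)// -big_split. Qed.

Lemma KopM f g z u v : smooth U f -> smooth U g -> U z ->
  Kop (fun y => f y * g y) u v z = f z * Kop g u v z + g z * Kop f u v z +
   (dd u f z * dd v g z + dd (Jc u) f z * dd (Jc v) g z) +
   (dd v f z * dd u g z + dd (Jc v) f z * dd (Jc u) g z).
Proof. by move=> sf sg Uz; rewrite /Kop !(hessM oU)//; abstract_dd; ring. Qed.

Lemma Kop_comp1 (A : set R) (h : R -> R) f z u v :
  (forall y, U y -> A (f y)) -> smooth A h -> smooth U f -> U z ->
  Kop (h \o f) u v z = dd (1 : R) (dd (1 : R) h) (f z) * Kq f u v z + dd (1 : R) h (f z) * Kop f u v z.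
Proof.
move=> UA sh sf Uz; rewrite /Kop /Kq !(hess_comp1 oU _ _ UA sh sf Uz).
by abstract_dd; ring.
Qed.

Lemma Kop_on f g z u v : U z -> (forall y, U y -> f y = g y) -> Kop f u v z = Kop g u v z.
Proof.
move=> Uz fg; rewrite /Kop; congr (_ + _).
  by apply: dd_on oU Uz _ => y Uy; exact: dd_on oU Uy fg.
by apply: dd_on oU Uz _ => y Uy; exact: dd_on oU Uy fg.
Qed.

End KForm.
End ComplexStructure.

(** * Holomorphic functions *)

Section ComplexLemmas.
Context {R : realType}.
Implicit Types a b : R[i].

Lemma Re_sub a b : complex.Re (a - b) = complex.Re a - complex.Re b.
Proof. by case: a b => ? ? []. Qed.

Lemma Im_sub a b : complex.Im (a - b) = complex.Im a - complex.Im b.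
Proof. by case: a b => ? ? []. Qed.

Lemma Re_mul a b : complex.Re (a * b) = complex.Re a * complex.Re b - complex.Im a * complex.Im b.
Proof. by case: a b => ? ? []. Qed.

Lemma Im_mul a b : complex.Im (a * b) = complex.Re a * complex.Im b + complex.Im a * complex.Re b.
Proof. by case: a b => ? ? []. Qed.

Lemma Re_inv a : complex.Re a^-1 = complex.Re a / (complex.Re a ^+ 2 + complex.Im a ^+ 2).
Proof. by case: a. Qed.

Lemma Im_inv a : complex.Im a^-1 = - complex.Im a / (complex.Re a ^+ 2 + complex.Im a ^+ 2).
Proof. by case: a => x y; rewrite /= mulNr. Qed.

Lemma cmod_sqr a : cmod a ^+ 2 = complex.Re a ^+ 2 + complex.Im a ^+ 2.
Proof. by case: a => x y; rewrite sqr_sqrtr// addr_ge0// sqr_ge0. Qed.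

Lemma cmod_ge0 a : 0 <= cmod a.
Proof. by case: a => x y; exact: sqrtr_ge0. Qed.

Lemma cmod_eq0 a : (cmod a == 0) = (a == 0).
Proof. by apply/eqP/eqP => [/Normc.eq0_normc //|->]; exact: Normc.normc0. Qed.

Lemma cmod_gt0 a : (0 < cmod a) = (a != 0).
Proof. by rewrite lt_def cmod_ge0 andbT cmod_eq0. Qed.

Lemma cmodM a b : cmod (a * b) = cmod a * cmod b.
Proof. exact: Normc.normcM. Qed.

Lemma sqsum_gt0 a : a != 0 -> 0 < complex.Re a ^+ 2 + complex.Im a ^+ 2.
Proof. by move=> a0; rewrite -cmod_sqr exprn_gt0// cmod_gt0. Qed.

Lemma complex_eq a b : complex.Re a = complex.Re b -> complex.Im a = complex.Im b -> a = b.
Proof. by case: a b => ? ? [? ?] /= -> ->. Qed.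

End ComplexLemmas.

Section Holomorphic.
Context {R : realType} {N : nat}.
Implicit Types (f g : 'Cn[R]_N -> R[i]) (u v z : 'Cn[R]_N) (U : set 'Cn[R]_N).

Definition cdiff f z :=
  differentiable (fun w => complex.Re (f w)) z /\ differentiable (fun w => complex.Im (f w)) z.

Lemma csmooth_cdiff U f z : csmooth U f -> U z -> cdiff f z.
Proof. by move=> [sr si] Uz; split; exact: smooth_differentiable Uz. Qed.

Lemma cderive_addl f z u v : cdiff f z -> cderive (u + v) f z = cderive u f z + cderive v f z.
Proof. by move=> [dr di]; rewrite !cderiveE !dd_addl. Qed.

Lemma cderive_scalel f z (a : R) u : cdiff f z -> cderive (a *: u) f z = a%:C * cderive u f z.
Proof. by move=> [dr di]; rewrite !cderiveE !dd_scalel//; simpc. Qed.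

Lemma cderive_on U f g z u : open U -> U z -> (forall y, U y -> f y = g y) ->
  cderive u f z = cderive u g z.
Proof.
by move=> oU Uz fg; rewrite !cderiveE; congr (_ +i* _); apply: dd_on oU Uz _ => y Uy; rewrite fg.
Qed.

Lemma cderive_cst (a : R[i]) z u : cderive u (fun=> a) z = 0.
Proof. by rewrite cderiveE !dd_cst. Qed.

Lemma cderiveB f g z u : cdiff f z -> cdiff g z ->
  cderive u (fun w => f w - g w) z = cderive u f z - cderive u g z.
Proof.
move=> [fr fi] [gr gi]; rewrite !cderiveE; simpc; rewrite -!ddB//.
by congr (dd u _ z +i* dd u _ z); apply/funext => w; case: (f w) (g w) => ? ? [].
Qed.

Lemma cderiveM f g z u : cdiff f z -> cdiff g z ->
  cderive u (fun w => f w * g w) z = f z * cderive u g z + cderive u f z * g z.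
Proof.
move=> [fr fi] [gr gi]; rewrite !cderiveE.
have -> : (fun w => complex.Re (f w * g w)) = (fun w =>
   complex.Re (f w) * complex.Re (g w) - complex.Im (f w) * complex.Im (g w)).
  by apply/funext => w; rewrite Re_mul.
have -> : (fun w => complex.Im (f w * g w)) = (fun w =>
   complex.Re (f w) * complex.Im (g w) + complex.Im (f w) * complex.Re (g w)).
  by apply/funext => w; rewrite Im_mul.
rewrite ddB; [|exact: differentiableM..]; rewrite ddD; [|exact: differentiableM..].
rewrite !ddM//; apply: complex_eq; abstract_dd;
  by case: (f z) (g z) => ? ? [? ?] /=; ring.
Qed.

Lemma csmooth_cst U (a : R[i]) : open U -> csmooth U (fun=> a).
Proof. by move=> oU; split; exact: smooth_cst. Qed.

Lemma csmoothB U f g : open U -> csmooth U f -> csmooth U g -> csmooth U (fun w => f w - g w).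
Proof.
move=> oU [fr fi] [gr gi]; split.
  by apply: smooth_eq (smoothB oU fr gr) => // z _; rewrite Re_sub.
by apply: smooth_eq (smoothB oU fi gi) => // z _; rewrite Im_sub.
Qed.

Lemma csmoothM U f g : open U -> csmooth U f -> csmooth U g -> csmooth U (fun w => f w * g w).
Proof.
move=> oU [fr fi] [gr gi]; split.
  apply: smooth_eq (smoothB oU (smoothM oU fr gr) (smoothM oU fi gi)) => // z _.
  by rewrite Re_mul.
apply: smooth_eq (smoothD oU (smoothM oU fr gi) (smoothM oU fi gr)) => // z _.
by rewrite Im_mul.
Qed.

Lemma csmoothV U f : open U -> (forall z, U z -> f z != 0) ->
  csmooth U f -> csmooth U (fun w => (f w)^-1).
Proof.
move=> oU f0 [fr fi].
have sn : smooth U ((fun x : R => x^-1) \o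
    (fun z => complex.Re (f z) * complex.Re (f z) + complex.Im (f z) * complex.Im (f z))).
  apply: (@smooth_comp1 _ _ _ oU [set x : R | x != 0]); last exact: smooth_invr.
    by move=> z Uz /=; rewrite -!expr2 gt_eqF// sqsum_gt0// f0.
  by apply: smoothD => //; exact: smoothM.
split.
  by apply: smooth_eq (smoothM oU fr sn) => // z _; rewrite Re_inv.
by apply: smooth_eq (smoothM oU (smoothN oU fi) sn) => // z _; rewrite Im_inv.
Qed.

(** The Cauchy-Riemann equations without coordinates: the real differential commutes with i. *)
Definition CR U f := csmooth U f /\
  forall z u, U z -> cderive (Jc u) f z = 'i%C * cderive u f z.

Lemma CR_holomorphic U f : CR U f -> holomorphic U f.
Proof.
move=> [sf fJ]; split => // z Uz k; rewrite /dzbar -Jc_re fJ// mulrA -expr2 sqr_i.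
by rewrite mulN1r subrr mul0r.
Qed.

Lemma cderive_basis f z u : cdiff f z -> cderive u f z =
  \sum_k ((u.1 0 k)%:C * cderive (e_re k) f z + (u.2 0 k)%:C * cderive (e_im k) f z).
Proof.
move=> [dr di]; rewrite cderiveE !dd_basis//.
rewrite -[LHS]/(Complex _ _) [LHS]complexE /= !rmorph_sum/= mulr_sumr -big_split.
by apply: eq_bigr => k _; rewrite !cderiveE /=; simpc.
Qed.

Lemma holomorphic_CR U f : holomorphic U f -> CR U f.
Proof.
move=> [sf fb]; split => // z u Uz.
have dim k : cderive (e_im k) f z = 'i%C * cderive (e_re k) f z.
  have := fb z Uz k; rewrite /dzbar => /eqP.
  rewrite mulf_eq0 invr_eq0 pnatr_eq0 orbF addrC addr_eq0 => /eqP E.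
  apply: (@mulfI _ 'i%C); first by rewrite eq_complex /= oner_eq0 andbF.
  by rewrite E mulrA -expr2 sqr_i mulN1r.
rewrite !cderive_basis; [|exact: csmooth_cdiff Uz..].
rewrite mulr_sumr; apply: eq_bigr => k _; rewrite dim /= mxE.
by case: (cderive _ _ _) => x y; simpc; congr (_ +i* _); ring.
Qed.

Section CRrules.
Variable U : set 'Cn[R]_N.
Hypothesis oU : open U.

Lemma CR_cst (a : R[i]) : CR U (fun=> a).
Proof. by split; [exact: csmooth_cst | move=> z u Uz; rewrite !cderive_cst mulr0]. Qed.

Lemma CR_B f g : CR U f -> CR U g -> CR U (fun w => f w - g w).
Proof.
move=> [sf fJ] [sg gJ]; split; first exact: csmoothB.
move=> z u Uz; rewrite !cderiveB; [|exact: csmooth_cdiff Uz..].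
by rewrite fJ// gJ// mulrBr.
Qed.

Lemma CR_M f g : CR U f -> CR U g -> CR U (fun w => f w * g w).
Proof.
move=> [sf fJ] [sg gJ]; split; first exact: csmoothM.
move=> z u Uz; rewrite !cderiveM; [|exact: csmooth_cdiff Uz..].
by rewrite fJ// gJ//; ring.
Qed.

Lemma CR_prod (I : Type) (r : seq I) (f : I -> 'Cn[R]_N -> R[i]) :
  (forall i, CR U (f i)) -> CR U (fun w => \prod_(i <- r) f i w).
Proof.
move=> cf; elim: r => [|i r IH].
  by rewrite (_ : (fun _ => _) = (fun=> 1));
    [exact: CR_cst | apply/funext => w; rewrite big_nil].
rewrite (_ : (fun _ => _) = (fun w => f i w * \prod_(j <- r) f j w)); first exact: CR_M.
by apply/funext => w; rewrite big_cons.
Qed.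

Lemma CR_V f : (forall z, U z -> f z != 0) -> CR U f -> CR U (fun w => (f w)^-1).
Proof.
move=> f0 [sf fJ]; have sV := csmoothV oU f0 sf; split => // z u Uz.
have E v : cderive v (fun w => (f w)^-1) z = - (cderive v f z / f z) / f z.
  have : cderive v (fun w => f w * (f w)^-1) z = 0.
    rewrite -(cderive_cst 1 z v); apply: cderive_on oU Uz _ => y Uy.
    by rewrite divff// f0.
  rewrite cderiveM; [|exact: csmooth_cdiff Uz..].
  move=> /eqP; rewrite addr_eq0 => /eqP H; apply: (mulfI (f0 _ Uz)); rewrite H.
  by rewrite mulrCA mulrV ?mulr1// unitfE f0.
by rewrite !E fJ//; ring.
Qed.

Lemma CR_Re f z u : CR U f -> U z ->
  dd (Jc u) (fun w => complex.Re (f w)) z = - dd u (fun w => complex.Im (f w)) z.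
Proof.
move=> [_ fJ] Uz; have := congr1 (@complex.Re R) (fJ z u Uz); rewrite !cderiveE Re_mul /= mul0r mul1r.
by rewrite sub0r.
Qed.

Lemma CR_Im f z u : CR U f -> U z ->
  dd (Jc u) (fun w => complex.Im (f w)) z = dd u (fun w => complex.Re (f w)) z.
Proof.
move=> [_ fJ] Uz; have := congr1 (@complex.Im R) (fJ z u Uz); rewrite !cderiveE Im_mul /= mul0r mul1r.
by rewrite add0r.
Qed.

(** By the Cauchy-Riemann equations [D_(iu) D_(iv) Re f = - D_(iu) D_v Im f =
    - D_v D_u Re f], so that real and imaginary parts are pluriharmonic. *)
Lemma Kop_Re f z u v : CR U f -> U z -> Kop (fun w => complex.Re (f w)) u v z = 0.
Proof.
move=> cf Uz; have [[sr si] _] := cf.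
have -> : Kop (fun w => complex.Re (f w)) u v z =
   dd u (dd v (fun w => complex.Re (f w))) z +
   dd (Jc u) (fun w => - dd v (fun w => complex.Im (f w)) w) z.
  by congr (_ + _); apply: dd_on oU Uz _ => y Uy; exact: CR_Re.
rewrite ddN; last exact: smooth_dd_diff Uz.
rewrite (dd_sym _ v oU si Uz) -[X in _ - X](_ : dd v (dd u (fun w => complex.Re (f w))) z = _).
  by rewrite (dd_sym v u oU sr Uz) subrr.
by apply: dd_on oU Uz _ => y Uy; rewrite CR_Im.
Qed.

Lemma Kop_Im f z u v : CR U f -> U z -> Kop (fun w => complex.Im (f w)) u v z = 0.
Proof.
move=> cf Uz; have [[sr si] _] := cf.
have -> : Kop (fun w => complex.Im (f w)) u v z =
   dd u (dd v (fun w => complex.Im (f w))) z +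
   dd (Jc u) (dd v (fun w => complex.Re (f w))) z.
  by congr (_ + _); apply: dd_on oU Uz _ => y Uy; exact: CR_Im.
rewrite (dd_sym _ v oU sr Uz) [X in _ + X](_ : _ = dd v (fun w =>
   - dd u (fun w => complex.Im (f w)) w) z).
  rewrite ddN; last exact: smooth_dd_diff Uz.
  by rewrite (dd_sym v u oU si Uz) subrr.
by apply: dd_on oU Uz _ => y Uy; rewrite CR_Re.
Qed.

End CRrules.

Lemma dd1_ln (x : R) : 0 < x -> dd (1 : R) (@ln R) x = x^-1.
Proof. by move=> x0; rewrite ddE; have := is_derive1_ln x0 => H; rewrite derive_val. Qed.

Lemma dd11_ln (x : R) : 0 < x -> dd (1 : R) (dd (1 : R) (@ln R)) x = - (x^-1 * x^-1).
Proof.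
move=> x0; transitivity (dd (1 : R) (fun y : R => y^-1) x).
  by apply: (@dd_on _ _ [set x : R | 0 < x]) => // y; exact: dd1_ln.
rewrite ddE.
have := @deriveV _ _ id x (1 : R) (lt0r_neq0 x0) (@derivable_id _ _ _ _).
rewrite /= derive_id => ->.
by rewrite -[_ *: 1]/(_ * 1) mulr1 -exprVn expr2.
Qed.

(** [log |f|^2] is locally the real part of the holomorphic function [2 log f];
    without a branch of the logarithm, the two terms of the chain rule for
    [log (a^2 + b^2)] cancel by the Cauchy-Riemann equations. *)
Lemma Kop_ln_sqmod U f z u v : open U -> CR U f -> (forall y, U y -> f y != 0) -> U z ->
  Kop (fun w => ln (complex.Re (f w) ^+ 2 + complex.Im (f w) ^+ 2)) u v z = 0.
Proof.
move=> oU cf f0 Uz; have [[sr si] _] := cf.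
pose a w := complex.Re (f w); pose b w := complex.Im (f w).
pose g w := a w * a w + b w * b w.
have sg : smooth U g by apply: smoothD => //; exact: smoothM.
have g0 y : U y -> 0 < g y by move=> Uy; rewrite /g -!expr2 sqsum_gt0// f0.
have -> : (fun w => ln (complex.Re (f w) ^+ 2 + complex.Im (f w) ^+ 2)) = @ln R \o g.
  by apply/funext => w; rewrite /g /= -!expr2.
rewrite (Kop_comp1 oU u v (A := [set x : R | 0 < x]) g0 (@smooth_ln R) sg Uz).
rewrite dd1_ln ?g0// dd11_ln ?g0//.
have ga w : dd w g z = 2 * (a z * dd w a z + b z * dd w b z).
  have da := smooth_differentiable sr Uz; have db := smooth_differentiable si Uz.
  rewrite /g ddD; [|exact: differentiableM..].
  by rewrite !ddM//; abstract_dd; ring.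
have -> : Kop g u v z = 4 * (dd u a z * dd v a z + dd u b z * dd v b z).
  rewrite /g (KopD oU); [|exact: smoothM..|by []].
  rewrite !(KopM oU)// (Kop_Re oU _ _ cf Uz) (Kop_Im oU _ _ cf Uz).
  by rewrite !(CR_Re _ cf Uz) !(CR_Im _ cf Uz); rewrite -/a -/b; abstract_dd; ring.
rewrite /Kq !ga !(CR_Re _ cf Uz) !(CR_Im _ cf Uz) -/a -/b.
have := lt0r_neq0 (g0 _ Uz); rewrite /g; move: (a z) (b z) => az bz n0.
by abstract_dd; field.
Qed.

End Holomorphic.

(** * The function [eta] of [log kappa] *)

Section Eta.
Context {R : realType} {l : nat} (c : 'I_l.+1 -> R).
Hypothesis c0 : c ord0 = 0.
Hypothesis c_ge0 : forall k, 0 <= c k.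

Lemma prodc_lt (e e' : R) : 0 <= e -> e < e' -> \prod_k (c k + e) < \prod_k (c k + e').
Proof.
move=> e0 ee'; apply: ltr_prod; first by apply/hasP; exists ord0; rewrite // mem_index_enum.
by move=> k _; rewrite addr_ge0//= ltrD2l.
Qed.

Lemma prodc_inj (e e' : R) : 0 <= e -> 0 <= e' ->
  \prod_k (c k + e) = \prod_k (c k + e') -> e = e'.
Proof.
move=> e0 e'0 E; case: (ltgtP e e') => // [/(prodc_lt e0)|/(prodc_lt e'0)];
  by rewrite E ltxx.
Qed.

Lemma prodc0 : \prod_k (c k + 0) = 0.
Proof. by rewrite (bigD1 ord0)//= c0 addr0 mul0r. Qed.

(** Intermediate values between [0] and [1 + kap]; at the latter the factor of
    index 0 exceeds [kap] and all others are at least 1. *)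
Lemma prodc_surj (kap : R) : 0 <= kap -> exists2 e : R, 0 <= e & \prod_k (c k + e) = kap.
Proof.
move=> k0; pose f (e : R) := \prod_k (c k + e).
pose b := 1 + kap.
have b1 : 1 <= b by rewrite lerDl.
have b0 : 0 <= b by exact: le_trans b1.
have fb : kap <= f b.
  apply: (@le_trans _ _ b); first by rewrite lerDr.
  rewrite /f (bigD1 ord0)//= c0 add0r ler_peMr//.
  elim/big_ind: _ => // [x y x1 y1|k _]; first by rewrite -(mulr1 1) ler_pM.
  by rewrite (le_trans b1)// lerDr.
have cf : continuous f.
  rewrite /f; elim: (index_enum _) => [|k r IH] x.
    rewrite (_ : (fun _ => _) = cst 1); first exact: cst_continuous.
    by apply/funext => y; rewrite big_nil.
  rewrite (_ : (fun _ => _) = (fun y => (c k + y) * \prod_(i <- r) (c i + y))).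
    by apply: continuousM; [apply: continuousD; [exact: cst_continuous|] | exact: IH].
  by apply/funext => y; rewrite big_cons.
have [||e] := @IVT R f 0 b kap b0.
- exact: continuous_subspaceT.
- rewrite /f prodc0 -/(f b); have fb0 := le_trans k0 fb.
  by rewrite min_l// max_r// k0.
- by rewrite in_itv /= => /andP[e0 _] fe; exists e.
Qed.

Lemma eta_ofP (kap : R) : 0 <= kap ->
  0 <= eta_of c kap /\ \prod_k (c k + eta_of c kap) = kap.
Proof.
move=> k0; rewrite /eta_of; case: xgetP => [e _ [] //|].
by have [e e0 E] := prodc_surj k0 => /(_ e) []; split.
Qed.

Lemma eta_of_eq (kap e : R) : 0 <= e -> \prod_k (c k + e) = kap -> eta_of c kap = e.
Proof.
move=> e0 E; have [|h1 h2] := @eta_ofP kap.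
  by rewrite -E; apply: prodr_ge0 => k _; rewrite addr_ge0.
by apply: prodc_inj => //; rewrite E.
Qed.

(** [eta] as a function of [log kappa]. *)
Definition elog (x : R) : R := eta_of c (expR x).

Lemma prod_elog x : \prod_k (c k + elog x) = expR x.
Proof. by have [] := eta_ofP (expR_ge0 x). Qed.

Lemma elog_gt0 x : 0 < elog x.
Proof.
have [e0 E] := eta_ofP (expR_ge0 x); rewrite lt_def e0 andbT; apply/eqP => e00.
by move: E; rewrite -/(elog x) e00 prodc0 => E; have := expR_gt0 x; rewrite -E ltxx.
Qed.

Lemma c_elog_gt0 x k : 0 < c k + elog x.
Proof. by rewrite ltr_wpDl// elog_gt0. Qed.

(** [1 / sum_k 1 / (c_k + e)], the derivative of [eta] with respect to [log kappa]. *)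
Definition harm (e : R) : R := (\sum_k (c k + e)^-1)^-1.

Lemma sumV_gt0 (e : R) : 0 < e -> 0 < \sum_k (c k + e)^-1.
Proof.
move=> e0; have p k : 0 < (c k + e)^-1 by rewrite invr_gt0 ltr_wpDl.
rewrite (bigD1 ord0)//= ltr_pwDl// sumr_ge0// => k _; exact: ltW.
Qed.

Definition slog (e : R) : R := \sum_k ln (c k + e).

Lemma expR_slog (e : R) : 0 < e -> expR (slog e) = \prod_k (c k + e).
Proof.
move=> e0; rewrite /slog; elim/big_ind2: _ => [|x1 x2 y1 y2 <- <-|k _].
- by rewrite expR0.
- by rewrite expRD.
- by rewrite lnK// posrE ltr_wpDl.
Qed.

Lemma slogK (e : R) : 0 < e -> elog (slog e) = e.
Proof. by move=> e0; apply: eta_of_eq; [exact: ltW | rewrite expR_slog]. Qed.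

Lemma elogK x : slog (elog x) = x.
Proof. by apply: expR_inj; rewrite expR_slog ?elog_gt0// prod_elog. Qed.

Let pos_near (y : R) : 0 < y -> \forall z \near y, 0 < z.
Proof. by move=> y0; exact: lt_nbhsr. Qed.

Lemma differentiable_lncD k (e : R) : 0 < e -> differentiable (fun y => ln (c k + y)) e.
Proof.
move=> e0; apply: (@differentiable_comp _ _ _ _ (fun y => c k + y) (@ln R)).
  exact: differentiableD.
by apply: differentiable_ln; rewrite ltr_wpDl.
Qed.

Lemma dd_cD k (e v : R) : dd v (fun y => c k + y) e = v.
Proof. by rewrite ddD// dd_cst add0r ddE derive_id. Qed.

Lemma dd_lncD k (e : R) : 0 < e -> dd (1 : R) (fun y => ln (c k + y)) e = (c k + e)^-1.
Proof.
move=> e0; have ce0 : 0 < c k + e by rewrite ltr_wpDl.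
rewrite (@dd_comp1 _ _ (fun y => c k + y) (@ln R)); last exact: differentiable_ln.
  by rewrite dd1_ln// dd_cD mulr1.
exact: differentiableD.
Qed.

Lemma differentiable_slog (e : R) : 0 < e -> differentiable slog e.
Proof.
move=> e0; rewrite /slog.
have -> : (fun e => \sum_k ln (c k + e)) = \sum_k (fun e => ln (c k + e)).
  by apply/funext => x; rewrite fct_sumE.
by apply: differentiable_sum => k; exact: differentiable_lncD.
Qed.

(** [elog] is inverse to [slog = log prod_k (c_k + e)]. *)
Lemma is_derive_elog (x : R) : is_derive x (1 : R) elog (harm (elog x)).
Proof.
have y0 := elog_gt0 x; set y := elog x in y0 *.
have -> : x = slog y by rewrite elogK.
apply: is_derive_inverse.
- by near=> z; apply: slogK; near: z; exact: pos_near.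
- near=> z; apply: differentiable_continuous; apply: differentiable_slog.
  by near: z; exact: pos_near.
- have dy := differentiable_slog y0.
  apply: DeriveDef; first exact/diff_derivable.
  have := @dd_sum R R _ (index_enum _) (fun k e => ln (c k + e)) y 1
   (fun k => differentiable_lncD k y0).
  rewrite ddE => ->; apply: eq_bigr => k _; exact: dd_lncD.
- by rewrite gt_eqF// sumV_gt0.
Unshelve. all: by end_near. Qed.

Lemma smooth_harm : smooth [set e : R | 0 < e] harm.
Proof.
have o0 : open [set e : R | 0 < e] by exact: open_gt.
have sN : smooth [set e : R | 0 < e] (fun e => \sum_k (c k + e)^-1).
  apply: smooth_sum => // k.
  apply: (@smooth_comp1 _ _ _ o0 [set x | x != 0] (fun e => c k + e) (fun x => x^-1)).
  - by move=> e /= e0; rewrite gt_eqF// ltr_wpDl.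
  - apply: (@smooth_linear _ _ _ o0 _ id) => [x|v x]; first exact: differentiableD.
    by have := dd_cD k x v; rewrite ddE.
  - exact: smooth_invr.
apply: (smooth_comp1 o0 _ sN smooth_invr) => e /= e0.
by rewrite gt_eqF// sumV_gt0.
Qed.

Lemma differentiable_elog (x : R) : differentiable elog x.
Proof. by apply/derivable1_diffP; case: (is_derive_elog x). Qed.

Lemma dd_elog x : dd (1 : R) elog x = harm (elog x).
Proof. by rewrite ddE; have := is_derive_elog x => H; rewrite derive_val. Qed.

Lemma dd_scale1 (f : R -> R) (v x : R) : differentiable f x -> dd v f x = v * dd (1 : R) f x.
Proof. by move=> df; rewrite -dd_scalel// [_ *: _]mulr1. Qed.

(** The equation [elog' = harm o elog] lifts smoothness from each order to the next. *)
Lemma smooth_elog : smooth setT elog.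
Proof.
apply/smoothnP; elim=> [|n IH]; first by split=> // x _; exact: differentiable_elog.
apply: (@smoothnS_of _ _ _ _ _ (fun v x : R => v * (harm \o elog) x)).
- exact: openT.
- by move=> x _; exact: differentiable_elog.
- move=> v x _; transitivity (dd v elog x); first by rewrite ddE.
  rewrite dd_scale1; last exact: differentiable_elog.
  by rewrite dd_elog.
- move=> v; apply: smoothnM; [exact: openT | exact: smoothn_cst |].
  apply: (@smoothn_comp1 _ _ _ _ [set e | 0 < e]) => //.
  + exact: openT.
  + by move=> x _; exact: elog_gt0.
  + by move/smoothnP: smooth_harm; exact.
Qed.

(** [mu] as a function of [log kappa]. *)
Definition mulog (x : R) : R := l.+1%:R * elog x - \sum_k c k * ln (c k + elog x).

(** Since [c_k / (c_k + eta) = 1 - eta / (c_k + eta)], the derivative is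
    [eta' (l + 1 - sum_k c_k / (c_k + eta)) = eta' eta sum_k 1 / (c_k + eta) = eta]. *)
Lemma dd_mulog (x : R) : differentiable mulog x /\ dd (1 : R) mulog x = elog x.
Proof.
have y0 := elog_gt0 x; have de := differentiable_elog x.
have dk k : differentiable (fun x => ln (c k + elog x)) x.
  by apply: (@differentiable_comp _ _ _ _ elog (fun y => ln (c k + y))) => //; exact: differentiable_lncD.
have d1 : differentiable (fun x => l.+1%:R * elog x) x by exact: differentiableM.
have d2k k : differentiable (fun x => c k * ln (c k + elog x)) x by exact: differentiableM.
have d2 : differentiable (fun x => \sum_k c k * ln (c k + elog x)) x.
  rewrite (_ : (fun _ => _) = \sum_k (fun x => c k * ln (c k + elog x))).
    exact: differentiable_sum.
  by apply/funext => z; rewrite fct_sumE.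
split; first exact: differentiableB.
rewrite /mulog ddB// ddMc// dd_sum// dd_elog.
have S0 := lt0r_neq0 (sumV_gt0 y0).
under eq_bigr => k _.
  rewrite ddMc// (@dd_comp1 _ _ elog (fun y => ln (c k + y)))//; last exact: differentiable_lncD.
  rewrite dd_lncD// dd_elog mulrA.
  rewrite (_ : c k * (c k + elog x)^-1 = 1 - elog x * (c k + elog x)^-1); last first.
    by have := lt0r_neq0 (c_elog_gt0 x k) => n0; field.
  over.
rewrite -mulr_suml sumrB -mulr_sumr sumr_const card_ord.
rewrite /harm; move: S0; move: (\sum_k _) => S S0.
by field.
Qed.

Lemma smooth_mulog : smooth setT mulog.
Proof.
apply/smoothnP => -[|n]; first by split=> // x _; case: (dd_mulog x).
apply: (@smoothnS_of _ _ _ _ _ (fun v x : R => v * elog x)).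
- exact: openT.
- by move=> x _; case: (dd_mulog x).
- move=> v x _; have [d1 d2] := dd_mulog x.
  transitivity (dd v mulog x); first by rewrite ddE.
  by rewrite dd_scale1// d2.
- move=> v; apply: smoothnM; [exact: openT | exact: smoothn_cst |].
  by move/smoothnP: smooth_elog; exact.
Qed.

Lemma dd11_mulog x : dd (1 : R) (dd (1 : R) mulog) x = harm (elog x).
Proof.
by rewrite -dd_elog; congr (dd _ _ x); apply/funext => y; case: (dd_mulog y).
Qed.

End Eta.

(** * Coordinates and their squared moduli *)

Section Coordinates.
Context {R : realType} {N : nat}.
Implicit Types (u v z : 'Cn[R]_N) (k : 'I_N).

Lemma Cn_eq u v : (forall i, coord u i = coord v i) -> u = v.
Proof.
move=> H; rewrite [u]surjective_pairing [v]surjective_pairing.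
by congr pair; apply/rowP => i; have [] := H i.
Qed.

Lemma differentiable_re k z : differentiable (fun w : 'Cn[R]_N => w.1 0 k) z.
Proof.
apply: continuous_linear_differentiable => [h v y|y]; first by rewrite /= !mxE.
apply: (@continuous_comp _ _ _ fst (fun x : 'rV[R]_N => x 0 k)); first exact: cvg_fst.
exact: coord_continuous.
Qed.

Lemma differentiable_im k z : differentiable (fun w : 'Cn[R]_N => w.2 0 k) z.
Proof.
apply: continuous_linear_differentiable => [h v y|y]; first by rewrite /= !mxE.
apply: (@continuous_comp _ _ _ snd (fun x : 'rV[R]_N => x 0 k)); first exact: cvg_snd.
exact: coord_continuous.
Qed.

Lemma dd_linear (V : normedModType R) (f : V -> R) (x v : V) :
  (forall (h : R) (w y : V), f (h *: w + y) = h * f w + f y) -> dd v f x = f v.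
Proof.
move=> fl; rewrite ddE /derive.
rewrite (_ : (fun h => _) = (fun h : R => h^-1 *: (h *: f v))); last first.
  by apply/funext => h /=; rewrite fl addrK.
apply/cvg_lim => //; apply/cvgrPdist_le => e e0; near=> h.
have h0 : h != 0 by near: h; exact: nbhs_dnbhs_neq.
by rewrite scalerA mulVf// scale1r subrr normr0 ltW.
Unshelve. all: by end_near. Qed.

Lemma dd_re k z v : dd v (fun w : 'Cn[R]_N => w.1 0 k) z = v.1 0 k.
Proof. by rewrite dd_linear// => h a b; rewrite /= !mxE. Qed.

Lemma dd_im k z v : dd v (fun w : 'Cn[R]_N => w.2 0 k) z = v.2 0 k.
Proof. by rewrite dd_linear// => h a b; rewrite /= !mxE. Qed.

Lemma smooth_re U k : open U -> smooth U (fun w : 'Cn[R]_N => w.1 0 k).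
Proof.
move=> oU; apply: (@smooth_linear _ _ _ oU _ (fun v => v.1 0 k)) => [x|v x].
  exact: differentiable_re.
by rewrite -(dd_re k x v) ddE.
Qed.

Lemma smooth_im U k : open U -> smooth U (fun w : 'Cn[R]_N => w.2 0 k).
Proof.
move=> oU; apply: (@smooth_linear _ _ _ oU _ (fun v => v.2 0 k)) => [x|v x].
  exact: differentiable_im.
by rewrite -(dd_im k x v) ddE.
Qed.

Lemma cderive_coord k z v : cderive v (fun w : 'Cn[R]_N => coord w k) z = coord v k.
Proof. by rewrite cderiveE /= dd_re dd_im. Qed.

Lemma coordJ u k : coord (Jc u) k = 'i%C * coord u k.
Proof. by rewrite /coord /= mxE; simpc. Qed.

Lemma CR_coord U k : open U -> CR U (fun w : 'Cn[R]_N => coord w k).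
Proof.
move=> oU; split; first by split; [exact: smooth_re | exact: smooth_im].
by move=> z u _; rewrite !cderive_coord coordJ.
Qed.

Definition sqn k z : R := z.1 0 k ^+ 2 + z.2 0 k ^+ 2.

Lemma cmod_coord z k : cmod (coord z k) ^+ 2 = sqn k z.
Proof. by rewrite cmod_sqr. Qed.

Lemma sqn_gt0 z k : (0 < sqn k z) = (coord z k != 0).
Proof. by rewrite -cmod_coord exprn_even_gt0 // -[_ || _]/(cmod _ != 0) cmod_eq0. Qed.

Lemma smooth_sqn U k : open U -> smooth U (sqn k).
Proof.
move=> oU.
by apply: smoothD => //; apply: smoothM => //; [exact: smooth_re..|exact: smooth_im|exact: smooth_im].
Qed.

Lemma dd_sqn k z v : dd v (sqn k) z = 2 * (z.1 0 k * v.1 0 k + z.2 0 k * v.2 0 k).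
Proof.
have d1 := differentiable_re k z; have d2 := differentiable_im k z.
rewrite /sqn ddD; [|exact: differentiableM..].
rewrite !ddM// !dd_re !dd_im; ring.
Qed.

Lemma hess_sqn k z u v : dd u (dd v (sqn k)) z = 2 * (u.1 0 k * v.1 0 k + u.2 0 k * v.2 0 k).
Proof.
have d1 := differentiable_re k z; have d2 := differentiable_im k z.
have -> : dd v (sqn k) = (fun z => 2 * (v.1 0 k * z.1 0 k + v.2 0 k * z.2 0 k)).
  by apply/funext => y; rewrite dd_sqn; ring.
rewrite ddMc ?ddD ?ddMc ?dd_re ?dd_im//; first by ring.
- exact: differentiableM.
- exact: differentiableM.
- by apply: differentiableD; exact: differentiableM.
Qed.

Lemma Kop_sqn k z u v : Kop (sqn k) u v z = 4 * (u.1 0 k * v.1 0 k + u.2 0 k * v.2 0 k).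
Proof. by rewrite /Kop !hess_sqn /= !mxE; ring. Qed.

Lemma sqmodsE z : sqmods z = \row_j sqn j z.
Proof. by apply/rowP => j; rewrite !mxE cmod_coord. Qed.

Lemma smooth_sqmods (g : 'rV[R]_N -> R) : smooth setT g ->
  smooth setT (fun z : 'Cn[R]_N => g (sqmods z)).
Proof.
move=> sg; apply: (@smooth_eq _ _ _ (fun z : 'Cn[R]_N => g (\row_j sqn j z))).
- exact: openT.
- by move=> z _; rewrite sqmodsE.
- apply: smooth_comp_row => //; first exact: openT.
  by move=> j; apply: smooth_sqn; exact: openT.
Qed.

Lemma sqn_diff j z : differentiable (sqn j) z.
Proof. by apply: smooth_differentiable (smooth_sqn j (openT)) _. Qed.

Lemma dd_sqmods (g : 'rV[R]_N -> R) z v : smooth setT g ->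
  dd v (fun z : 'Cn[R]_N => g (sqmods z)) z =
  \sum_j dd v (sqn j) z * dd (delta_mx 0 j) g (sqmods z).
Proof.
move=> sg.
have -> : (fun z : 'Cn[R]_N => g (sqmods z)) = (fun z => g (\row_j sqn j z)).
  by apply/funext => y; rewrite sqmodsE.
rewrite dd_comp_row.
- by under eq_bigr do rewrite -sqmodsE.
- by move=> j; exact: sqn_diff.
- exact: smooth_differentiable sg _.
Qed.

Lemma dd_sqmods_torus (g : 'rV[R]_N -> R) z v : smooth setT g ->
  (forall j, dd v (sqn j) z = 0) -> dd v (fun z : 'Cn[R]_N => g (sqmods z)) z = 0.
Proof.
by move=> sg v0; rewrite dd_sqmods// big1// => j _; rewrite v0 mul0r.
Qed.

(** Torus orbits are isotropic for the form of a torus-invariant potential [g]. Of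
    the second derivatives only those of the squared moduli remain, as [g] and its
    partial derivatives are constant to first order along [u] and [v]; and vectors
    tangent to the orbit have coordinates [i b_j z_j], [i b'_j z_j] with [b_j], [b'_j]
    real, for which [Re (u_j conj (i v_j)) = 0]. *)
Lemma Kop_sqmods_torus (g : 'rV[R]_N -> R) z u v : smooth setT g ->
  (forall j, coord z j != 0) ->
  (forall j, dd u (sqn j) z = 0) -> (forall j, dd v (sqn j) z = 0) ->
  Kop (fun z : 'Cn[R]_N => g (sqmods z)) u (Jc v) z = 0.
Proof.
move=> sg z0 u0 v0.
have oT : open [set: 'Cn[R]_N] by exact: openT.
have sG := smooth_sqmods sg.
pose G j := fun z : 'Cn[R]_N => dd (delta_mx 0 j) g (sqmods z).
have sGj j : smooth setT (G j) by apply: smooth_sqmods; exact: smooth_dd.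
have dG j : differentiable (G j) z by exact: smooth_differentiable (sGj j) _.
have dsq j w : differentiable (dd w (sqn j)) z.
  by apply: smooth_dd_diff (smooth_sqn j oT) _.
rewrite (KopJ oT)//.
have E w w' : dd w (dd w' (fun z : 'Cn[R]_N => g (sqmods z))) z =
   \sum_j (dd w' (sqn j) z * dd w (G j) z + G j z * dd w (dd w' (sqn j)) z).
  have -> : dd w' (fun z : 'Cn[R]_N => g (sqmods z)) = (fun y => \sum_j dd w' (sqn j) y * G j y).
    by apply/funext => y; rewrite dd_sqmods.
  rewrite dd_sum; last by move=> j; exact: differentiableM.
  by apply: eq_bigr => j _; rewrite ddM.
rewrite !E -sumrB big1// => j _.
rewrite v0 mul0r add0r (_ : dd u (G j) z = 0); last first.
  by apply: dd_sqmods_torus => //; exact: smooth_dd.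
rewrite mulr0 add0r -mulrBr !hess_sqn /= !mxE.
have := u0 j; have := v0 j; rewrite !dd_sqn => V0 U0.
(* Multiplied by |z_j|^2, the expression lies in the ideal of U0 and V0. *)
have n0 : z.1 0 j ^+ 2 + z.2 0 j ^+ 2 != 0.
  by have := z0 j; rewrite -sqn_gt0 => /lt0r_neq0.
apply: (mulfI n0); rewrite mulr0.
move: V0 U0; move: (G j z) (z.1 0 j) (z.2 0 j) (u.1 0 j) (u.2 0 j) (v.1 0 j) (v.2 0 j).
move=> G0 a b u1 u2 v1 v2 V0 U0.
transitivity (4 * G0 * (a * u2 * (a * v1 + b * v2) - a * v2 * (a * u1 + b * u2) +
   b * v1 * (a * u1 + b * u2) - b * u1 * (a * v1 + b * v2))); first by ring.
have -> : a * u1 + b * u2 = 0 by lra.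
have -> : a * v1 + b * v2 = 0 by lra.
ring.
Qed.

End Coordinates.

(** * The projection to [z'] *)

Section Zprime.
Context {R : realType} {l m : nat}.
Implicit Types (u v z : 'Cn[R]_(l.+1 + m)).

Lemma zprime_lin (h : R) u v : zprime (h *: u + v) = h *: zprime u + zprime v.
Proof. by rewrite /zprime /= !linearP. Qed.

Lemma zprimeJ u : zprime (Jc u) = Jc (zprime u).
Proof. by rewrite /zprime /Jc /= linearN. Qed.

Lemma coord_zprime z j : coord (zprime z) j = coord z (rshift l.+1 j).
Proof. by rewrite /coord /= !mxE. Qed.

Lemma sqn_zprime z j : sqn j (zprime z) = sqn (rshift l.+1 j) z.
Proof. by rewrite -!cmod_coord coord_zprime. Qed.

Lemma differentiable_zprime z : differentiable (@zprime R l m) z.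
Proof.
apply: differentiable_pair.
  apply: continuous_linear_differentiable => [h v y|y]; first by rewrite /= linearP.
  apply: (@continuous_comp _ _ _ fst (@rsubmx R 1 l.+1 m)); first exact: cvg_fst.
  exact: continuous_rsubmx.
apply: continuous_linear_differentiable => [h v y|y]; first by rewrite /= linearP.
apply: (@continuous_comp _ _ _ snd (@rsubmx R 1 l.+1 m)); first exact: cvg_snd.
exact: continuous_rsubmx.
Qed.

Lemma dd_zprime (f : 'Cn[R]_m -> R) v :
  dd v (fun z => f (zprime z)) = fun z => dd (zprime v) f (zprime z).
Proof.
rewrite !ddE; apply: (@derive_pullback _ _ _ zprime) => // h u w.
exact: zprime_lin.
Qed.

Lemma smooth_zprime (f : 'Cn[R]_m -> R) : smooth setT f ->
  smooth setT (fun z : 'Cn[R]_(l.+1 + m) => f (zprime z)).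
Proof.
move=> sf; have := @smooth_pullback _ _ _ (@zprime R l m) zprime_lin differentiable_zprime _ _ sf.
by rewrite preimage_setT.
Qed.

Lemma Kop_zprime (f : 'Cn[R]_m -> R) u v z :
  Kop (fun z => f (zprime z)) u v z = Kop f (zprime u) (zprime v) (zprime z).
Proof. by rewrite /Kop !dd_zprime -!zprimeJ. Qed.

Lemma cderive_zprime (f : 'Cn[R]_m -> R[i]) u z :
  cderive u (fun z => f (zprime z)) z = cderive (zprime u) f (zprime z).
Proof.
rewrite !cderiveE (dd_zprime (fun w => complex.Re (f w))).
by rewrite (dd_zprime (fun w => complex.Im (f w))).
Qed.

Lemma CR_zprime (f : 'Cn[R]_m -> R[i]) : CR setT f ->
  CR setT (fun z : 'Cn[R]_(l.+1 + m) => f (zprime z)).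
Proof.
move=> [[sr si] fJ]; split.
  by split; [exact: (smooth_zprime sr) | exact: (smooth_zprime si)].
by move=> z u _; rewrite !cderive_zprime zprimeJ fJ.
Qed.

End Zprime.

(** * Tangent vectors of curves *)

Lemma dd_chain {R : realType} {V : normedModType R} (g : R -> V) (s : R) (f : V -> R) :
  differentiable g s -> differentiable f (g s) ->
  dd (1 : R) (f \o g) s = dd ('D_(1 : R) g s) f (g s).
Proof. by move=> dg df; rewrite !ddE (derive_comp _ dg df). Qed.

Lemma derive_coord {R : realType} {N : nat} (g : R -> 'Cn[R]_N) (s : R) i :
  differentiable g s -> coord ('D_(1 : R) g s) i =
    dd (1 : R) (fun x => (g x).1 0 i) s +i* dd (1 : R) (fun x => (g x).2 0 i) s.
Proof.
move=> dg; rewrite /coord -(dd_re i (g s)) -(dd_im i (g s)); congr (_ +i* _).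
  exact: esym (dd_chain dg (differentiable_re i (g s))).
exact: esym (dd_chain dg (differentiable_im i (g s))).
Qed.

Lemma derive_coord_eq {R : realType} {N : nat} (g h : R -> 'Cn[R]_N) (s : R) i :
  differentiable g s -> differentiable h s -> (forall x, coord (g x) i = coord (h x) i) ->
  coord ('D_(1 : R) g s) i = coord ('D_(1 : R) h s) i.
Proof.
move=> dg dh E; apply: etrans (derive_coord i dg) _.
apply: etrans (esym (derive_coord i dh)).
have -> : (fun x => (g x).1 0 i) = (fun x => (h x).1 0 i).
  by apply/funext => x; case: (E x).
have -> // : (fun x => (g x).2 0 i) = (fun x => (h x).2 0 i).
by apply/funext => x; case: (E x).
Qed.

Lemma tangent_dd0 {R : realType} {N : nat} (M : set 'Cn[R]_N) (f : 'Cn[R]_N -> R) z u a :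
  tangent M z u -> differentiable f z -> (forall y, M y -> f y = a) -> dd u f z = 0.
Proof.
move=> [g [g0 gM dg]] df fa.
have dg1 : differentiable g 0 by apply/derivable1_diffP; case: dg.
have E : 'D_(1 : R) g 0 = u by exact: derive_val.
rewrite -g0 in df *; rewrite ddE -E -(derive_comp (1 : R) dg1 df).
transitivity ('D_(1 : R) (cst a) (0 : R)); last exact: derive_cst.
by apply: near_eq_derive; near=> s => /=; apply: fa; near: s.
Unshelve. all: by end_near. Qed.

(** * Joint continuity of derivatives in the point and the direction *)

Section JointContinuity.
Context {R : realType} {N : nat} (U : set 'Cn[R]_N).
Hypothesis oU : open U.
Notation C := 'Cn[R]_N.

Lemma continuous_at_sum (X : topologicalType) (I : Type) (r : seq I) (f : I -> X -> R) x :
  (forall i, {for x, continuous (f i)}) -> {for x, continuous (fun y => \sum_(i <- r) f i y)}.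
Proof.
move=> cf; elim: r => [|i r IH].
  rewrite (_ : (fun _ => _) = cst 0); first exact: cst_continuous.
  by apply/funext => y; rewrite big_nil.
rewrite (_ : (fun _ => _) = fun y => f i y + \sum_(j <- r) f j y).
  by apply: continuousD.
by apply/funext => y; rewrite big_cons.
Qed.

Lemma continuous_at_near (X : topologicalType) (f g : X -> R) x :
  (\forall y \near x, f y = g y) -> {for x, continuous f} -> {for x, continuous g}.
Proof.
move=> fg cf; have E : f x = g x := nbhs_singleton fg.
by change (g @ x --> g x); rewrite -E; apply: cvg_trans cf; exact: near_eq_cvg.
Qed.

Lemma near_snd (u z : C) : U z -> \forall w \near (u, z), U w.2.
Proof. by move=> Uz; apply: (@cvg_snd _ _ (nbhs u) (nbhs z)); exact: open_nbhs_nbhs. Qed.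

Lemma continuous_at_fst_re (w : C * C) k : {for w, continuous (fun w : C * C => w.1.1 0 k)}.
Proof.
apply: (@continuous_comp _ _ _ fst (fun u : C => u.1 0 k)); first exact: cvg_fst.
exact/differentiable_continuous/differentiable_re.
Qed.

Lemma continuous_at_fst_im (w : C * C) k : {for w, continuous (fun w : C * C => w.1.2 0 k)}.
Proof.
apply: (@continuous_comp _ _ _ fst (fun u : C => u.2 0 k)); first exact: cvg_fst.
exact/differentiable_continuous/differentiable_im.
Qed.

Lemma continuous_at_snd (f : C -> R) (u z : C) : smooth U f -> U z ->
  {for (u, z), continuous (fun w : C * C => f w.2)}.
Proof.
move=> sf Uz; apply: (@continuous_comp _ _ _ snd f); first exact: cvg_snd.
exact/differentiable_continuous/(smooth_differentiable sf).
Qed.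

Lemma joint_dd (f : C -> R) (u z : C) : smooth U f -> U z ->
  {for (u, z), continuous (fun w : C * C => dd w.1 f w.2)}.
Proof.
move=> sf Uz.
apply: (@continuous_at_near _ (fun w : C * C => \sum_k
    (w.1.1 0 k * dd (e_re k) f w.2 + w.1.2 0 k * dd (e_im k) f w.2))).
  apply: filterS (near_snd u Uz) => w Uw; rewrite -dd_basis//.
  exact: smooth_differentiable Uw.
apply: continuous_at_sum => k; apply: continuousD; apply: continuousM.
- exact: continuous_at_fst_re.
- by apply: continuous_at_snd => //; exact: smooth_dd.
- exact: continuous_at_fst_im.
- by apply: continuous_at_snd => //; exact: smooth_dd.
Qed.

Lemma joint_hess (f : C -> R) (u z : C) : smooth U f -> U z ->
  {for (u, z), continuous (fun w : C * C => dd w.1 (dd w.1 f) w.2)}.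
Proof.
move=> sf Uz.
apply: (@continuous_at_near _ (fun w : C * C => \sum_k
    (w.1.1 0 k * dd w.1 (dd (e_re k) f) w.2 + w.1.2 0 k * dd w.1 (dd (e_im k) f) w.2))).
  apply: filterS (near_snd u Uz) => w Uw; rewrite -(hess_lincombr oU)// -Cn_basis//.
apply: continuous_at_sum => k; apply: continuousD; apply: continuousM.
- exact: continuous_at_fst_re.
- by apply: joint_dd => //; exact: smooth_dd.
- exact: continuous_at_fst_im.
- by apply: joint_dd => //; exact: smooth_dd.
Qed.

Lemma differentiable_Cn (V : normedModType R) (g : V -> C) x :
  (forall i, differentiable (fun y => (g y).1 0 i) x) ->
  (forall i, differentiable (fun y => (g y).2 0 i) x) -> differentiable g x.
Proof.
move=> d1 d2.
have -> : g = fun y => (\row_i (g y).1 0 i, \row_i (g y).2 0 i).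
  apply/funext => y; rewrite [LHS]surjective_pairing; congr pair; apply/rowP => i;
  by rewrite mxE.
by apply: differentiable_pair; exact: differentiable_row.
Qed.

Lemma continuous_Jc : continuous (@Jc R N).
Proof.
move=> u; apply: differentiable_continuous; apply: differentiable_Cn => i.
  under eq_fun do rewrite Jc1; apply: differentiableN; exact: differentiable_im.
exact: differentiable_re.
Qed.

Lemma joint_Kop (f : C -> R) (u z : C) : smooth U f -> U z ->
  {for (u, z), continuous (fun w : C * C => Kop f w.1 w.1 w.2)}.
Proof.
move=> sf Uz; apply: continuousD; first exact: joint_hess.
apply: (@continuous_comp _ _ _ (fun w : C * C => (Jc w.1, w.2))
  (fun w : C * C => dd w.1 (dd w.1 f) w.2)); last exact: joint_hess.
change ((Jc w.1, w.2) @[w --> (u, z)] --> (Jc u, z)).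
move=> A; apply: (@cvg_pair _ _ _ (nbhs (u, z)) (nbhs (Jc u)) (nbhs z) _ _ _
  (fun w : C * C => Jc w.1) (fun w : C * C => w.2)); last exact: cvg_snd.
by apply: (@cvg_comp _ _ _ fst (@Jc R N) _ (nbhs u)); [exact: cvg_fst | exact: continuous_Jc].
Qed.

Lemma compact_sphere : compact [set u : C | \sum_k sqn k u = 1].
Proof.
pose K0 := [set x : 'rV[R]_N | forall i, `[(-1 : R), 1]%classic (x 0 i)].
have cK0 : compact K0 by apply: (@rV_compact _ _ (fun=> `[(-1 : R), 1]%classic)) => i; exact: segment_compact.
apply: (@subclosed_compact _ _ (K0 `*` K0)); last 2 first.
- exact: compact_setX.
- move=> u /= u1.
  have H k : sqn k u <= 1.
    rewrite -u1 (bigD1 k)//= lerDl sumr_ge0// => i _.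
    by rewrite /sqn addr_ge0// sqr_ge0.
  by split=> i /=; rewrite in_itv /=; have := H i; rewrite /sqn;
    move: (u.1 0 i) (u.2 0 i) => a b; nra.
- rewrite (_ : [set u : C | _] = (fun u : C => \sum_k sqn k u) @^-1` [set 1]) //.
  apply: closed_comp; last exact: closed_eq.
  move=> u _; apply: continuous_at_sum => k.
  exact/differentiable_continuous/sqn_diff.
Qed.

End JointContinuity.

(** * Logarithmic coordinates near [Y_t] *)

Section Toric.
Context {R : realType} {l m : nat}.
Variables (lam : 'I_l.+1 -> 'rV[R]_m -> R) (rho : 'rV[R]_m -> R).
Variables (p : 'Cn[R]_m -> R[i]) (t : R[i]) (c : 'I_l.+1 -> R).
Hypothesis lam_smooth : forall k, smooth setT (lam k).
Hypothesis rho_smooth : smooth setT rho.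
Hypothesis lam_gt0 : forall k (z' : 'Cn[R]_m), 0 < lam k (sqmods z').
Hypothesis p_hol : holomorphic setT p.
Hypothesis t0 : t != 0.
Hypothesis c0 : c ord0 = 0.
Hypothesis c_ge0 : forall k, 0 <= c k.

Notation C := 'Cn[R]_(l.+1 + m).
Implicit Types (u v z : C).

Let oT : open [set: C]. Proof. exact: openT. Qed.
Let oT' : open [set: 'Cn[R]_m]. Proof. exact: openT. Qed.

Definition lamz k (z' : 'Cn[R]_m) : R := lam k (sqmods z').
Definition rhoz (z' : 'Cn[R]_m) : R := rho (sqmods z').
Definition lnlam k (z' : 'Cn[R]_m) : R := ln (lamz k z').

Lemma smooth_lamz k : smooth setT (lamz k). Proof. exact: smooth_sqmods. Qed.
Lemma smooth_rhoz : smooth setT rhoz. Proof. exact: smooth_sqmods. Qed.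
Lemma lamz_gt0 k (z' : 'Cn[R]_m) : 0 < lamz k z'. Proof. exact: lam_gt0. Qed.

Lemma smooth_lnlam k : smooth setT (lnlam k).
Proof.
apply: (@smooth_comp1 _ _ _ _ [set x : R | 0 < x] (lamz k) (@ln R)).
- exact: oT'.
- by move=> x _; exact: lamz_gt0.
- exact: smooth_lamz.
- exact: smooth_ln.
Qed.

Lemma dd_lnlam k (v z' : 'Cn[R]_m) : dd v (lnlam k) z' = (lamz k z')^-1 * dd v (lamz k) z'.
Proof.
rewrite (@dd_comp1 _ _ (lamz k) (@ln R)).
- by rewrite dd1_ln// lamz_gt0.
- exact: smooth_differentiable (smooth_lamz k) _.
- by apply: differentiable_ln; exact: lamz_gt0.
Qed.

Definition coords_prod z : R[i] := \prod_k coord z k.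
Definition tp z : R[i] := t * p (zprime z).

Lemma CR_coords_prod : CR setT coords_prod.
Proof. by apply: CR_prod => // k; exact: CR_coord. Qed.

Lemma CR_tp : CR setT tp.
Proof.
apply: CR_M => //; first exact: CR_cst.
by apply: CR_zprime; exact: holomorphic_CR.
Qed.

(** The region where all the logarithms below are defined. *)
Definition dom : set C := [set z | coords_prod z != 0 /\ tp z != 0].

Definition csqr (a : R[i]) : R := complex.Re a ^+ 2 + complex.Im a ^+ 2.

Lemma smooth_csqr (U : set C) (f : C -> R[i]) : open U -> csmooth U f ->
  smooth U (fun z => csqr (f z)).
Proof. by move=> oU [sr si]; apply: smoothD => //; exact: smoothM. Qed.

Lemma csqr_eq0 a : (csqr a == 0) = (a == 0).
Proof. by rewrite /csqr -cmod_sqr sqrf_eq0 cmod_eq0. Qed.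

Lemma csqr_gt0 a : (0 < csqr a) = (a != 0).
Proof. by rewrite lt_def csqr_eq0 addr_ge0 ?sqr_ge0// andbT. Qed.

Lemma csqrM a b : csqr (a * b) = csqr a * csqr b.
Proof. by rewrite /csqr -!cmod_sqr cmodM exprMn. Qed.

Lemma csmooth_continuous_csqr (f : C -> R[i]) : csmooth setT f ->
  continuous (fun z => csqr (f z)).
Proof.
move=> sf z; apply: differentiable_continuous.
exact: smooth_differentiable (smooth_csqr oT sf) _.
Qed.

Lemma open_nonzero (f : C -> R[i]) : csmooth setT f -> open [set z | f z != 0].
Proof.
move=> sf; rewrite (_ : [set z | f z != 0] = (fun z => csqr (f z)) @^-1` [set x : R | x != 0]).
  apply: open_comp; last exact: open_neq.
  by move=> z _; exact: csmooth_continuous_csqr.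
by apply/seteqP; split => z /=; rewrite csqr_eq0.
Qed.

Lemma open_dom : open dom.
Proof.
rewrite (_ : dom = [set z | coords_prod z != 0] `&` [set z | tp z != 0])//.
by apply: openI; apply: open_nonzero; [case: CR_coords_prod | case: CR_tp].
Qed.

Lemma dom_coord z k : dom z -> coord z k != 0.
Proof. by case=> /prodf_neq0 H _; exact: H. Qed.

Lemma csqr_coords_prod z : csqr (coords_prod z) = \prod_k sqn k z.
Proof.
rewrite /coords_prod /csqr -cmod_sqr.
elim/big_ind2: _ => [|x1 x2 y1 y2 <- <-|k _].
- by rewrite /cmod Normc.normc1 expr1n.
- by rewrite cmodM exprMn.
- by rewrite cmod_coord.
Qed.

(** [log kappa] and the logarithms of the functions [lambda_k |z_k|^2]. *)
Definition tau z : R :=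
  \sum_k lnlam k (zprime z) - \sum_j ln (sqn (rshift l.+1 j) z) + ln (csqr (tp z)).
Definition phi k z : R := lnlam k (zprime z) + ln (sqn (lshift m k) z).

Lemma smooth_lnsqn k : smooth dom (fun z => ln (sqn k z)).
Proof.
apply: (@smooth_comp1 _ _ _ open_dom [set x : R | 0 < x] (sqn k) (@ln R)).
- by move=> z dz /=; rewrite sqn_gt0 dom_coord.
- exact: smooth_sqn open_dom.
- exact: smooth_ln.
Qed.

Lemma smooth_lncsqr (f : C -> R[i]) : csmooth setT f -> (forall z, dom z -> f z != 0) ->
  smooth dom (fun z => ln (csqr (f z))).
Proof.
move=> sf f0.
apply: (@smooth_comp1 _ _ _ open_dom [set x : R | 0 < x] (fun z => csqr (f z)) (@ln R)).
- by move=> z dz /=; rewrite csqr_gt0 f0.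
- by apply: smooth_sub (smooth_csqr oT sf).
- exact: smooth_ln.
Qed.

Lemma smooth_dom_zprime (f : 'Cn[R]_m -> R) : smooth setT f -> smooth dom (fun z => f (zprime z)).
Proof. by move=> sf; apply: smooth_sub (smooth_zprime sf). Qed.

Lemma smooth_tau : smooth dom tau.
Proof.
have od := open_dom; apply: smoothD => //; last first.
  by apply: smooth_lncsqr; [case: CR_tp | move=> z []].
apply: smoothB => //; apply: smooth_sum => // k; last exact: smooth_lnsqn.
exact/smooth_dom_zprime/smooth_lnlam.
Qed.

Lemma smooth_phi k : smooth dom (phi k).
Proof.
apply: smoothD; [exact: open_dom | | exact: smooth_lnsqn].
exact/smooth_dom_zprime/smooth_lnlam.
Qed.

Lemma expR_phi k z : dom z -> expR (phi k z) = lamz k (zprime z) * sqn (lshift m k) z.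
Proof.
move=> dz; rewrite expRD !lnK// posrE ?lamz_gt0//.
by rewrite sqn_gt0 dom_coord.
Qed.

Lemma expR_sum_ln (I : finType) (f : I -> R) : (forall i, 0 < f i) ->
  expR (\sum_i ln (f i)) = \prod_i f i.
Proof.
move=> f0; elim/big_ind2: _ => [|x1 x2 y1 y2 <- <-|k _]; first by rewrite expR0.
  by rewrite expRD.
by rewrite lnK// posrE.
Qed.

Lemma expR_tau z : dom z -> expR (tau z) = kappa lam p t (zprime z).
Proof.
move=> dz; rewrite /kappa !expRD expRN !expR_sum_ln; last 2 first.
- by move=> k; exact: lamz_gt0.
- by move=> j; rewrite sqn_gt0 dom_coord.
rewrite lnK ?posrE ?csqr_gt0; last by case: dz.
congr (_ * _ * _); last by rewrite cmod_sqr.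
rewrite -prodfV; apply: eq_bigr => j _.
by rewrite cmod_coord sqn_zprime.
Qed.

Lemma eta_tau z : dom z -> eta lam p t c (zprime z) = elog c (tau z).
Proof. by move=> dz; rewrite /eta /elog expR_tau. Qed.

Lemma mu_tau z : dom z -> mu lam p t c (zprime z) = mulog c (tau z).
Proof. by move=> dz; rewrite /mu /mulog eta_tau. Qed.

Lemma dd_lncsqr (f : C -> R[i]) z u : csmooth setT f -> f z != 0 ->
  dd u (fun z => ln (csqr (f z))) z =
  (csqr (f z))^-1 * (2 * (complex.Re (f z) * complex.Re (cderive u f z) +
                          complex.Im (f z) * complex.Im (cderive u f z))).
Proof.
move=> sf f0; have [dr di] := csmooth_cdiff sf (I : [set: C] z).
have p0 : 0 < csqr (f z) by rewrite csqr_gt0.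
rewrite (@dd_comp1 _ _ (fun z => csqr (f z)) (@ln R)); last exact: differentiable_ln.
  rewrite dd1_ln// cderiveE /= /csqr ddD; [|exact: differentiableM..].
  by rewrite !dd_sqr// -mulrDr.
exact: smooth_differentiable (smooth_csqr oT sf) _.
Qed.

Lemma sum_phi z : dom z ->
  \sum_k phi k z = tau z - ln (csqr (tp z)) + ln (csqr (coords_prod z)).
Proof.
move=> dz; rewrite csqr_coords_prod.
have -> : ln (\prod_k sqn k z) = \sum_k ln (sqn k z).
  apply: expR_inj; rewrite expR_sum_ln ?lnK//; last by move=> k; rewrite sqn_gt0 dom_coord.
  by rewrite posrE prodr_gt0// => k _; rewrite sqn_gt0 dom_coord.
rewrite big_split_ord /tau /phi big_split /=; ring.
Qed.

(** The linearized equation of [Y_t]. *)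
Definition tangent_eq z u := cderive u coords_prod z = cderive u tp z.

(** By [sum_phi] the two sides differ by [log |z_0 ... z_n|^2 - log |tp|^2], which
    vanishes to first order along a solution of the linearized equation. *)
Lemma dd_tau_sum_phi z u : dom z -> coords_prod z = tp z -> tangent_eq z u ->
  dd u tau z = \sum_k dd u (phi k) z.
Proof.
move=> dz E Eu; have od := open_dom; have [Pz qz] := dz.
have [cP _] := CR_coords_prod; have [cq _] := CR_tp.
have H : dd u (fun z => ln (csqr (coords_prod z))) z = dd u (fun z => ln (csqr (tp z))) z.
  by rewrite !dd_lncsqr// E Eu.
have sP : smooth dom (fun z => ln (csqr (coords_prod z))).
  by apply: smooth_lncsqr => // y [].
have sq : smooth dom (fun z => ln (csqr (tp z))) by apply: smooth_lncsqr => // y [].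
rewrite -dd_sum; last by move=> k; exact: smooth_differentiable (smooth_phi k) _.
apply/eqP; rewrite -subr_eq0 -ddB; first last.
- by apply: smooth_differentiable (smooth_sum _ _ smooth_phi) dz.
- exact: smooth_differentiable smooth_tau dz.
rewrite (dd_on u (g := fun z => ln (csqr (tp z)) - ln (csqr (coords_prod z))) od dz); last first.
  by move=> y dy; rewrite sum_phi//; ring.
rewrite ddB; [|exact: smooth_differentiable dz..].
by rewrite H subrr.
Qed.

(** * The Hermitian form of [omega - ddbar mu] along the fibre *)

Lemma dd1_expR (x : R) : dd (1 : R) (@expR R) x = expR x.
Proof. by rewrite ddE derive_val. Qed.

Lemma dd11_expR (x : R) : dd (1 : R) (dd (1 : R) (@expR R)) x = expR x.
Proof. by rewrite (_ : dd (1 : R) (@expR R) = @expR R) ?dd1_expR//; apply/funext => y; rewrite dd1_expR. Qed.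

Definition pot z : R := \sum_k lamz k (zprime z) * sqn (lshift m k) z + rhoz (zprime z).

Lemma potentialE z : potential lam rho z = pot z.
Proof. by rewrite /potential /pot; under eq_bigr do rewrite cmod_coord. Qed.

Lemma smooth_pot_term k : smooth setT (fun z => lamz k (zprime z) * sqn (lshift m k) z).
Proof.
apply: smoothM => //; first exact/smooth_zprime/smooth_lamz.
exact: smooth_sqn.
Qed.

Lemma smooth_pot : smooth setT pot.
Proof.
apply: smoothD => //; last exact/smooth_zprime/smooth_rhoz.
by apply: smooth_sum => // k; exact: smooth_pot_term.
Qed.

(** The potential of [omega - ddbar mu]. *)
Definition potc z : R := pot z - mulog c (tau z).

Lemma smooth_mutau : smooth dom (mulog c \o tau).
Proof.
by apply: (smooth_comp1 open_dom (A := setT)) => //; [exact: smooth_tau | exact: smooth_mulog].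
Qed.

Lemma smooth_potc : smooth dom potc.
Proof.
apply: smoothB; [exact: open_dom | | exact: smooth_mutau].
exact: smooth_sub smooth_pot.
Qed.

Lemma omega_check_Kop z u v : dom z ->
  omega_check lam rho p t c z u v = 0 +i* (Kop potc u (Jc v) z / 2).
Proof.
move=> dz; have od := open_dom.
have smu : smooth dom (fun w => mu lam p t c (zprime w)).
  by apply: (smooth_eq od _ smooth_mutau) => y dy; rewrite mu_tau.
rewrite /omega_check (_ : (fun w => (potential lam rho w)%:C) = (fun w => (pot w)%:C)); last first.
  by apply/funext => w; rewrite potentialE.
rewrite (ddbar_Kop oT _ _ smooth_pot)// (ddbar_Kop od _ _ smu)//.
rewrite (Kop_on (f := fun w => mu lam p t c (zprime w)) (g := mulog c \o tau) od _ _ dz); last by move=> y dy; rewrite mu_tau.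
rewrite /potc (KopB od _ _ (smooth_sub _ smooth_pot) smooth_mutau)//.
by apply: complex_eq; rewrite /= ?subrr// mulrBl.
Qed.

Lemma Kop_lnsqn k z u v : dom z -> Kop (fun z => ln (sqn k z)) u v z = 0.
Proof.
move=> dz; apply: (@Kop_ln_sqmod _ _ dom (fun z => coord z k)) => //.
- exact: open_dom.
- by apply: CR_coord; exact: open_dom.
- by move=> y dy; exact: dom_coord.
Qed.

Lemma CR_sub (U U' : set C) (f : C -> R[i]) : U' `<=` U -> CR U f -> CR U' f.
Proof.
move=> s [[sr si] fJ]; split; last by move=> z u /s; exact: fJ.
by split; [exact: smooth_sub sr | exact: smooth_sub si].
Qed.

Lemma Kop_lntp z u v : dom z -> Kop (fun z => ln (csqr (tp z))) u v z = 0.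
Proof.
move=> dz; apply: (@Kop_ln_sqmod _ _ dom tp) => //.
- exact: open_dom.
- by apply: CR_sub CR_tp.
- by move=> y [].
Qed.

Lemma Kop_phi k z u v : dom z ->
  Kop (phi k) u v z = Kop (lnlam k) (zprime u) (zprime v) (zprime z).
Proof.
move=> dz; rewrite /phi (KopD open_dom) ?Kop_lnsqn// ?addr0 ?Kop_zprime//.
  exact/smooth_dom_zprime/smooth_lnlam.
exact: smooth_lnsqn.
Qed.

Lemma Kop_tau z u v : dom z ->
  Kop tau u v z = \sum_k Kop (lnlam k) (zprime u) (zprime v) (zprime z).
Proof.
move=> dz; have od := open_dom.
have s1 k : smooth dom (fun z => lnlam k (zprime z)) by exact/smooth_dom_zprime/smooth_lnlam.
have s2 (j : 'I_m) : smooth dom (fun z => ln (sqn (rshift l.+1 j) z)) by exact: smooth_lnsqn.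
have s3 : smooth dom (fun z => ln (csqr (tp z))).
  by apply: smooth_lncsqr; [case: CR_tp | move=> y []].
have s12 := smoothB od (smooth_sum od (index_enum _) s1) (smooth_sum od (index_enum _) s2).
rewrite /tau (KopD od _ _ s12 s3)// Kop_lntp// addr0.
rewrite (KopB od _ _ (smooth_sum od _ s1) (smooth_sum od _ s2))//.
rewrite !(Kop_sum od)// [X in _ - X]big1 ?subr0; last by move=> j _; rewrite Kop_lnsqn.
by apply: eq_bigr => k _; rewrite Kop_zprime.
Qed.

(** The part of the Hermitian form which depends on [z'] only. It is the form that
    [omega] induces on the base by symplectic reduction at the level [c]. *)
Definition base_form (u' v' z' : 'Cn[R]_m) : R :=
  \sum_k c k * Kop (lnlam k) u' v' z' + Kop rhoz u' v' z'.

(** The second derivatives of [exp phi_k] and [mulog tau] contribute [A_k Kq phi_k]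
    and [harm Kq tau], and the first derivatives contribute
    [A_k Kop log lambda_k - eta Kop log lambda_k = c_k Kop log lambda_k]. *)
Lemma Kop_potc z u v : dom z -> (forall k, expR (phi k z) = c k + elog c (tau z)) ->
  Kop potc u v z = base_form (zprime u) (zprime v) (zprime z)
    + (\sum_k (c k + elog c (tau z)) * Kq (phi k) u v z
       - harm c (elog c (tau z)) * Kq tau u v z).
Proof.
move=> dz zL; have od := open_dom.
have se k : smooth dom (@expR R \o phi k).
  by apply: (smooth_comp1 od (A := setT)) => //; [exact: smooth_phi | exact: smooth_expR].
have sr : smooth dom (fun z => rhoz (zprime z)) by exact/smooth_dom_zprime/smooth_rhoz.
rewrite /potc (KopB od _ _ (smooth_sub _ smooth_pot) smooth_mutau)//.
rewrite (Kop_on (f := pot) (g := fun z => \sum_k (@expR R \o phi k) z + rhoz (zprime z)) od u v dz); last first.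
  by move=> y dy; rewrite /pot; congr (_ + _); apply: eq_bigr => k _ /=; rewrite expR_phi.
rewrite (KopD od _ _ (smooth_sum od _ se) sr)// (Kop_sum od _ _ _ se)//.
rewrite (Kop_comp1 od u v (A := setT) _ (smooth_mulog c0 c_ge0) smooth_tau dz)//.
rewrite dd11_mulog//; have [_ ->] := dd_mulog c0 c_ge0 (tau z).
under eq_bigr => k _.
  rewrite (Kop_comp1 od u v (A := setT) _ smooth_expR (smooth_phi k) dz)//.
  rewrite dd1_expR dd11_expR zL Kop_phi// -mulrDr.
  rewrite mulrDr [X in _ + X]mulrDl addrCA; over.
rewrite !big_split /= Kop_tau// -mulr_sumr Kop_zprime /base_form.
by move: (\sum_k _) (\sum_k _) (\sum_k _) => a1 a2 a3; ring.
Qed.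

Lemma Kop_lamz k (u' v' z' : 'Cn[R]_m) :
  Kop (lamz k) u' v' z' = lamz k z' * (Kq (lnlam k) u' v' z' + Kop (lnlam k) u' v' z').
Proof.
have -> : lamz k = @expR R \o lnlam k.
  by apply/funext => y /=; rewrite lnK// posrE lamz_gt0.
rewrite (Kop_comp1 oT' u' v' (A := setT) _ smooth_expR (smooth_lnlam k))//.
by rewrite dd1_expR dd11_expR /= [RHS]mulrDr.
Qed.

Lemma dd_lamz k (v' z' : 'Cn[R]_m) : dd v' (lamz k) z' = lamz k z' * dd v' (lnlam k) z'.
Proof. by rewrite dd_lnlam mulrA mulfV ?mul1r// gt_eqF// lamz_gt0. Qed.

(** At the point over [z'] with [lambda_k |z_k|^2 = c_k], in the direction over
    [u'] along which every [lambda_k |z_k|^2] is stationary, the Kaehler form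
    [omega] takes the value of [base_form]. *)
Lemma base_form_gt0 (u' z' : 'Cn[R]_m) :
  kahler_potential (fun z : C => (potential lam rho z)%:C) -> u' != 0 ->
  0 < base_form u' u' z'.
Proof.
move=> kahl u'0.
pose P k := dd u' (lnlam k) z'; pose Q k := dd (Jc u') (lnlam k) z'.
pose s k := Num.sqrt (c k / lamz k z').
(* The coordinates z_k are real, and u_k = - z_k d'(log lambda_k)(u'), where d' is
   the part of type (1,0) of the differential. *)
pose z : C := (row_mx (\row_k s k) z'.1, row_mx 0 z'.2).
pose u : C := (row_mx (\row_k (- (s k * P k / 2))) u'.1,
               row_mx (\row_k (s k * Q k / 2)) u'.2).
have zz : zprime z = z' by rewrite /zprime /= !row_mxKr; case: (z').
have uu : zprime u = u' by rewrite /zprime /= !row_mxKr; case: (u').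
have z1 k : z.1 0 (lshift m k) = s k by rewrite /= row_mxEl mxE.
have z2 k : z.2 0 (lshift m k) = 0 by rewrite /= row_mxEl mxE.
have u1 k : u.1 0 (lshift m k) = - (s k * P k / 2) by rewrite /= row_mxEl mxE.
have u2 k : u.2 0 (lshift m k) = s k * Q k / 2 by rewrite /= row_mxEl mxE.
have u0 : u != 0 by apply: contra_neq u'0 => u0; rewrite -uu u0 /zprime /= !linear0.
clearbody z u.
have := kahl z u u0.
rewrite (_ : (fun w : C => (potential lam rho w)%:C) = (fun w => (pot w)%:C)); last first.
  by apply/funext => w; rewrite potentialE.
move=> /(kahler_Kop oT smooth_pot I).
rewrite /pot (KopD oT _ _ (smooth_sum oT _ smooth_pot_term) (smooth_zprime smooth_rhoz))//.
rewrite (Kop_sum oT _ _ _ smooth_pot_term)// Kop_zprime uu zz.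
congr (0 < _ + _); apply: eq_bigr => k _.
have ss : s k ^+ 2 = c k / lamz k z'.
  by rewrite sqr_sqrtr// divr_ge0// ltW// lamz_gt0.
rewrite (KopM oT _ _ (smooth_zprime (smooth_lamz k)) (smooth_sqn _ oT))//.
rewrite !(dd_zprime (lamz k)) Kop_zprime Kop_sqn !dd_sqn Jc1 Jc2 zprimeJ uu zz.
rewrite !dd_lamz -/(P k) -/(Q k) Kop_lamz /Kq -/(P k) -/(Q k).
rewrite /sqn z1 z2 u1 u2.
transitivity (lamz k z' * s k ^+ 2 * Kop (lnlam k) u' u' z'); first by field.
by rewrite ss; have := lt0r_neq0 (lamz_gt0 k z') => l0; field.
Qed.

(** Cauchy-Schwarz inequality for the weights [A_k] and [1 / A_k]. The difference of
    the two sides is a weighted sum of squares of the deviations from the case of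
    equality, [x_k] proportional to [1 / A_k]. *)
Lemma harmonic_le (A x : 'I_l.+1 -> R) : (forall k, 0 < A k) ->
  (\sum_k (A k)^-1)^-1 * (\sum_k x k) ^+ 2 <= \sum_k A k * x k ^+ 2.
Proof.
move=> A0; pose S := \sum_k (A k)^-1; pose X := \sum_k x k.
have S0 : 0 < S.
  rewrite /S (bigD1 ord0)//= ltr_pwDl ?invr_gt0// sumr_ge0// => k _.
  by rewrite ltW// invr_gt0.
rewrite -subr_ge0 -/S -/X.
have -> : \sum_k A k * x k ^+ 2 - S^-1 * X ^+ 2 =
   \sum_k A k * (x k - X / (A k * S)) ^+ 2.
  transitivity (\sum_k (A k * x k ^+ 2 - 2 * X / S * x k + (X / S) ^+ 2 * (A k)^-1)).
    rewrite big_split sumrB /= -!mulr_sumr -/S -/X.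
    by have := lt0r_neq0 S0 => n0; field.
  apply: eq_bigr => k _; have := lt0r_neq0 S0; have := lt0r_neq0 (A0 k) => n0 n1.
  by field; rewrite n0 n1.
by apply: sumr_ge0 => k _; rewrite mulr_ge0 ?sqr_ge0// ltW.
Qed.

Lemma tangent_eqJ z u : tangent_eq z u -> tangent_eq z (Jc u).
Proof.
have [_ JP] := CR_coords_prod; have [_ Jq] := CR_tp.
by rewrite /tangent_eq => E; rewrite (JP z u I) (Jq z u I) E.
Qed.

Definition tauz (z' : 'Cn[R]_m) : R :=
  \sum_k lnlam k z' - \sum_j ln (sqn j z') + ln (csqr (t * p z')).

Lemma tauE z : tau z = tauz (zprime z).
Proof.
rewrite /tau /tauz; congr (_ - _ + _).
by apply: eq_bigr => j _; rewrite sqn_zprime.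
Qed.

Lemma dd_tau_vertical z u : zprime u = 0 -> dd u tau z = 0.
Proof.
move=> u0; have -> : tau = fun z => tauz (zprime z) by apply/funext => y; exact: tauE.
by rewrite dd_zprime u0 ddE derive0.
Qed.

Lemma zprime0_coord_neq0 u : u != 0 -> zprime u = 0 -> exists k, coord u (lshift m k) != 0.
Proof.
move=> un0 u0; apply: contrapT => H; move/eqP: un0; apply.
have uc i : coord u i = 0.
  case: (fintype.split_ordP i) => k ->.
    by apply: contrapT => /eqP Hk; apply: H; exists k.
  by rewrite -coord_zprime u0 /coord /= !mxE.
rewrite [u]surjective_pairing; congr pair; apply/rowP => i; rewrite mxE.
  by have [] := uc i.
by have [] := uc i.
Qed.

Lemma dd_lnsqn k z u : dom z ->
  dd u (fun z => ln (sqn k z)) z = (sqn k z)^-1 * (2 * (z.1 0 k * u.1 0 k + z.2 0 k * u.2 0 k)).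
Proof.
move=> dz; have k0 : 0 < sqn k z by rewrite sqn_gt0 dom_coord.
rewrite (@dd_comp1 _ _ (sqn k) (@ln R)); last exact: differentiable_ln.
  by rewrite dd1_ln// dd_sqn.
exact: sqn_diff.
Qed.

Lemma dd_phi k z u : dom z ->
  dd u (phi k) z = dd (zprime u) (lnlam k) (zprime z) + dd u (fun z => ln (sqn (lshift m k) z)) z.
Proof.
move=> dz; rewrite /phi ddD ?dd_zprime//.
  exact: smooth_differentiable (smooth_zprime (smooth_lnlam k)) _.
exact: smooth_differentiable (smooth_lnsqn _) dz.
Qed.

Lemma Kq_ge0 (f : C -> R) u z : 0 <= Kq f u u z.
Proof. by rewrite /Kq -!expr2 addr_ge0// sqr_ge0. Qed.

Lemma Kq_phi_vertical k z u : dom z -> zprime u = 0 -> coord u (lshift m k) != 0 ->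
  0 < Kq (phi k) u u z.
Proof.
move=> dz u0 uk.
have Ju0 : zprime (Jc u) = 0 by rewrite zprimeJ u0 /Jc /= oppr0.
rewrite /Kq !dd_phi// u0 Ju0 ddE derive0 !add0r !dd_lnsqn// Jc1 Jc2.
have n0 := dom_coord (lshift m k) dz; rewrite -sqn_gt0 in n0.
rewrite -sqn_gt0 in uk; move: n0 uk; rewrite /sqn.
move: (z.1 0 _) (z.2 0 _) (u.1 0 _) (u.2 0 _) => a b x y ab xy.
have -> : ((a ^+ 2 + b ^+ 2)^-1 * (2 * (a * x + b * y)) *
   ((a ^+ 2 + b ^+ 2)^-1 * (2 * (a * x + b * y))) +
   (a ^+ 2 + b ^+ 2)^-1 * (2 * (a * - y + b * x)) *
   ((a ^+ 2 + b ^+ 2)^-1 * (2 * (a * - y + b * x)))) =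
   4 * (x ^+ 2 + y ^+ 2) / (a ^+ 2 + b ^+ 2).
  by have := lt0r_neq0 ab => n0; field.
by rewrite divr_gt0// mulr_gt0.
Qed.

(** For [zprime u != 0] the form on the base is positive and the remainder is
    nonnegative by [harmonic_le], applied to the derivatives of the [phi_k] along
    [u] and along [iu]. Otherwise [tau] is stationary and some [phi_k] is not. *)
Lemma potc_gt0 z u : kahler_potential (fun z : C => (potential lam rho z)%:C) ->
  dom z -> coords_prod z = tp z ->
  (forall k, expR (phi k z) = c k + elog c (tau z)) ->
  tangent_eq z u -> u != 0 -> 0 < Kop potc u u z.
Proof.
move=> kahl dz Pq zL Tu u0; rewrite Kop_potc//.
have A0 k : 0 < c k + elog c (tau z) by exact: c_elog_gt0.
have D1 := dd_tau_sum_phi dz Pq Tu.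
have D2 := dd_tau_sum_phi dz Pq (tangent_eqJ Tu).
have [u'0|u'0] := eqVneq (zprime u) 0.
  have Ju0 : zprime (Jc u) = 0 by rewrite zprimeJ u'0 /Jc /= oppr0.
  rewrite [X in harm _ _ * X](_ : _ = 0); last first.
    by rewrite /Kq !dd_tau_vertical// !mul0r addr0.
  rewrite mulr0 subr0 u'0 [base_form _ _ _](_ : _ = 0); last first.
    rewrite /base_form /Kop /Jc /= oppr0 -[(0, 0)]/(0 : 'Cn[R]_m).
    by rewrite !ddE derive0 !addr0 big1// => k _; rewrite !ddE !derive0 addr0 mulr0.
  have [k uk] := zprime0_coord_neq0 u0 u'0.
  rewrite add0r (bigD1 k)//= ltr_pwDl//; first by rewrite mulr_gt0// Kq_phi_vertical.
  by rewrite sumr_ge0// => i _; rewrite mulr_ge0 ?Kq_ge0// ltW.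
rewrite ltr_pwDl ?base_form_gt0// subr_ge0.
rewrite /Kq D1 D2 mulrDr -!expr2 /harm.
under [leRHS]eq_bigr do rewrite mulrDr -!expr2.
by rewrite big_split /= lerD// harmonic_le.
Qed.

Lemma base_form_torus (u' v' z' : 'Cn[R]_m) : (forall j, coord z' j != 0) ->
  (forall j, dd u' (sqn j) z' = 0) -> (forall j, dd v' (sqn j) z' = 0) ->
  base_form u' (Jc v') z' = 0.
Proof.
move=> z0 u0 v0; rewrite /base_form (Kop_sqmods_torus rho_smooth z0 u0 v0) addr0.
rewrite big1// => k _.
have := Kop_sqmods_torus (lam_smooth k) z0 u0 v0.
rewrite -/(lamz k) Kop_lamz => /eqP; rewrite mulf_eq0 (gt_eqF (lamz_gt0 _ _))/=.
rewrite [Kq _ _ _ _](_ : _ = 0) ?add0r; first by move=> /eqP ->; rewrite mulr0.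
rewrite /Kq JcK dd_oppl; last exact: smooth_differentiable (smooth_lnlam k) _.
rewrite !dd_lnlam (dd_sqmods_torus (lam_smooth k) u0) (dd_sqmods_torus (lam_smooth k) v0).
by rewrite !mulr0 mul0r oppr0 mulr0 addr0.
Qed.

(** The linearized equations of [S_(r,c)]; the second one is the derivative of
    [lambda_k |z_k|^2 = c_k + eta], as [d eta = harm d tau]. *)
Definition level_eq z u :=
  (forall j, dd u (sqn (rshift l.+1 j)) z = 0) /\
  (forall k, (c k + elog c (tau z)) * dd u (phi k) z = harm c (elog c (tau z)) * dd u tau z).

Lemma dd_sqn_zprime j z u : dd u (sqn (rshift l.+1 j)) z = dd (zprime u) (sqn j) (zprime z).
Proof.
rewrite (_ : sqn (rshift l.+1 j) = fun z => sqn j (zprime z)) ?dd_zprime//.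
by apply/funext => y; rewrite sqn_zprime.
Qed.

(** The terms in [phi_k] and [tau] cancel: by the level equations
    [A_k d phi_k] may be replaced with [harm d tau], and then [sum_k d phi_k] with
    [d tau]. *)
Lemma potc_isotropic z u v :
  dom z -> coords_prod z = tp z ->
  (forall k, expR (phi k z) = c k + elog c (tau z)) ->
  tangent_eq z u -> tangent_eq z v -> level_eq z u -> level_eq z v ->
  Kop potc u (Jc v) z = 0.
Proof.
move=> dz Pq zL Tu Tv [u0 ul] [v0 vl]; rewrite Kop_potc// zprimeJ base_form_torus; first last.
- by move=> j; rewrite -dd_sqn_zprime.
- by move=> j; rewrite -dd_sqn_zprime.
- by move=> j; rewrite coord_zprime dom_coord.
rewrite add0r; set h := harm _ _; set A := elog _ _ in ul vl h *.
have dphi k : differentiable (phi k) z by exact: smooth_differentiable (smooth_phi k) dz.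
have dtau : differentiable tau z by exact: smooth_differentiable smooth_tau dz.
transitivity (h * dd u tau z * dd (Jc v) tau z - h * dd v tau z * dd (Jc u) tau z
   - h * Kq tau u (Jc v) z); last first.
  by rewrite /Kq JcK dd_oppl//; abstract_dd; ring.
congr (_ - _).
rewrite (dd_tau_sum_phi dz Pq (tangent_eqJ Tv)) (dd_tau_sum_phi dz Pq (tangent_eqJ Tu)).
rewrite !mulr_sumr -sumrB; apply: eq_bigr => k _.
by rewrite -(ul k) -(vl k) /Kq JcK dd_oppl//; abstract_dd; ring.
Qed.

(** * Points and tangent vectors of [Y_t] *)

Let i0 : 'I_(l.+1 + m) := ord0.
Let il (i : 'I_(l + m)) : 'I_(l.+1 + m) := lift ord0 i.

Definition rest_prod z : R[i] := \prod_(i < l + m) coord z (il i).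

Lemma coords_prodE z : coords_prod z = coord z i0 * rest_prod z.
Proof. by rewrite /coords_prod big_ord_recl. Qed.

Lemma CR_rest_prod : CR setT rest_prod.
Proof. by apply: CR_prod => // i; exact: CR_coord. Qed.

Definition set0c (a : R[i]) z : C :=
  (\row_i (if i == i0 then complex.Re a else z.1 0 i),
   \row_i (if i == i0 then complex.Im a else z.2 0 i)).

Lemma coord_set0c a z : coord (set0c a z) i0 = a.
Proof. by rewrite /coord /set0c /= !mxE eqxx; case: a. Qed.

Lemma coord_set0c_il a z i : coord (set0c a z) (il i) = coord z (il i).
Proof. by rewrite /coord /set0c /= !mxE. Qed.

Lemma il_rshift j : rshift l.+1 j = il (rshift l j).
Proof. by apply: val_inj; rewrite /= /bump. Qed.

Lemma il_lshift (k : 'I_l) : lshift m (lift ord0 k) = il (lshift m k).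
Proof. by apply: val_inj. Qed.

Lemma Cn_eq0 u v : coord u i0 = coord v i0 ->
  (forall i, coord u (il i) = coord v (il i)) -> u = v.
Proof.
move=> H0 H; apply: Cn_eq => i; case: (unliftP (ord0 : 'I_(l.+1 + m)) i) => [j ->|->] //.
Qed.

Lemma zprime_il u v : (forall i, coord u (il i) = coord v (il i)) -> zprime u = zprime v.
Proof.
move=> H; rewrite /zprime; congr pair; apply/rowP => j; rewrite !mxE.
  by have := H (rshift l j); rewrite -il_rshift => -[].
by have := H (rshift l j); rewrite -il_rshift => -[].
Qed.

Lemma zprime_set0c a z : zprime (set0c a z) = zprime z.
Proof. by apply: zprime_il => i; rewrite coord_set0c_il. Qed.

Lemma rest_prod_set0c a z : rest_prod (set0c a z) = rest_prod z.
Proof. by apply: eq_bigr => i _; rewrite coord_set0c_il. Qed.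

Lemma tp_set0c a z : tp (set0c a z) = tp z.
Proof. by rewrite /tp zprime_set0c. Qed.

(** The point of [Y_t] with the same coordinates z_1, ..., z_n. *)
Definition solve0 z : C := set0c (tp z / rest_prod z) z.

Lemma rest_prod_neq0 z : dom z -> rest_prod z != 0.
Proof. by case; rewrite coords_prodE mulf_eq0 negb_or => /andP[]. Qed.

Lemma solve0_Yt z : rest_prod z != 0 -> coords_prod (solve0 z) = tp (solve0 z).
Proof.
move=> n0; rewrite coords_prodE /solve0 coord_set0c rest_prod_set0c tp_set0c.
by rewrite divfK.
Qed.

Lemma solve0_id z : rest_prod z != 0 -> coords_prod z = tp z -> solve0 z = z.
Proof.
move=> n0 E; apply: Cn_eq0 => [|i]; last by rewrite coord_set0c_il.
by rewrite coord_set0c -E coords_prodE mulfK.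
Qed.

Lemma differentiable_solve0 z : rest_prod z != 0 -> differentiable solve0 z.
Proof.
move=> n0.
have [cr _] := CR_rest_prod; have [cq _] := CR_tp.
pose U := [set w | rest_prod w != 0].
have oU : open U by exact: open_nonzero.
have [sr si] : csmooth U (fun w => tp w * (rest_prod w)^-1).
  by apply: csmoothM => //; [split; [exact: smooth_sub cq.1|exact: smooth_sub cq.2]
   | apply: csmoothV => //; split; [exact: smooth_sub cr.1|exact: smooth_sub cr.2]].
apply: differentiable_Cn => i.
  under eq_fun do rewrite mxE.
  by case: (i == i0); [exact: smooth_differentiable sr _ | exact: differentiable_re].
under eq_fun do rewrite mxE.
by case: (i == i0); [exact: smooth_differentiable si _ | exact: differentiable_im].
Qed.

(** Curves in [Y_t] are obtained by prescribing [z_1, ..., z_n] only. *)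
Lemma solve0_tangent (M : set C) (h : R -> C) z :
  rest_prod z != 0 -> coords_prod z = tp z -> h 0 = z -> differentiable h (0 : R) ->
  (\forall s \near (0 : R), M (solve0 (h s))) ->
  exists2 v, tangent M z v & forall i, coord v (il i) = coord ('D_(1 : R) h 0) (il i).
Proof.
move=> n0 Pq h0 dh hM; pose g := solve0 \o h.
have dg : differentiable g (0 : R).
  by apply: differentiable_comp => //; apply: differentiable_solve0; rewrite h0.
exists ('D_(1 : R) g 0).
  exists g; split => //; first by rewrite /g /= h0 solve0_id.
  by apply: DeriveDef => //; exact/diff_derivable.
by move=> i; apply: (derive_coord_eq dg dh) => s; exact: coord_set0c_il.
Qed.

Lemma cderive_coords_prod0 z w : (forall i, coord w (il i) = 0) ->
  cderive w coords_prod z = coord w i0 * rest_prod z.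
Proof.
move=> w0; have [cr _] := CR_rest_prod.
have -> : coords_prod = fun z => coord z i0 * rest_prod z.
  by apply/funext => y; rewrite coords_prodE.
rewrite cderiveM; [|exact: csmooth_cdiff (CR_coord i0 oT).1 I|exact: csmooth_cdiff cr I].
rewrite cderive_coord [cderive w rest_prod z](_ : _ = 0) ?mulr0 ?add0r//.
rewrite /rest_prod; elim: (index_enum _) => [|i r IH].
  rewrite (_ : (fun _ => _) = fun=> 1) ?cderive_cst//.
  by apply/funext => y; rewrite big_nil.
rewrite (_ : (fun _ => _) = fun y => coord y (il i) * \prod_(j <- r) coord y (il j)); last first.
  by apply/funext => y; rewrite big_cons.
have [cr' _] : CR setT (fun y : C => \prod_(j <- r) coord y (il j)).
  by apply: CR_prod => // j; exact: CR_coord.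
rewrite cderiveM; [|exact: csmooth_cdiff (CR_coord (il i) oT).1 I|exact: csmooth_cdiff cr' I].
by rewrite IH mulr0 add0r cderive_coord w0 mul0r.
Qed.

Lemma cderive_tp0 z w : zprime w = 0 -> cderive w tp z = 0.
Proof.
move=> w0; have [cq _] := CR_tp; rewrite cderiveE.
have E f : dd w (fun z : C => f (zprime z)) z = 0 by rewrite dd_zprime w0 ddE derive0.
by rewrite (E (fun y : 'Cn[R]_m => complex.Re (t * p y)))
  (E (fun y : 'Cn[R]_m => complex.Im (t * p y))).
Qed.

Lemma cderiveNl (f : C -> R[i]) z u : cdiff f z -> cderive (- u) f z = - cderive u f z.
Proof. by move=> df; rewrite -scaleN1r cderive_scalel// rmorphN1 mulN1r. Qed.

Lemma zprime_sub0 u : (forall i, coord u (il i) = 0) -> zprime u = 0.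
Proof.
move=> H; rewrite -[RHS](_ : zprime (0 : C) = 0); last by rewrite /zprime /= !linear0.
by apply: zprime_il => i; rewrite H /coord /= !mxE.
Qed.

Lemma coordB u v i : coord (u - v) i = coord u i - coord v i.
Proof. by rewrite /coord /= !mxE. Qed.

(** The linearized equation determines the component of index 0, whose coefficient
    [z_1 ... z_n] is nonzero. *)
Lemma tangent_eq_uniq z u v : rest_prod z != 0 -> tangent_eq z u -> tangent_eq z v ->
  (forall i, coord u (il i) = coord v (il i)) -> u = v.
Proof.
move=> n0 Tu Tv E.
have [cP _] := CR_coords_prod; have [cq _] := CR_tp.
have dP := csmooth_cdiff cP (I : [set: C] z); have dq := csmooth_cdiff cq (I : [set: C] z).
have w0 i : coord (u - v) (il i) = 0 by rewrite coordB E subrr.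
have := cderive_coords_prod0 z w0.
rewrite cderive_addl// cderiveNl// Tu Tv -cderiveNl// -cderive_addl//.
rewrite cderive_tp0; last exact: zprime_sub0.
move/esym/eqP; rewrite mulf_eq0 (negbTE n0) orbF coordB subr_eq0 => /eqP E0.
exact: Cn_eq0.
Qed.

Lemma Yt_eq z : (@Yt R l m p t) z <-> coords_prod z = tp z.
Proof. by []. Qed.

Lemma tangent_tangent_eq (M : set C) z u : M `<=` Yt p t -> tangent M z u -> tangent_eq z u.
Proof.
move=> MY Tu; have [cP _] := CR_coords_prod; have [cq _] := CR_tp.
have dP := csmooth_cdiff cP (I : [set: C] z); have dq := csmooth_cdiff cq (I : [set: C] z).
apply/eqP; rewrite -subr_eq0 -cderiveB// cderiveE.
have E y : M y -> coords_prod y - tp y = 0 by move=> /MY/Yt_eq ->; rewrite subrr.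
have [sr si] : csmooth setT (fun y => coords_prod y - tp y) by exact: csmoothB.
rewrite (tangent_dd0 (a := 0) Tu); first last.
- by move=> y /E ->.
- exact: smooth_differentiable sr (I : [set: C] z).
rewrite (tangent_dd0 (a := 0) Tu) ?eqxx//; last by move=> y /E ->.
exact: smooth_differentiable si (I : [set: C] z).
Qed.

Lemma near_solve0 (W : set C) (h : R -> C) z : open W -> W z -> rest_prod z != 0 ->
  coords_prod z = tp z -> h 0 = z -> differentiable h (0 : R) ->
  \forall s \near (0 : R), (Yt p t `&` W) (solve0 (h s)).
Proof.
move=> oW Wz n0 Pq h0 dh.
have cg : {for (0 : R), continuous (solve0 \o h)}.
  apply: differentiable_continuous; apply: differentiable_comp => //.
  by apply: differentiable_solve0; rewrite h0.
have N1 : \forall s \near (0 : R), W (solve0 (h s)).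
  by apply: cg; rewrite /= h0 solve0_id//; exact: open_nbhs_nbhs.
have N2 : \forall s \near (0 : R), rest_prod (h s) != 0.
  have ch : {for (0 : R), continuous h} by exact: differentiable_continuous.
  apply: (ch [set w | rest_prod w != 0]); rewrite h0; apply: open_nbhs_nbhs; split => //.
  by apply: open_nonzero; case: CR_rest_prod.
by apply: filterS2 N1 N2 => s Ws rs; split => //; exact: solve0_Yt.
Qed.

(** The curve obtained from the line through [z] directed by [u] has a velocity with
    the same coordinates of index [1, ..., n] as [u], and it is then equal to [u]. *)
Lemma tangent_eq_tangent (W : set C) z u : open W -> W z -> rest_prod z != 0 ->
  coords_prod z = tp z -> tangent_eq z u -> tangent (Yt p t `&` W) z u.
Proof.
move=> oW Wz n0 Pq Tu; pose h (s : R) : C := s *: u + z.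
have h0 : h 0 = z by rewrite /h scale0r add0r.
have ds : differentiable (fun s : R => s *: u) (0 : R) by exact: differentiableZl.
have dh : differentiable h (0 : R) by exact: differentiableD.
have [v Tv Ev] := solve0_tangent n0 Pq h0 dh (near_solve0 oW Wz n0 Pq h0 dh).
suff -> : u = v by [].
apply: tangent_eq_uniq n0 Tu _ _; first by apply: tangent_tangent_eq Tv => y [].
move=> i; rewrite Ev; congr (coord _ _).
rewrite deriveD//; [|exact: diff_derivable..].
by rewrite derive_cst addr0 deriveE// diff_val scale1r.
Qed.

Lemma tangent_extend (W : set C) z (a : 'I_(l + m) -> R[i]) : open W -> W z ->
  rest_prod z != 0 -> coords_prod z = tp z ->
  exists2 v, tangent (Yt p t `&` W) z v & forall i, coord v (il i) = a i.
Proof.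
move=> oW Wz n0 Pq.
pose u : C := (\row_i (if unlift ord0 i is Some j then complex.Re (a j) else 0),
               \row_i (if unlift ord0 i is Some j then complex.Im (a j) else 0)).
pose h (s : R) : C := s *: u + z.
have h0 : h 0 = z by rewrite /h scale0r add0r.
have ds : differentiable (fun s : R => s *: u) (0 : R) by exact: differentiableZl.
have dh : differentiable h (0 : R) by exact: differentiableD.
have [v Tv Ev] := solve0_tangent n0 Pq h0 dh (near_solve0 oW Wz n0 Pq h0 dh).
exists v => // i; rewrite Ev deriveD//; [|exact: diff_derivable..].
rewrite derive_cst addr0 deriveE// diff_val scale1r /coord /= !mxE liftK.
by case: (a i).
Qed.

Lemma Yt_submanifold (W : set C) : open W -> W `<=` dom ->
  complex_submanifold (l + m) (Yt p t `&` W).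
Proof.
move=> oW Wd z [/Yt_eq Pq Wz]; exists 1%N, W, (fun _ y => coords_prod y - tp y); split.
- by rewrite addn1.
- by [].
- move=> _; apply: CR_holomorphic; apply: CR_B => //.
    exact: CR_sub CR_coords_prod.
  exact: CR_sub CR_tp.
- move=> b; have n0 := rest_prod_neq0 (Wd _ Wz).
  pose w := set0c (b ord0 / rest_prod z) 0.
  have w0 i : coord w (il i) = 0 by rewrite coord_set0c_il /coord /= !mxE.
  exists w => i; rewrite ord1.
  have [cP _] := CR_coords_prod; have [cq _] := CR_tp.
  rewrite cderiveB; [|exact: csmooth_cdiff cP I|exact: csmooth_cdiff cq I].
  rewrite cderive_tp0; last exact: zprime_sub0.
  by rewrite subr0 cderive_coords_prod0// coord_set0c divfK.
- apply/seteqP; split => y /=.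
    by move=> [[/Yt_eq E Wy] _]; split => // _; rewrite E subrr.
  move=> [Wy /(_ ord0) /eqP]; rewrite subr_eq0 => /eqP E.
  by split => //; split.
Qed.

(** * The holomorphic volume form *)

Definition logmx z (v : 'I_(l + m) -> C) : 'M[R[i]]_(l + m) :=
  \matrix_(i, k) (coord (v i) (il k) / coord z (il k)).

Lemma Omega_logmx z (v : 'I_(l + m) -> C) : Omega_t z v = \det (logmx z v).
Proof. by []. Qed.

Lemma coord_lin (a : R[i]) u v i : coord (cscale a u + v) i = a * coord u i + coord v i.
Proof.
by rewrite /coord /cscale /= !mxE; case: a => x y; apply: complex_eq => /=.
Qed.

Lemma Omega_holomorphic_form : holomorphic_form dom (@Omega_t R l m).
Proof.
split.
- move=> z dz v i a u1 u2; rewrite !Omega_logmx.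
  rewrite (determinant_multilinear (i0 := i) (b := a) (c := 1)
    (B := logmx z (dfwith v i u1)) (C := logmx z (dfwith v i u2))) ?mul1r//.
  + by apply/rowP => k; rewrite !mxE !dfwithin coord_lin mul1r mulrDl mulrA.
  + by apply/matrixP => j k; rewrite !mxE !dfwithout// neq_lift.
  + by apply/matrixP => j k; rewrite !mxE !dfwithout// neq_lift.
- move=> z dz v i j ij vij; rewrite Omega_logmx; apply: (determinant_alternate ij) => k.
  by rewrite !mxE vij.
- move=> v; apply: CR_holomorphic; have od := open_dom.
  rewrite (_ : (fun z => _) = fun z => \det (\matrix_(i, k) coord (v i) (il k)) *
      \prod_k (coord z (il k))^-1); last first.
    apply/funext => z; rewrite Omega_logmx.
    have -> : \prod_k (coord z (il k))^-1 = \det (diag_mx (\row_k (coord z (il k))^-1)).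
      by rewrite det_diag; apply: eq_bigr => k _; rewrite mxE.
    rewrite -det_mulmx; congr (\det _); apply/matrixP => i k.
    by rewrite mul_mx_diag !mxE.
  apply: CR_M => //; first exact: CR_cst.
  apply: CR_prod => // i; apply: CR_V => //; first by move=> z dz; exact: dom_coord.
  exact: CR_coord.
Qed.

Lemma Omega_volume_form (W : set C) : open W -> W `<=` dom ->
  holomorphic_volume_form (Yt p t `&` W) (@Omega_t R l m).
Proof.
move=> oW Wd; split.
  exists dom; split; [exact: open_dom | by move=> z [_ /Wd] | exact: Omega_holomorphic_form].
move=> z [/Yt_eq Pq Wz]; have n0 := rest_prod_neq0 (Wd _ Wz).
have H i := tangent_extend (fun k => if k == i then coord z (il k) else 0) oW Wz n0 Pq.
pose v i := s2val (cid2 (H i)).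
exists v; first by move=> i; rewrite /v; case: cid2.
have vE i k : coord (v i) (il k) = if k == i then coord z (il k) else 0.
  by rewrite /v; case: cid2.
rewrite Omega_logmx (_ : logmx z v = 1%:M) ?det1 ?oner_neq0//.
apply/matrixP => i k; rewrite !mxE vE eq_sym; case: eqP => _; last by rewrite mul0r.
by rewrite divff// dom_coord//; exact: Wd.
Qed.

(** * The symplectic form on a neighbourhood of the fibre *)

Definition positive_region : set C :=
  [set z | dom z /\ forall u, tangent_eq z u -> u != 0 -> 0 < Kop potc u u z]^°.

(** The conditions [tangent_eq y u] and [0 < Kop potc u u y] are respectively closed
    and open in the pair [(u, y)]; by compactness of the unit sphere the points [y]
    where the former implies the latter for all unit vectors [u] form a neighbourhood
    of [z], and the case of unit vectors implies the general one by homogeneity. *)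
Lemma positive_regionP z : dom z ->
  (forall u, tangent_eq z u -> u != 0 -> 0 < Kop potc u u z) -> positive_region z.
Proof.
move=> dz zpos; have od := open_dom.
have ndom : \forall y \near z, dom y by exact: open_nbhs_nbhs.
have [cP _] := CR_coords_prod; have [cq _] := CR_tp.
have [sr si] : csmooth setT (fun y => coords_prod y - tp y) by exact: csmoothB.
have E y u : tangent_eq y u <-> dd u (fun y => complex.Re (coords_prod y - tp y)) y = 0 /\
    dd u (fun y => complex.Im (coords_prod y - tp y)) y = 0.
  rewrite /tangent_eq; split => [/eqP|[e1 e2]].
    rewrite -subr_eq0 -cderiveB; [|exact: csmooth_cdiff cP I|exact: csmooth_cdiff cq I].
    by rewrite cderiveE => /eqP [].
  apply/eqP; rewrite -subr_eq0 -cderiveB; [|exact: csmooth_cdiff cP I|exact: csmooth_cdiff cq I].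
  by rewrite cderiveE e1 e2.
have := (@compact_near_coveringP C _).1 (@compact_sphere R (l.+1 + m)).
move=> /(_ C (nbhs z) (fun y u => tangent_eq y u -> 0 < Kop potc u u y) _) cov.
have {cov} cov : \forall y \near z, [set u : C | \sum_k sqn k u = 1] `<=`
    (fun u => tangent_eq y u -> 0 < Kop potc u u y).
  apply: cov => u /= u1.
  have u0 : u != 0.
    apply/eqP => u0; move: u1; rewrite u0 big1 ?(eq_sym 0)//.
      by move/eqP; rewrite eq_sym oner_eq0.
    by move=> k _; rewrite /sqn !mxE expr0n addr0.
  have [Tu|nTu] := pselect (tangent_eq z u).
    have := @joint_Kop _ _ _ od _ u _ smooth_potc dz => /(_ [set x : R | 0 < x]) cK.
    have N : nbhs (u, z) (fun w : C * C => 0 < Kop potc w.1 w.1 w.2).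
      by apply: cK; apply: open_nbhs_nbhs; split; [exact: open_gt | exact: zpos].
    by apply: filterS N => w.
  have [n|n] : dd u (fun y => complex.Re (coords_prod y - tp y)) z != 0 \/
      dd u (fun y => complex.Im (coords_prod y - tp y)) z != 0.
    apply: contrapT => H; apply: nTu; apply/E.
    by split; apply: contrapT => /eqP Hn; apply: H; [left|right].
  - have N : nbhs (u, z) (fun w : C * C => dd w.1 (fun y => complex.Re (coords_prod y - tp y)) w.2 != 0).
      have := @joint_dd _ _ _ oT _ u _ sr (I : [set: C] z) => /(_ [set x : R | x != 0]); apply.
      by apply: open_nbhs_nbhs; split; [exact: open_neq | exact: n].
    by apply: filterS N => w /= /eqP w0 /E [].
  - have N : nbhs (u, z) (fun w : C * C => dd w.1 (fun y => complex.Im (coords_prod y - tp y)) w.2 != 0).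
      have := @joint_dd _ _ _ oT _ u _ si (I : [set: C] z) => /(_ [set x : R | x != 0]); apply.
      by apply: open_nbhs_nbhs; split; [exact: open_neq | exact: n].
    by apply: filterS N => w /= /eqP w0 /E [].
apply: filterS2 ndom cov => y dy yS; split => // u Tu u0.
pose a := \sum_k sqn k u.
have a0 : 0 < a.
  have [k uk] : exists k, coord u k != 0.
    apply: contrapT => H; move/eqP: u0; apply; apply: Cn_eq => k.
    by apply: contrapT => /eqP Hk; apply: H; exists k; move: Hk; rewrite /coord !mxE.
  rewrite /a (bigD1 k)//= ltr_pwDl ?sqn_gt0// sumr_ge0// => i _.
  by rewrite /sqn addr_ge0// sqr_ge0.
pose b := (Num.sqrt a)^-1.
have b0 : 0 < b by rewrite invr_gt0 sqrtr_gt0.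
have b1 : \sum_k sqn k (b *: u) = 1.
  rewrite (_ : \sum_k _ = b ^+ 2 * a); last first.
    by rewrite mulr_sumr; apply: eq_bigr => k _; rewrite /sqn /= !mxE; ring.
  by rewrite /b exprVn sqr_sqrtr ?mulVf// ?gt_eqF// ltW.
have Tbu : tangent_eq y (b *: u).
  rewrite /tangent_eq !cderive_scalel ?Tu//; [exact: csmooth_cdiff cq I|exact: csmooth_cdiff cP I].
have sp := smooth_potc; have := yS _ b1 Tbu; rewrite (KopZl b u _ sp dy).
by rewrite (Kop_sym od (b *: u) u sp dy) (KopZl b u u sp dy) !pmulr_rgt0.
Qed.

Lemma open_positive_region : open positive_region.
Proof. exact: open_interior. Qed.

Lemma positive_region_dom z : positive_region z -> dom z.
Proof. by move=> /interior_subset []. Qed.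

(** On a tangent vector [u] and its multiple [iu], which is tangent as well, the form
    takes the value [- (i/2) Kop potc u u], and it is hence nondegenerate. *)
Lemma omega_check_symplectic :
  symplectic_on (Yt p t `&` positive_region) (omega_check lam rho p t c).
Proof.
have od := open_dom; have wE z u v : dom z -> _ := @omega_check_Kop z u v.
split.
- exists dom; split => //; first by move=> z [_ /positive_region_dom].
  exact: (is_form2_Kop od smooth_potc wE).
- move=> z [_ /positive_region_dom dz] u1 u2 u3 _ _ _.
  exact: (closed_Kop od _ _ _ smooth_potc wE dz).
- move=> z [/Yt_eq Pq Wz] u Tu u0; have dz := positive_region_dom Wz.
  have Eu : tangent_eq z u by apply: tangent_tangent_eq Tu => y [].
  exists (Jc u).
    apply: (tangent_eq_tangent open_positive_region Wz (rest_prod_neq0 dz) Pq).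
    exact: tangent_eqJ.
  have [_ Wpos] := interior_subset Wz.
  rewrite wE// JcK eq_complex /= negb_and; apply/orP; right.
  have -> : Kop potc u (- u) z = - Kop potc u u z.
    by rewrite -scaleN1r (Kop_sym od (-1 *: u) u smooth_potc dz) (KopZl (-1) u u smooth_potc dz) mulN1r.
  by rewrite mulf_eq0 oppr_eq0 invr_eq0 pnatr_eq0 orbF gt_eqF// Wpos.
Qed.

(** * The fibre as an isotropic submanifold *)

Section Fibre.
Variables (r : 'I_m -> R) (U : set C).
Hypothesis r_gt0 : forall j, 0 < r j.
Hypothesis oU : open U.
Hypothesis U_p : forall z, U z -> p (zprime z) != 0.

Definition fibre : set C := Src lam p t c r `&` Yt p t `&` U.

Lemma fibre_dom z : fibre z -> dom z.
Proof.
move=> [[_ /Yt_eq Pq] /U_p pz]; have q0 : tp z != 0 by rewrite mulf_neq0.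
by split => //; rewrite Pq.
Qed.

Lemma fibre_Yt z : fibre z -> coords_prod z = tp z.
Proof. by move=> [[_ /Yt_eq]]. Qed.

Lemma fibre_sqn z j : fibre z -> sqn (rshift l.+1 j) z = r j ^+ 2.
Proof. by move=> [[[rz _] _] _]; rewrite -cmod_coord rz. Qed.

Lemma fibre_phi z k : fibre z -> expR (phi k z) = c k + elog c (tau z).
Proof.
move=> Lz; have dz := fibre_dom Lz; have [[[_ H] _] _] := Lz.
by move: (H k); rewrite eta_tau// expR_phi// -cmod_coord.
Qed.

(** The equation of [S_(r,c)] with index 0 follows from those of index [1, ..., l] and
    the equation of [Y_t], because [prod_k exp phi_k = kappa = prod_k (c_k + eta)] on
    [Y_t]. *)
Lemma fibreP z : dom z -> U z -> coords_prod z = tp z ->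
  (forall j, sqn (rshift l.+1 j) z = r j ^+ 2) ->
  (forall k : 'I_l, expR (phi (lift ord0 k) z) = c (lift ord0 k) + elog c (tau z)) ->
  fibre z.
Proof.
move=> dz Uz Pq zj zk.
have E0 : expR (phi ord0 z) = c ord0 + elog c (tau z).
  have := sum_phi dz; rewrite Pq subrK => /(congr1 (@expR R)).
  rewrite big_ord_recl expRD => E; have P := prod_elog c0 c_ge0 (tau z).
  have rest : expR (\sum_(i < l) phi (lift ord0 i) z) =
      \prod_(i < l) (c (lift ord0 i) + elog c (tau z)).
    elim/big_ind2: _ => [|x1 x2 y1 y2 <- <-|k _]; [by rewrite expR0 | by rewrite expRD |].
    exact: zk.
  move: P; rewrite big_ord_recl -rest -E => /mulIf <-//.
  by rewrite gt_eqF// expR_gt0.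
split => //; split => //; split => [j|k].
  by apply/eqP; rewrite -(eqrXn2 (n := 2))// ?cmod_ge0 ?ltW// cmod_coord zj.
rewrite cmod_coord -expR_phi// eta_tau//.
by case: (unliftP ord0 k) => [k' ->|->].
Qed.

Lemma fibre_tangent_eq z u : tangent fibre z u -> tangent_eq z u.
Proof. by apply: tangent_tangent_eq => y [[]]. Qed.

Lemma dd_level k z u : dom z ->
  dd u (fun z => expR (phi k z) - elog c (tau z)) z =
  expR (phi k z) * dd u (phi k) z - harm c (elog c (tau z)) * dd u tau z.
Proof.
move=> dz; have dp := smooth_differentiable (smooth_phi k) dz.
have dt := smooth_differentiable smooth_tau dz.
have de : differentiable (@expR R) (phi k z) by exact: smooth_differentiable smooth_expR _.
have dl := differentiable_elog c0 c_ge0 (tau z).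
rewrite (@ddB _ _ (@expR R \o phi k) (elog c \o tau)); [|exact: differentiable_comp..].
by rewrite (dd_comp1 u dp de) (dd_comp1 u dt dl) dd1_expR dd_elog.
Qed.

Lemma smooth_level k : smooth dom (fun z => expR (phi k z) - elog c (tau z)).
Proof.
have od := open_dom; apply: smoothB => //.
  by apply: (smooth_comp1 od (A := setT)) => //; [exact: smooth_phi | exact: smooth_expR].
by apply: (smooth_comp1 od (A := setT)) => //; [exact: smooth_tau | exact: smooth_elog].
Qed.

Lemma fibre_level_eq z u : fibre z -> tangent fibre z u -> level_eq z u.
Proof.
move=> Lz Tu; have dz := fibre_dom Lz; split => [j|k].
  by apply: (tangent_dd0 (a := r j ^+ 2) Tu); [exact: sqn_diff | move=> y /fibre_sqn].
have : dd u (fun z => expR (phi k z) - elog c (tau z)) z = 0.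
  apply: (tangent_dd0 (a := c k) Tu); first exact: smooth_differentiable (smooth_level k) dz.
  by move=> y /fibre_phi ->; rewrite addrK.
by rewrite dd_level// fibre_phi// => /eqP; rewrite subr_eq0 => /eqP.
Qed.

Lemma fibre_isotropic z u v : fibre z -> tangent fibre z u -> tangent fibre z v ->
  omega_check lam rho p t c z u v = 0.
Proof.
move=> Lz Tu Tv; have dz := fibre_dom Lz.
rewrite omega_check_Kop// potc_isotropic ?mul0r//.
- exact: fibre_Yt.
- by move=> k; exact: fibre_phi.
- exact: fibre_tangent_eq.
- exact: fibre_tangent_eq.
- exact: fibre_level_eq.
- exact: fibre_level_eq.
Qed.

Lemma fibre_positive z : kahler_potential (fun z : C => (potential lam rho z)%:C) ->
  fibre z -> positive_region z.
Proof.
move=> kahl Lz; apply: positive_regionP; first exact: fibre_dom.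
move=> u Tu u0; apply: potc_gt0 => //; first exact: fibre_dom.
  exact: fibre_Yt.
by move=> k; exact: fibre_phi.
Qed.

Definition mkvec (b : R[i]) (a : 'I_(l + m) -> R[i]) : C :=
  (\row_i (if unlift ord0 i is Some j then complex.Re (a j) else complex.Re b),
   \row_i (if unlift ord0 i is Some j then complex.Im (a j) else complex.Im b)).

Lemma coord_mkvec_il b a i : coord (mkvec b a) (il i) = a i.
Proof. by rewrite /coord /= !mxE liftK; case: (a i). Qed.

Lemma coord_mkvec0 b a : coord (mkvec b a) i0 = b.
Proof. by rewrite /coord /= !mxE unlift_none; case: b. Qed.

Lemma coord_mkvec_rshift b a j : coord (mkvec b a) (rshift l.+1 j) = a (rshift l j).
Proof. by rewrite il_rshift coord_mkvec_il. Qed.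

Lemma coord_mkvec_lshift b a (k : 'I_l) :
  coord (mkvec b a) (lshift m (lift ord0 k)) = a (lshift m k).
Proof. by rewrite il_lshift coord_mkvec_il. Qed.

Lemma dd_sqn_scaled z v k (y : R) : coord v k = y%:C * coord z k ->
  dd v (sqn k) z = 2 * y * sqn k z.
Proof.
rewrite /coord; simpc => -[e1 e2]; rewrite dd_sqn e1 e2 /sqn; ring.
Qed.

Lemma dd_phi_scaled k z v (y : R) : dom z ->
  coord v (lshift m k) = y%:C * coord z (lshift m k) ->
  dd v (phi k) z = dd (zprime v) (lnlam k) (zprime z) + 2 * y.
Proof.
move=> dz e; rewrite dd_phi//; congr (_ + _).
have n0 : sqn (lshift m k) z != 0 by rewrite gt_eqF// sqn_gt0 dom_coord.
rewrite dd_lnsqn// -dd_sqn (dd_sqn_scaled e); by field.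
Qed.

Lemma dd_tau_zprime z u v : dom z -> zprime u = zprime v -> dd u tau z = dd v tau z.
Proof.
move=> dz uv; rewrite -(subrK v u) dd_addl; last exact: smooth_differentiable smooth_tau dz.
rewrite dd_tau_vertical ?add0r// -scaleN1r addrC zprime_lin uv.
by rewrite scaleN1r addNr.
Qed.

(** The differentials of the equations form a triangular system: the moduli |z_j| for
    j in I' are prescribed first, then |z_k| for 0 < k <= l, and finally z_0. *)
Lemma fibre_submersion z (bj : 'I_m -> R) (bk : 'I_l -> R) (b : R[i]) : dom z ->
  exists v : C, [/\ forall j, dd v (sqn (rshift l.+1 j)) z = bj j,
    forall k : 'I_l, dd v (fun z => expR (phi (lift ord0 k) z) - elog c (tau z)) z = bk k &
    cderive v (fun z => coords_prod z - tp z) z = b].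
Proof.
move=> dz; have n0 := rest_prod_neq0 dz.
pose aj j : R := bj j / (2 * sqn (rshift l.+1 j) z).
pose v1 : C := mkvec 0 (fun i => (if fintype.split i is inr j then aj j else 0)%:C * coord z (il i)).
pose yk (k : 'I_l) : R :=
  ((bk k + harm c (elog c (tau z)) * dd v1 tau z) / expR (phi (lift ord0 k) z)
    - dd (zprime v1) (lnlam (lift ord0 k)) (zprime z)) / 2.
pose a i : R := match fintype.split i with inl k => yk k | inr j => aj j end.
pose v2 (x : R[i]) : C := mkvec x (fun i => (a i)%:C * coord z (il i)).
have split_l (k : 'I_l) : fintype.split (lshift m k) = inl k by exact: (unsplitK (inl k)).
have split_r (j : 'I_m) : fintype.split (rshift l j) = inr j by exact: (unsplitK (inr j)).
have zp x : zprime (v2 x) = zprime v1.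
  rewrite /zprime; congr pair; apply/rowP => j; rewrite ![in LHS]mxE ![in RHS]mxE;
  by rewrite il_rshift liftK /a split_r.
have [cP _] := CR_coords_prod; have [cq _] := CR_tp.
have dP := csmooth_cdiff cP (I : [set: C] z); have dq := csmooth_cdiff cq (I : [set: C] z).
pose x := (b - cderive (v2 0) (fun z => coords_prod z - tp z) z) / rest_prod z.
exists (v2 x); split.
- move=> j; have e : coord (v2 x) (rshift l.+1 j) = (aj j)%:C * coord z (rshift l.+1 j).
    by rewrite coord_mkvec_rshift /a split_r il_rshift.
  rewrite (dd_sqn_scaled e) /aj.
  have sn0 : sqn (rshift l.+1 j) z != 0 by rewrite gt_eqF// sqn_gt0 dom_coord.
  by field.
- move=> k; rewrite dd_level//.
  have e : coord (v2 x) (lshift m (lift ord0 k)) = (yk k)%:C * coord z (lshift m (lift ord0 k)).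
    by rewrite coord_mkvec_lshift /a split_l il_lshift.
  rewrite (dd_phi_scaled dz e) zp (dd_tau_zprime dz (zp x)) /yk.
  have en0 : expR (phi (lift ord0 k) z) != 0 by rewrite gt_eqF// expR_gt0.
  by abstract_dd; field.
- have w0 i : coord (v2 x - v2 0) (il i) = 0 by rewrite coordB !coord_mkvec_il subrr.
  rewrite -(subrK (v2 0) (v2 x)) cderive_addl; last first.
    by apply: csmooth_cdiff (csmoothB oT cP cq) I.
  rewrite [X in X + _]cderiveB// cderive_tp0; last exact: zprime_sub0.
  by rewrite subr0 (cderive_coords_prod0 _ w0) coordB !coord_mkvec0 subr0 divfK// subrK.
Qed.

(** Equations indexed by an arbitrary finite type, as the fibre has equations of
    several kinds. *)
Lemma real_submanifold_of_equations (d : nat) (M : set C) (I : finType) :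
  (d + #|I| = 2 * (l.+1 + m))%N ->
  (forall z, M z -> exists (W : set C) (F : I -> C -> R),
    [/\ open W /\ W z, forall i, smooth W (F i),
        forall b : I -> R, exists v, forall i, dd v (F i) z = b i &
        M `&` W = W `&` [set x | forall i, F i x = 0]]) ->
  real_submanifold d M.
Proof.
move=> dI H z Mz; have [W [F [oW sF subF E]]] := H z Mz.
exists #|I|, W, (fun i => F (enum_val i)); split => //.
  move=> b; have [v vE] := subF (fun x => b (enum_rank x)).
  by exists v => i; have := vE (enum_val i); rewrite ddE enum_valK.
rewrite E; apply/seteqP; split => x /= [Wx Fx]; split => // i.
by have := Fx (enum_rank i); rewrite enum_rankK.
Qed.

Lemma fibre_submanifold : real_submanifold (l + m) fibre.
Proof.
apply: (@real_submanifold_of_equations _ _ (('I_m + 'I_l) + bool)%type).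
  by rewrite !card_sum !card_ord card_bool mul2n -addnn addn2 !(addnS, addSn) (addnC m l).
move=> z Lz; have dz := fibre_dom Lz; have od := open_dom.
have Uz : U z by case: Lz.
pose F (i : ('I_m + 'I_l) + bool) (y : C) : R :=
  match i with
  | inl (inl j) => sqn (rshift l.+1 j) y - r j ^+ 2
  | inl (inr k) => expR (phi (lift ord0 k) y) - elog c (tau y) - c (lift ord0 k)
  | inr true => complex.Re (coords_prod y - tp y)
  | inr false => complex.Im (coords_prod y - tp y)
  end.
have [cP _] := CR_coords_prod; have [cq _] := CR_tp.
have [sr si] : csmooth setT (fun y => coords_prod y - tp y) by exact: csmoothB.
exists (dom `&` U), F; split.
- by split => //; exact: openI.
- move=> i; apply: (@smooth_sub _ _ dom); first by move=> y [].
  case: i => [[j|k]|[]] /=.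
  + by apply: smoothB => //; [exact: smooth_sqn | exact: smooth_cst].
  + by apply: smoothB => //; [exact: smooth_level | exact: smooth_cst].
  + exact: smooth_sub sr.
  + exact: smooth_sub si.
- move=> b.
  have [v [vj vk vc]] := fibre_submersion (fun j => b (inl (inl j)))
    (fun k => b (inl (inr k))) (b (inr true) +i* b (inr false)) dz.
  exists v => -[[j|k]|[]] /=.
  + rewrite /F ddB; [|exact: sqn_diff|exact: differentiable_cst].
    by rewrite dd_cst subr0 vj.
  + rewrite /F ddB; [|exact: smooth_differentiable (smooth_level _) dz|exact: differentiable_cst].
    by rewrite dd_cst subr0 vk.
  + by move: vc; rewrite cderiveE => -[].
  + by move: vc; rewrite cderiveE => -[].
- apply/seteqP; split => y /=.
    move=> [Ly [dy Uy]]; split => // -[[j|k]|[]] /=.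
    + by rewrite fibre_sqn// subrr.
    + by rewrite fibre_phi// addrK subrr.
    + by rewrite fibre_Yt// subrr.
    + by rewrite fibre_Yt// subrr.
  move=> [[dy Uy] Fy]; split => //; apply: fibreP => //.
  + apply/eqP; rewrite -subr_eq0; apply/eqP; apply: complex_eq.
      exact: (Fy (inr true)).
    exact: (Fy (inr false)).
  + by move=> j; apply/eqP; rewrite -subr_eq0; apply/eqP; exact: (Fy (inl (inl j))).
  + move=> k; have := Fy (inl (inr k)); rewrite /F => /eqP.
    by rewrite subr_eq0 subr_eq => /eqP.
Qed.

(** * The phase of the volume form on the fibre *)

(** The coordinate [z_0] is left constant; it will be determined by the equation of
    [Y_t]. *)
Definition rotation (th : 'I_(l + m) -> R) (rh : 'I_(l + m) -> R -> R) z (s : R) : C :=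
  mkvec (coord z i0) (fun i => (rh i s)%:C * ((cos (th i * s) +i* sin (th i * s)) * coord z (il i))).

Lemma csqr_rotation (x s : R) (a : R[i]) :
  csqr (x%:C * ((cos s +i* sin s) * a)) = x ^+ 2 * csqr a.
Proof.
rewrite !csqrM (_ : csqr (cos s +i* sin s) = 1) ?mul1r; last by rewrite /csqr /= cos2Dsin2.
by rewrite /csqr /= expr0n addr0.
Qed.

Lemma sqnE z k : sqn k z = csqr (coord z k).
Proof. by []. Qed.

Lemma sqn_rotation th rh z s i : sqn (il i) (rotation th rh z s) = rh i s ^+ 2 * sqn (il i) z.
Proof. by rewrite !sqnE coord_mkvec_il csqr_rotation. Qed.

Lemma rotation0 th rh z : (forall i, rh i 0 = 1) -> rotation th rh z 0 = z.
Proof.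
move=> rh1; apply: Cn_eq0; first by rewrite coord_mkvec0.
move=> i; rewrite coord_mkvec_il rh1 mulr0 cos0 sin0; simpc.
by [].
Qed.

Lemma dd_scal (a x : R) : dd (1 : R) (fun s : R => a * s) x = a.
Proof. by rewrite ddMc// ddE derive_id mulr1. Qed.

Lemma derive_cos_scal (a x : R) : differentiable (fun s : R => cos (a * s)) x /\
  dd (1 : R) (fun s : R => cos (a * s)) x = - sin (a * x) * a.
Proof.
have d1 : differentiable (fun s : R => a * s) x by exact: differentiableM.
have d2 : differentiable (@cos R) (a * x) by exact/derivable1_diffP.
split; first exact: (@differentiable_comp _ _ _ _ (fun s : R => a * s) (@cos R)).
rewrite (@dd_comp1 _ _ (fun s : R => a * s) (@cos R))// dd_scal.
by rewrite ddE derive_val.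
Qed.

Lemma derive_sin_scal (a x : R) : differentiable (fun s : R => sin (a * s)) x /\
  dd (1 : R) (fun s : R => sin (a * s)) x = cos (a * x) * a.
Proof.
have d1 : differentiable (fun s : R => a * s) x by exact: differentiableM.
have d2 : differentiable (@sin R) (a * x) by exact/derivable1_diffP.
split; first exact: (@differentiable_comp _ _ _ _ (fun s : R => a * s) (@sin R)).
rewrite (@dd_comp1 _ _ (fun s : R => a * s) (@sin R))// dd_scal.
by rewrite ddE derive_val.
Qed.

Lemma rotation_derive (th : 'I_(l + m) -> R) (rh : 'I_(l + m) -> R -> R) z : (forall i, rh i 0 = 1) ->
  (forall i, differentiable (rh i) (0 : R)) ->
  differentiable (rotation th rh z) (0 : R) /\
  forall i, coord ('D_(1 : R) (rotation th rh z) 0) (il i) =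
    (dd (1 : R) (rh i) 0 +i* th i) * coord z (il i).
Proof.
move=> rh1 drh.
pose x i : R := z.1 0 (il i); pose y i : R := z.2 0 (il i).
pose fre i (s : R) : R := rh i s * (cos (th i * s) * x i - sin (th i * s) * y i).
pose fim i (s : R) : R := rh i s * (cos (th i * s) * y i + sin (th i * s) * x i).
have e1 i : (fun s => (rotation th rh z s).1 0 (il i)) = fre i.
  apply/funext => s; transitivity (complex.Re (coord (rotation th rh z s) (il i))) => //.
  by rewrite coord_mkvec_il 2!Re_mul Im_mul /= mul0r subr0.
have e2 i : (fun s => (rotation th rh z s).2 0 (il i)) = fim i.
  apply/funext => s; transitivity (complex.Im (coord (rotation th rh z s) (il i))) => //.
  by rewrite coord_mkvec_il 2!Im_mul Re_mul /= mul0r addr0.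
have dc i := (derive_cos_scal (th i) 0).1; have ds i := (derive_sin_scal (th i) 0).1.
have dcx i a : differentiable (fun s : R => cos (th i * s) * a) (0 : R).
  by apply: differentiableM.
have dsx i a : differentiable (fun s : R => sin (th i * s) * a) (0 : R).
  by apply: differentiableM.
have dre i : differentiable (fre i) (0 : R).
  by apply: differentiableM => //; exact: differentiableB.
have dim i : differentiable (fim i) (0 : R).
  by apply: differentiableM => //; exact: differentiableD.
have dr : differentiable (rotation th rh z) (0 : R).
  apply: differentiable_Cn => i; case: (unliftP (ord0 : 'I_(l.+1 + m)) i) => [j ->|->].
  - by rewrite e1.
  - by under eq_fun do rewrite mxE unlift_none.
  - by rewrite e2.
  - by under eq_fun do rewrite mxE unlift_none.
split => // i; rewrite (derive_coord (il i) dr) e1 e2 /fre /fim.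
have gB : differentiable (fun s : R => cos (th i * s) * x i - sin (th i * s) * y i) (0 : R).
  by apply: differentiableB.
have gD : differentiable (fun s : R => cos (th i * s) * y i + sin (th i * s) * x i) (0 : R).
  by apply: differentiableD.
rewrite (ddM _ (drh i) gB) (ddM _ (drh i) gD).
have cD a : dd (1 : R) (fun s : R => cos (th i * s) * a) 0 = 0.
  by rewrite ddM// dd_cst (derive_cos_scal _ _).2 !mulr0 sin0 oppr0 mul0r mulr0 addr0.
have sD a : dd (1 : R) (fun s : R => sin (th i * s) * a) 0 = a * th i.
  by rewrite ddM// dd_cst (derive_sin_scal _ _).2 !mulr0 cos0 mul1r add0r.
rewrite ddB// ddD// !cD !sD rh1 !mulr0 cos0 sin0.
apply: complex_eq; rewrite ?Re_mul ?Im_mul /= -/(x i) -/(y i).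
  by rewrite !mul1r mul0r sub0r subr0 addrC mulrC [y i * _]mulrC.
by rewrite !mul1r mul0r add0r addr0 addrC mulrC [x i * _]mulrC.
Qed.

(** The square root of [(a + T s) / (a + T 0)], obtained from the logarithm. *)
Lemma sqrt_ratio (T : R -> R) (a : R) : differentiable T (0 : R) -> (forall s, 0 < a + T s) ->
  exists rk : R -> R, [/\ differentiable rk (0 : R), rk 0 = 1 &
    forall s, rk s ^+ 2 * (a + T 0) = a + T s].
Proof.
move=> dT T_gt0.
pose L s : R := ln (a + T s).
have d0 : differentiable (fun s => a + T s) (0 : R) by exact: differentiableD.
have d1 : differentiable L (0 : R).
  by apply: (@differentiable_comp _ _ _ _ (fun s => a + T s) (@ln R)) => //; exact: differentiable_ln.
pose h s : R := 2^-1 * (L s - L 0).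
have d2 : differentiable h (0 : R).
  have d3 : differentiable (fun s => L s - L 0) (0 : R).
    exact: (differentiableB d1 (differentiable_cst (L 0) _)).
  exact: (differentiableM (differentiable_cst (2^-1 : R) _) d3).
exists (@expR R \o h); split.
- by apply: differentiable_comp => //; exact: smooth_differentiable smooth_expR _.
- by rewrite /= /h subrr mulr0 expR0.
- move=> s; rewrite /= expr2 -expRD /h -mulrDl.
  have -> : 2^-1 + 2^-1 = 1 :> R by field.
  by rewrite mul1r expRB !lnK ?posrE// divfK// gt_eqF.
Qed.

(** The curve starts as a rotation [h1] of [z_1, ..., z_n]; as [tau] depends on [z']
    only, the value [T] of [eta] along it is known before the moduli of [z_1, ..., z_l]
    are corrected to [sqrt ((c_k + T) / lambda_k)], and [z_0] is solved for last. *)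
Lemma fibre_tangent_rotation z (th : 'I_(l + m) -> R) : fibre z ->
  exists2 v, tangent fibre z v & forall i, complex.Im (coord v (il i) / coord z (il i)) = th i.
Proof.
move=> Lz; have dz := fibre_dom Lz; have n0 := rest_prod_neq0 dz; have Pq := fibre_Yt Lz.
have od := open_dom.
pose h1 := rotation th (fun _ _ => 1) z.
have [dh1 _] : differentiable h1 (0 : R) /\ _ := rotation_derive th z (fun=> erefl) (fun=> differentiable_cst _ _).
have h10 : h1 0 = z by exact: rotation0.
pose T s := elog c (tau (h1 s)).
have T0 : T 0 = elog c (tau z) by rewrite /T h10.
have dT : differentiable T (0 : R).
  apply: (@differentiable_comp _ _ _ _ (tau \o h1) (elog c)).
    by apply: differentiable_comp => //; rewrite h10; exact: smooth_differentiable smooth_tau dz.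
  exact: differentiable_elog.
have T_gt0 s k : 0 < c k + T s by exact: c_elog_gt0.
have Hrk (k : 'I_l) := sqrt_ratio dT (fun s => T_gt0 s (lift ord0 k)).
pose rk k := sval (cid (Hrk k)).
have drk k : differentiable (rk k) (0 : R) by rewrite /rk; case: cid => ? [].
have rk1 k : rk k 0 = 1 by rewrite /rk; case: cid => ? [].
have rkE k s : rk k s ^+ 2 * (c (lift ord0 k) + T 0) = c (lift ord0 k) + T s.
  by rewrite /rk; case: cid => ? [].
pose rh (i : 'I_(l + m)) : R -> R := if fintype.split i is inl k then rk k else fun=> 1.
have rh1 i : rh i 0 = 1 by rewrite /rh; case: (fintype.split i).
have drh i : differentiable (rh i) (0 : R).
  by rewrite /rh; case: (fintype.split i) => // _; exact: differentiable_cst.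
pose h := rotation th rh z.
have [dh Dh] := rotation_derive th z rh1 drh.
have h0 : h 0 = z by exact: rotation0.
have split_l (k : 'I_l) : rh (lshift m k) = rk k.
  by rewrite /rh (_ : fintype.split _ = inl k)//; exact: (unsplitK (inl k)).
have split_r (j : 'I_m) : rh (rshift l j) = fun=> 1.
  by rewrite /rh (_ : fintype.split _ = inr j)//; exact: (unsplitK (inr j)).
have zph s : zprime (h s) = zprime (h1 s).
  rewrite /zprime; congr pair; apply/rowP => j; rewrite ![in LHS]mxE ![in RHS]mxE;
  by rewrite il_rshift liftK split_r.
have hL : \forall s \near (0 : R), fibre (solve0 (h s)).
  have N := near_solve0 (openI od oU) (conj dz (proj2 Lz)) n0 Pq h0 dh.
  apply: filterS N => s [/Yt_eq Ys [ds Us]]; apply: fibreP => //.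
    by move=> j; rewrite il_rshift sqnE coord_set0c_il -sqnE sqn_rotation split_r
      expr1n mul1r -il_rshift fibre_sqn.
  move=> k; rewrite expR_phi// zprime_set0c.
  have -> : tau (solve0 (h s)) = tau (h1 s) by rewrite !tauE zprime_set0c zph.
  have -> : lamz (lift ord0 k) (zprime (h s)) = lamz (lift ord0 k) (zprime z).
    rewrite /lamz; congr (lam _ _); rewrite !sqmodsE; apply/rowP => j; rewrite !mxE !sqn_zprime.
    by rewrite !il_rshift sqn_rotation split_r expr1n mul1r.
  rewrite il_lshift sqnE coord_set0c_il -sqnE sqn_rotation split_l mulrCA -il_lshift.
  have := fibre_phi (lift ord0 k) Lz; rewrite expR_phi// => ->.
  by rewrite -T0; exact: rkE.
have [v Tv vE] := solve0_tangent n0 Pq h0 dh hL.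
exists v => // i; rewrite vE Dh mulfK//.
by apply: dom_coord.
Qed.

Definition rotvec z (j : 'I_m) : C :=
  mkvec 0 (fun i => if i == rshift l j then 'i%C * coord z (il i) else 0).

(** The matrix expressing the logarithmic derivatives along the fibre by the angular
    velocities. The moduli |z_j|, j in I', are constant, which gives the last columns.
    For 0 < k <= l, the derivative of [log |z_k| = (log (c_k + eta) - log lambda_k) / 2]
    is [d eta / (2 (c_k + eta))], a combination of the angular velocities of the z_j. *)
Definition phase_mx z : 'M[R[i]]_(l + m) :=
  block_mx ('i%C)%:M 0
    (\matrix_(j, k) (harm c (elog c (tau z)) * dd (rotvec z j) tau z
       / (2 * (c (lift ord0 k) + elog c (tau z))))%:C)
    ('i%C)%:M.

Definition angles z (v : 'I_(l + m) -> C) : 'M[R]_(l + m) :=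
  \matrix_(i, k) complex.Im (coord (v i) (il k) / coord z (il k)).

Lemma Re_div_sqn z u k : coord z k != 0 ->
  dd u (sqn k) z = 2 * complex.Re (coord u k / coord z k) * sqn k z.
Proof.
move=> z0; have n0 : sqn k z != 0 by rewrite gt_eqF// sqn_gt0.
by rewrite dd_sqn Re_mul Re_inv Im_inv /=; move: n0; rewrite /sqn => n0; field.
Qed.

Lemma fibre_log_imaginary z u j : fibre z -> tangent fibre z u ->
  complex.Re (coord u (rshift l.+1 j) / coord z (rshift l.+1 j)) = 0.
Proof.
move=> Lz Tu; have [/(_ j) + _] := fibre_level_eq Lz Tu.
have z0 := dom_coord (rshift l.+1 j) (fibre_dom Lz); rewrite Re_div_sqn// => /eqP.
by rewrite !mulf_eq0 pnatr_eq0/= (gt_eqF (_ : 0 < sqn _ _)) ?sqn_gt0// orbF => /eqP.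
Qed.

Lemma dd_tau_fibre z u : fibre z -> tangent fibre z u ->
  dd u tau z = \sum_j complex.Im (coord u (rshift l.+1 j) / coord z (rshift l.+1 j))
                * dd (rotvec z j) tau z.
Proof.
move=> Lz Tu; have dz := fibre_dom Lz.
have dt := smooth_differentiable smooth_tau dz.
transitivity (dd (\sum_j complex.Im (coord u (rshift l.+1 j) / coord z (rshift l.+1 j))
   *: rotvec z j) tau z); last first.
  by rewrite dd_suml//; apply: eq_bigr => j _; rewrite dd_scalel.
apply: dd_tau_zprime => //.
have cs (F : 'I_m -> C) i : coord (\sum_j F j) i = \sum_j coord (F j) i.
  elim: (index_enum _) => [|j s IH]; first by rewrite !big_nil /coord /= !mxE.
  by rewrite !big_cons -IH /coord /= !mxE.
apply: Cn_eq => j; rewrite !coord_zprime cs (bigD1 j)//= big1 ?addr0; last first.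
  move=> i ij; rewrite [LHS](_ : _ = (complex.Im (coord u (rshift l.+1 i) / coord z (rshift l.+1 i)))%:C *
     coord (rotvec z i) (rshift l.+1 j)).
    by rewrite coord_mkvec_rshift eq_rshift eq_sym (negbTE ij) mulr0.
  by rewrite /coord /= !mxE; simpc.
rewrite [RHS](_ : _ = (complex.Im (coord u (rshift l.+1 j) / coord z (rshift l.+1 j)))%:C *
     coord (rotvec z j) (rshift l.+1 j)); last by rewrite /coord /= !mxE; simpc.
rewrite coord_mkvec_rshift eqxx -il_rshift.
have z0 := dom_coord (rshift l.+1 j) dz.
have re0 := fibre_log_imaginary j Lz Tu.
rewrite -[LHS](divfK z0) mulrA; congr (_ * _).
by rewrite [LHS]complexE re0 add0r mulrC.
Qed.

Lemma logmx_phase z (v : 'I_(l + m) -> C) : fibre z -> (forall i, tangent fibre z (v i)) ->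
  logmx z v = map_mx (real_complex R) (angles z v) *m phase_mx z.
Proof.
move=> Lz Tv; have dz := fibre_dom Lz.
rewrite -[map_mx _ _]hsubmxK /phase_mx mul_row_block mulmx0 add0r !mul_mx_scalar.
apply/matrixP => i k; rewrite [LHS]mxE; case: (fintype.split_ordP k) => [k' ->|j ->].
  rewrite row_mxEl !mxE -il_lshift; set a := coord (v i) _ / _.
  have [vj vk] := fibre_level_eq Lz (Tv i).
  have z0 := dom_coord (lshift m (lift ord0 k')) dz.
  have A0 : 0 < c (lift ord0 k') + elog c (tau z) by exact: c_elog_gt0.
  have rea : complex.Re a = harm c (elog c (tau z)) * dd (v i) tau z
       / (2 * (c (lift ord0 k') + elog c (tau z))).
    have := vk (lift ord0 k'); rewrite dd_phi// dd_lnsqn// -dd_sqn Re_div_sqn// -/a.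
    rewrite dd_lnlam dd_sqmods_torus//; last by move=> j; rewrite -dd_sqn_zprime vj.
    have n0 : sqn (lshift m (lift ord0 k')) z != 0 by rewrite gt_eqF// sqn_gt0.
    move=> <-; have := lt0r_neq0 A0 => n1.
    by field; rewrite n1 n0 gt_eqF// lamz_gt0.
  rewrite [LHS]complexE addrC; congr (_ + _).
  rewrite rea (dd_tau_fibre Lz (Tv i)) mulr_sumr mulr_suml rmorph_sum.
  apply: eq_bigr => j _; rewrite !mxE -il_rshift -rmorphM; congr (_%:C).
  by move: (complex.Im _) (dd _ _ _) => x y; ring.
rewrite row_mxEr !mxE -il_rshift; set a := coord (v i) _ / _.
have re0 : complex.Re a = 0 by exact: fibre_log_imaginary.
by rewrite [LHS]complexE re0 add0r.
Qed.

Lemma det_phase_mx z : \det (phase_mx z) = 'i%C ^+ (l + m).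
Proof. by rewrite det_lblock !det_scalar exprD. Qed.

(** The factorization of [logmx] shows that [Omega_t] is [i^n] times the determinant
    of the angular velocities, which is 1 on vectors given by
    [fibre_tangent_rotation]. *)
Lemma fibre_constant_phase : constant_phase fibre (@Omega_t R l m).
Proof.
have dE z (v : 'I_(l + m) -> C) : fibre z -> (forall i, tangent fibre z (v i)) ->
    Omega_t z v = 'i%C ^+ (l + m) * (\det (angles z v))%:C.
  move=> Lz Tv; rewrite Omega_logmx (logmx_phase Lz Tv) det_mulmx det_phase_mx mulrC.
  by rewrite det_map_mx.
have ci n : cmod ('i%C ^+ n : R[i]) = 1.
  elim: n => [|n IH]; first by rewrite expr0 /cmod Normc.normc1.
  by rewrite exprS cmodM IH mulr1 /cmod /= expr0n expr1n add0r sqrtr1.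
split; last first.
  by exists ('i%C ^+ (l + m)) => // z Lz v Tv; exists (\det (angles z v)); exact: dE.
move=> z Lz.
have H i := fibre_tangent_rotation (fun k => if k == i then 1 else 0) Lz.
pose v i := s2val (cid2 (H i)).
have Tv i : tangent fibre z (v i) by rewrite /v; case: cid2.
exists v => //; rewrite dE// (_ : angles z v = 1%:M) ?det1 ?mulr1.
  by rewrite -cmod_eq0 ci oner_eq0.
apply/matrixP => i k; rewrite !mxE /v; case: cid2 => w _ /= ->.
by rewrite eq_sym; case: eqP.
Qed.

End Fibre.

End Toric.

Theorem theorem2p2 (R : realType) (l m : nat)
    (lam : 'I_l.+1 -> 'rV[R]_m -> R) (rho : 'rV[R]_m -> R)
    (p : 'Cn[R]_m -> R[i]) :
  toric_kahler lam rho ->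
  holomorphic setT p ->
  forall B C : R, 0 < C ->
  exists eps delta : R, [/\ 0 < eps, 0 < delta &
  forall (t : R[i]), t != 0 -> cmod t < delta ->
  forall (c : 'I_l.+1 -> R), c ord0 = 0 ->
    (forall i j : 'I_l.+1, (i <= j)%N -> c i <= c j) ->
  forall (r : 'I_m -> R), (forall j, 0 < r j) ->
  forall (U : set 'Cn[R]_(l.+1 + m)), normal_region p B C eps U ->
  exists W : set 'Cn[R]_(l.+1 + m),
    [/\ open W, Src lam p t c r `&` Yt p t `&` U `<=` W &
        gen_special_lagrangian (Yt p t `&` W) (omega_check lam rho p t c)
          Omega_t (Src lam p t c r `&` Yt p t `&` U)]].
Proof.
move=> [sl sr l0 kahl] hp B C C0; (* Positivity comes from the Kaehler condition on all of C^(n+1), and the thresholds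
   are arbitrary. *)
exists 1, 1; split => // t t0 _ c c0 cmono r r0 U [oU Up].
have c_ge0 k : 0 <= c k by rewrite -c0 cmono.
have U_p z : U z -> p (zprime z) != 0.
  by move=> /Up [_ Cp _ _]; rewrite -cmod_gt0 (lt_le_trans C0).
exists (positive_region lam rho p t c); split.
- exact: open_positive_region.
- move=> z Lz; exact: (fibre_positive sl sr l0 hp t0 c0 c_ge0 U_p kahl Lz).
split.
- split.
  + apply: Yt_submanifold => //; first exact: open_positive_region.
    exact: positive_region_dom.
  + exact: omega_check_symplectic.
  + apply: Omega_volume_form => //; first exact: open_positive_region.
    exact: positive_region_dom.
- split; last exact: fibre_submanifold.
  move=> z Lz; split; first by case: Lz => [[]].
  exact: (fibre_positive sl sr l0 hp t0 c0 c_ge0 U_p kahl Lz).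
- by move=> z Lz u v Tu Tv; apply: fibre_isotropic Tu Tv.
- exact: fibre_constant_phase.
Qed.
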